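(* Let $N\ge3$ and let $\mathbf{B}^{\vee}\subset sl(N)$ be the complex Lie subalgebra with basis $\{H_{1N},E_{1N},E_{1j},E_{jN}\}_{j=2,\dots,N-1}$, where $H_{1N}=E_{11}-E_{NN}$. Let $\xi$ be a formal parameter, $\sigma=\frac12\ln(1+2\xi E_{1N})$, and $$\mathcal{F}=\exp(H_{1N}\otimes\sigma)\prod_{j=2}^{N-1}\exp\left(2\xi E_{1j}\otimes E_{jN}e^{-2\sigma}\right).$$ Twisting $\mathcal{U}(\mathbf{B}^{\vee})[[\xi]]$ by $\mathcal{F}$ gives a triangular Hopf algebra $\mathcal{U}_{\xi}(\mathbf{B}^{\vee})$ with the original multiplication and counit, with coproducts ($i=2,\dots,N-1$) $$\begin{aligned} \Delta_{\mathcal{F}}H_{1N}&=H_{1N}\otimes e^{-2\sigma}+1\otimes H_{1N}-4\xi\sum_{j=2}^{N-1}E_{1j}\otimes E_{jN}e^{-3\sigma},\\ \Delta_{\mathcal{F}}E_{1i}&=E_{1i}\otimes e^{-\sigma}+1\otimes E_{1i},\\ \Delta_{\mathcal{F}}E_{iN}&=E_{iN}\otimes e^{\sigma}+e^{2\sigma}\otimes E_{iN},\\ \Delta_{\mathcal{F}}E_{1N}&=E_{1N}\otimes e^{2\sigma}+1\otimes E_{1N}, \end{aligned}$$ antipode $$\begin{aligned} &S_{\mathcal{F}}(\sigma)=-\sigma,\quad S_{\mathcal{F}}(E_{1i})=-E_{1i}e^{\sigma},\quad S_{\mathcal{F}}(E_{iN})=-E_{iN}e^{-3\sigma},\quad S_{\mathcal{F}}(E_{1N})=-E_{1N}e^{-2\sigma},\\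 &S_{\mathcal{F}}(H_{1N})=-H_{1N}e^{2\sigma}-4\xi\sum_{j=2}^{N-1}E_{1j}E_{jN}, \end{aligned}$$ and universal $R$-matrix $$\mathcal{R}=\mathcal{F}_{21}\mathcal{F}^{-1}=\prod_{j=2}^{N-1}\exp\left(2\xi E_{jN}e^{-\sigma}\otimes E_{1j}\right)\exp(\sigma\otimes H_{1N})\exp(-H_{1N}\otimes\sigma)\prod_{j=2}^{N-1}\exp\left(-2\xi E_{1j}\otimes E_{jN}e^{-\sigma}\right).$$
   Context: $E_{ij}$ are the matrix units, $[E_{ik},E_{lm}]=\delta_{kl}E_{im}-\delta_{im}E_{lk}$. $\mathcal{U}(\mathbf{B}^\vee)$ carries its standard cocommutative Hopf structure $(\Delta,\epsilon,S)$; tensor products are completed $\xi$-adically. Twisting a Hopf algebra by an invertible $\mathcal{F}=\sum f^{(1)}_i\otimes f^{(2)}_i$ satisfying $\mathcal{F}_{12}(\Delta\otimes \mathrm{id})(\mathcal{F})=\mathcal{F}_{23}(\mathrm{id}\otimes\Delta)(\mathcal{F})$ and $(\epsilon\otimes \mathrm{id})(\mathcal{F})=(\mathrm{id}\otimes\epsilon)(\mathcal{F})=1$ means keeping the multiplication and counit and replacing the coproduct and antipode by $\Delta_{\mathcal{F}}(a)=\mathcal{F}\Delta(a)\mathcal{F}^{-1}$, $S_{\mathcal{F}}(a)=vS(a)v^{-1}$, $v=\sum f^{(1)}_iS(f^{(2)}_i)$. $\mathcal{F}_{21}=\tau(\mathcal{F})$ with $\tau(f\otimes g)=g\otimes f$.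 ''Triangular with universal $R$-matrix $\mathcal{R}$'' means $\mathcal{R}\Delta_{\mathcal{F}}(a)\mathcal{R}^{-1}=\tau(\Delta_{\mathcal{F}}(a))$, $(\Delta_{\mathcal{F}}\otimes \mathrm{id})(\mathcal{R})=\mathcal{R}_{13}\mathcal{R}_{23}$, $(\mathrm{id}\otimes\Delta_{\mathcal{F}})(\mathcal{R})=\mathcal{R}_{13}\mathcal{R}_{12}$ and $\mathcal{R}_{21}\mathcal{R}=1$. *)

(* Defs.v *)
From HB Require Import structures.
From mathcomp Require Import all_boot all_order all_algebra.
From mathcomp Require Import boolp classical_sets reals complex.

Set Implicit Arguments.
Unset Strict Implicit.
Unset Printing Implicit Defensive.

Import GRing.Theory.
Local Open Scope ring_scope.
Local Open Scope quotient_scope.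

(* Needed for [1 != 0] in a tensor product of algebras. *)
Lemma exists_functional (K : fieldType) (V : lmodType K) (v : V) :
  v != 0 -> exists2 phi : V -> K^o, linear phi & phi v = 1.
Proof.
move=> v0; pose cl (W : set V) := forall a x y, W x -> W y -> W (a *: x + y).
have [|A [[clA Av] maxA]] := @Zorn_bigcup V (fun W => cl W /\ ~ W v).
  move=> F FP tot; split; last by move=> [X FX /(FP _ FX).2].
  move=> a x y [X FX Xx] [Y FY Yy].
  have [XY|YX] := tot _ _ FX FY.
    by exists Y => //; apply: (FP _ FY).1 => //; apply: XY.
  by exists X => //; apply: (FP _ FX).1 => //; apply: YX.
have A0 : A 0.
  apply: contrapT => nA0; apply: (maxA [set x | A x \/ x = 0]%classic).
    split; first by move=> x; left.
    by move=> h; apply: nA0; apply: h; right.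
  split; last by case=> // /eqP; apply/negP.
  move=> a x y [Ax|->] [Ay|->]; last by right; rewrite scaler0 addr0.
  - by left; apply: clA.
  - left; have -> : a *: x + 0 = (a - 1) *: x + x.
      by rewrite addr0 scalerBl scale1r subrK.
    exact: clA.
  - by left; rewrite scaler0 add0r.
have AZ a x : A x -> A (a *: x) by move=> Ax; rewrite -[_ *: _]addr0; apply: clA.
have AD x y : A x -> A y -> A (x + y) by move=> *; rewrite -[x]scale1r; apply: clA.
have ex x : exists c : K, A (x - c *: v).
  apply: contrapT => nex.
  apply: (maxA [set y | exists c : K, A (y - c *: x)]%classic).
    split=> [y Ay|h]; first by exists 0; rewrite scale0r subr0.
    apply: nex; exists 0; rewrite scale0r subr0; apply: h.
    by exists 1; rewrite scale1r subrr.
  split=> [a y z [c Ac] [d Ad]|[c Ac]].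
    exists (a * c + d); rewrite scalerDl opprD addrACA -scalerA -scalerBr.
    exact: clA.
  have c0 : c != 0 by apply/eqP => c0; apply: Av; move: Ac; rewrite c0 scale0r subr0.
  apply: nex; exists c^-1; have := AZ (- c^-1) _ Ac.
  by rewrite scalerBr scalerA mulNr mulVf // !scaleNr scale1r opprK addrC.
have uniq c : A (c *: v) -> c = 0.
  move=> Ac; apply/eqP; apply: contrapT => /negP c0; apply: Av.
  by have := AZ c^-1 _ Ac; rewrite scalerA mulVf // scale1r.
have [phi phiP] := choice ex.
have phiE x c : A (x - c *: v) -> phi x = c.
  move=> Ac; apply/eqP; rewrite -subr_eq0; apply/eqP/uniq.
  have := AD _ _ Ac (AZ (-1) _ (phiP x)).
  by rewrite scaleN1r opprB scalerBl addrC addrA subrK.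
exists phi => [a x y|]; last by apply: phiE; rewrite scale1r subrr.
have -> : a *: (phi x : K^o) = a * phi x by [].
apply: phiE; rewrite scalerDl -scalerA.
by rewrite opprD addrACA -scalerBr; apply: clA.
Qed.

(** [A (x) B] is the set of formal sums [a_1 (x) b_1 + ... + a_n (x) b_n],
    coded as sequences of pairs, two of them being identified when every
    bilinear map out of [A x B] takes the same value on them. *)

Section Tensor.
Variables (K : fieldType) (A B : lmodType K).

Definition is_bilinear (V : lmodType K) (f : A -> B -> V) :=
  (forall b, linear (f^~ b)) /\ (forall a, linear (f a)).

Definition tens_eval (V : zmodType) (f : A -> B -> V) (s : seq (A * B)) : V :=
  \sum_(p <- s) f p.1 p.2.

Definition tens_rel (s t : seq (A * B)) : bool :=
  `[< forall (V : lmodType K) (f : A -> B -> V),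
        is_bilinear f -> tens_eval f s = tens_eval f t >].

Lemma tens_rel_refl : reflexive tens_rel.
Proof. by move=> s; apply/asboolP. Qed.

Lemma tens_rel_sym : symmetric tens_rel.
Proof.
by move=> s t; apply/asboolP/asboolP => h V f fP; rewrite (h V f fP).
Qed.

Lemma tens_rel_trans : transitive tens_rel.
Proof.
move=> t s u /asboolP st /asboolP tu; apply/asboolP => V f fP.
by rewrite (st V f fP) (tu V f fP).
Qed.

Canonical tens_equiv := EquivRel tens_rel tens_rel_refl tens_rel_sym tens_rel_trans.

Definition tens := {eq_quot tens_equiv}.
HB.instance Definition _ := Choice.on tens.
HB.instance Definition _ := Quotient.on tens.

Definition tpure (a : A) (b : B) : tens := \pi_tens [:: (a, b)].

(** The linear map [tens -> V] with [a (x) b |-> f a b], for [f] bilinear. *)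
Definition tlift (V : zmodType) (f : A -> B -> V) (t : tens) : V :=
  tens_eval f (repr t).

Lemma tens_piP s t : reflect
  (forall (V : lmodType K) (f : A -> B -> V),
     is_bilinear f -> tens_eval f s = tens_eval f t)
  (\pi_tens s == \pi_tens t).
Proof. by rewrite eqquotE; exact: asboolP. Qed.

Lemma tlift_pi (V : lmodType K) (f : A -> B -> V) s :
  is_bilinear f -> tlift f (\pi_tens s) = tens_eval f s.
Proof.
by move=> fP; have /eqP/tens_piP := reprK (\pi_tens s); apply.
Qed.

Lemma tens_ext (t u : tens) :
  (forall (V : lmodType K) (f : A -> B -> V),
     is_bilinear f -> tlift f t = tlift f u) -> t = u.
Proof. by move=> h; rewrite -[t]reprK -[u]reprK; apply/eqP/tens_piP. Qed.

Lemma bilinearDl (V : lmodType K) (f : A -> B -> V) (fP : is_bilinear f) x y b :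
  f (x + y) b = f x b + f y b.
Proof. by have := fP.1 b 1 x y; rewrite !scale1r. Qed.
Lemma bilinear0l (V : lmodType K) (f : A -> B -> V) (fP : is_bilinear f) b :
  f 0 b = 0.
Proof. by have := fP.1 b 1 0 0; rewrite !scale1r addr0 => /eqP; rewrite -subr_eq0 opprD addrA subrr sub0r oppr_eq0 => /eqP. Qed.
Lemma bilinearZl (V : lmodType K) (f : A -> B -> V) (fP : is_bilinear f) c x b :
  f (c *: x) b = c *: f x b.
Proof. by have := fP.1 b c x 0; rewrite !addr0 bilinear0l // addr0. Qed.
Lemma bilinearDr (V : lmodType K) (f : A -> B -> V) (fP : is_bilinear f) a x y :
  f a (x + y) = f a x + f a y.
Proof. by have := fP.2 a 1 x y; rewrite !scale1r. Qed.
Lemma bilinear0r (V : lmodType K) (f : A -> B -> V) (fP : is_bilinear f) a :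
  f a 0 = 0.
Proof. by have := fP.2 a 1 0 0; rewrite !scale1r addr0 => /eqP; rewrite -subr_eq0 opprD addrA subrr sub0r oppr_eq0 => /eqP. Qed.
Lemma bilinearZr (V : lmodType K) (f : A -> B -> V) (fP : is_bilinear f) c a x :
  f a (c *: x) = c *: f a x.
Proof. by have := fP.2 a c x 0; rewrite !addr0 bilinear0r // addr0. Qed.

Definition tens_zero : tens := \pi_tens [::].
Definition tens_add (t u : tens) : tens := \pi_tens (repr t ++ repr u).
Definition tens_scale (c : K) (t : tens) : tens :=
  \pi_tens [seq (c *: p.1, p.2) | p <- repr t].
Definition tens_opp (t : tens) : tens := tens_scale (-1) t.

Section Lift.
Variables (V : lmodType K) (f : A -> B -> V).
Hypothesis fP : is_bilinear f.

Lemma tlift_pure a b : tlift f (tpure a b) = f a b.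
Proof. by rewrite tlift_pi // /tens_eval big_seq1. Qed.
Lemma tlift_zero : tlift f tens_zero = 0.
Proof. by rewrite tlift_pi // /tens_eval big_nil. Qed.
Lemma tlift_add t u : tlift f (tens_add t u) = tlift f t + tlift f u.
Proof. by rewrite tlift_pi // /tens_eval big_cat. Qed.
Lemma tlift_scale c t : tlift f (tens_scale c t) = c *: tlift f t.
Proof.
rewrite tlift_pi // /tens_eval big_map scaler_sumr.
by apply: eq_bigr => p _; rewrite bilinearZl.
Qed.
Lemma tlift_opp t : tlift f (tens_opp t) = - tlift f t.
Proof. by rewrite tlift_scale scaleN1r. Qed.
End Lift.

Lemma tens_addA : associative tens_add.
Proof. by move=> t u w; apply: tens_ext => V f fP; rewrite !tlift_add // addrA. Qed.
Lemma tens_addC : commutative tens_add.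
Proof. by move=> t u; apply: tens_ext => V f fP; rewrite !tlift_add // addrC. Qed.
Lemma tens_add0 : left_id tens_zero tens_add.
Proof.
by move=> t; apply: tens_ext => V f fP; rewrite tlift_add // tlift_zero // add0r.
Qed.
Lemma tens_addN : left_inverse tens_zero tens_opp tens_add.
Proof.
move=> t; apply: tens_ext => V f fP.
by rewrite tlift_add // tlift_opp // tlift_zero // addNr.
Qed.
HB.instance Definition _ := GRing.isZmodule.Build tens
  tens_addA tens_addC tens_add0 tens_addN.

Lemma tens_scaleA a b t : tens_scale a (tens_scale b t) = tens_scale (a * b) t.
Proof.
by apply: tens_ext => V f fP; rewrite !tlift_scale // scalerA.
Qed.
Lemma tens_scale1 : left_id 1 tens_scale.
Proof. by move=> t; apply: tens_ext => V f fP; rewrite tlift_scale // scale1r. Qed.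
Lemma tens_scaleDr : right_distributive tens_scale +%R.
Proof.
move=> c t u; apply: tens_ext => V f fP.
by rewrite tlift_add // !tlift_scale // tlift_add // scalerDr.
Qed.
Lemma tens_scaleDl t : {morph tens_scale^~ t : a b / a + b}.
Proof.
move=> a b; apply: tens_ext => V f fP.
by rewrite tlift_add // !tlift_scale // scalerDl.
Qed.
HB.instance Definition _ := GRing.Zmodule_isLmodule.Build K tens
  tens_scaleA tens_scale1 tens_scaleDr tens_scaleDl.

Section LiftLinear.
Variables (V : lmodType K) (f : A -> B -> V).
Hypothesis fP : is_bilinear f.
Lemma tlift0 : tlift f 0 = 0. Proof. exact: tlift_zero. Qed.
Lemma tliftD t u : tlift f (t + u) = tlift f t + tlift f u.
Proof. exact: tlift_add. Qed.
Lemma tliftZ c t : tlift f (c *: t) = c *: tlift f t.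
Proof. exact: tlift_scale. Qed.
End LiftLinear.

Lemma tpure_bilinear : is_bilinear tpure.
Proof.
split=> [b|a] c x y; apply: tens_ext => V f fP.
  by rewrite tlift_add // tlift_scale // !tlift_pure // (fP.1 b).
by rewrite tlift_add // tlift_scale // !tlift_pure // (fP.2 a).
Qed.

Lemma tlift_linear (V : lmodType K) (f : A -> B -> V) :
  is_bilinear f -> linear (tlift f).
Proof. by move=> fP c t u; rewrite tlift_add // tlift_scale. Qed.

Lemma tens_sum_pure (t : tens) : t = \sum_(p <- repr t) tpure p.1 p.2.
Proof.
apply: tens_ext => V f fP; rewrite {1}/tlift /tens_eval.
elim: (repr t) => [|p s ih]; first by rewrite !big_nil tlift_zero.
by rewrite !big_cons ih tlift_add // tlift_pure.
Qed.

End Tensor.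

Section TensorAlgebra.
Variables (K : fieldType) (A B : algType K).
Local Notation T := (tens A B).

Definition tens_mul (t u : T) : T :=
  \pi_T [seq (p.1 * q.1, p.2 * q.2) | p <- repr t, q <- repr u].
Definition tens_one : T := tpure 1 1.

Section Lift.
Variables (V : lmodType K) (f : A -> B -> V).
Hypothesis fP : is_bilinear f.

Lemma mul_bilinearl (u : T) :
  is_bilinear (fun a b => tlift (fun a' b' => f (a * a') (b * b')) u).
Proof.
split=> [b|a] c x y; rewrite /tlift /tens_eval scaler_sumr -big_split /=;
  apply: eq_bigr => p _.
  by rewrite mulrDl -scalerAl (fP.1 (b * p.2)).
by rewrite mulrDl -scalerAl (fP.2 (a * p.1)).
Qed.
Lemma mul_bilinearr a b : is_bilinear (fun a' b' => f (a * a') (b * b')).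
Proof.
split=> [b'|a'] c x y.
  by rewrite mulrDr -scalerAr (fP.1 (b * b')).
by rewrite mulrDr -scalerAr (fP.2 (a * a')).
Qed.
Lemma mul_bilinearl1 a' b' : is_bilinear (fun a b => f (a * a') (b * b')).
Proof.
split=> [b|a] c x y.
  by rewrite mulrDl -scalerAl (fP.1 (b * b')).
by rewrite mulrDl -scalerAl (fP.2 (a * a')).
Qed.

Lemma tlift_mul (t u : T) : tlift f (tens_mul t u) =
  tlift (fun a b => tlift (fun a' b' => f (a * a') (b * b')) u) t.
Proof. by rewrite tlift_pi // /tens_eval big_allpairs_dep. Qed.
End Lift.

Lemma tens_mulDl : left_distributive tens_mul +%R.
Proof.
move=> t u w; apply: tens_ext => V f fP.
rewrite tlift_mul // !(tliftD fP) !tlift_mul // (tliftD (mul_bilinearl fP w)) //.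
Qed.
Lemma tens_mulDr : right_distributive tens_mul +%R.
Proof.
move=> t u w; apply: tens_ext => V f fP.
rewrite tlift_mul // !(tliftD fP) !tlift_mul // -big_split /=.
by apply: eq_bigr => p _; rewrite (tliftD (mul_bilinearr fP _ _)).
Qed.

Lemma tens_mul_pure a b a' b' :
  tens_mul (tpure a b) (tpure a' b') = tpure (a * a') (b * b').
Proof.
apply: tens_ext => V f fP; rewrite tlift_mul //.
rewrite (tlift_pure (mul_bilinearl fP _)) (tlift_pure (mul_bilinearr fP _ _)).
by rewrite tlift_pure.
Qed.

Lemma tens_mulA : associative tens_mul.
Proof.
have mulsl (I : Type) (s : seq I) (F : I -> T) u :
    tens_mul (\sum_(p <- s) F p) u = \sum_(p <- s) tens_mul (F p) u.
  elim: s => [|p s ih]; last by rewrite !big_cons tens_mulDl ih.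
  rewrite !big_nil; apply: (addIr (tens_mul 0 u)).
  by rewrite -tens_mulDl addr0 add0r.
have mulsr (I : Type) (s : seq I) (F : I -> T) u :
    tens_mul u (\sum_(p <- s) F p) = \sum_(p <- s) tens_mul u (F p).
  elim: s => [|p s ih]; last by rewrite !big_cons tens_mulDr ih.
  rewrite !big_nil; apply: (addIr (tens_mul u 0)).
  by rewrite -tens_mulDr addr0 add0r.
move=> t u w; rewrite (tens_sum_pure t) (tens_sum_pure u) (tens_sum_pure w).
rewrite !mulsl; apply: eq_bigr => p _.
rewrite [LHS]mulsr [tens_mul (tpure _ _) (\sum_(_ <- repr u) _)]mulsr mulsl; apply: eq_bigr => q _.
rewrite !mulsr; apply: eq_bigr => r _.
by rewrite !tens_mul_pure !mulrA.
Qed.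

Lemma tens_mul1 : left_id tens_one tens_mul.
Proof.
move=> t; apply: tens_ext => V f fP; rewrite tlift_mul //.
rewrite (tlift_pure (mul_bilinearl fP _)).
by apply: eq_bigr => p _; rewrite !mul1r.
Qed.
Lemma tens_mulr1 : right_id tens_one tens_mul.
Proof.
move=> t; apply: tens_ext => V f fP; rewrite tlift_mul //.
by apply: eq_bigr => p _; rewrite (tlift_pure (mul_bilinearr fP _ _)) !mulr1.
Qed.

Lemma tens_one_neq0 : tens_one != 0.
Proof.
have [phi phiL phi1] := exists_functional (@oner_neq0 A).
have [psi psiL psi1] := exists_functional (@oner_neq0 B).
pose f (a : A) (b : B) : K^o := phi a * psi b.
have fP : is_bilinear f.
  split=> [b|a] c x y; rewrite /f.
    by rewrite phiL mulrDl -[c *: _ in RHS]/(c * _) mulrA.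
  by rewrite psiL mulrDr -[c *: _ in RHS]/(c * _) mulrCA.
apply/eqP => /(congr1 (tlift f)); rewrite (tlift0 fP) (tlift_pure fP) /f.
by rewrite phi1 psi1 mulr1 => /eqP; rewrite oner_eq0.
Qed.

HB.instance Definition _ := GRing.Zmodule_isNzRing.Build T
  tens_mulA tens_mul1 tens_mulr1 tens_mulDl tens_mulDr tens_one_neq0.

Lemma tens_scaleAl (c : K) (t u : T) : c *: (t * u) = (c *: t) * u.
Proof.
apply: tens_ext => V f fP.
by rewrite (tliftZ fP) !tlift_mul // (tliftZ (mul_bilinearl fP u)).
Qed.
HB.instance Definition _ := GRing.Lmodule_isLalgebra.Build K T tens_scaleAl.
Lemma tens_scaleAr (c : K) (t u : T) : c *: (t * u) = t * (c *: u).
Proof.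
apply: tens_ext => V f fP; rewrite (tliftZ fP) !tlift_mul //.
apply/esym/(etrans (eq_bigr _ (fun p _ => tliftZ (mul_bilinearr fP p.1 p.2) c u))).
by rewrite -scaler_sumr.
Qed.
HB.instance Definition _ := GRing.Lalgebra_isAlgebra.Build K T tens_scaleAr.

Lemma tpureM a b a' b' : tpure a b * tpure a' b' = tpure (a * a') (b * b') :> T.
Proof. exact: tens_mul_pure. Qed.

End TensorAlgebra.

(** [L] is a vector space and [br] its Lie bracket.  [uea br] is the quotient
    of the free algebra on [L] (formal linear combinations of words, coded as
    sequences of pairs (coefficient, word)) in which two elements are identified
    when every Lie morphism from [L] to an associative algebra takes the same
    value on them; [uea_lift_morphism] and [uea_lift_unique] below are its
    universal property. *)

Section UEA.
Variables (K : fieldType) (L : lmodType K) (br : L -> L -> L).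

Definition lie_morphism (A : algType K) (f : L -> A) :=
  linear f /\ (forall x y, f (br x y) = f x * f y - f y * f x).

Definition uea_eval (A : algType K) (f : L -> A) (s : seq (K * seq L)) : A :=
  \sum_(p <- s) p.1 *: \prod_(x <- p.2) f x.

Definition uea_rel (s t : seq (K * seq L)) : bool :=
  `[< forall (A : algType K) (f : L -> A),
        lie_morphism f -> uea_eval f s = uea_eval f t >].

Lemma uea_rel_refl : reflexive uea_rel.
Proof. by move=> s; apply/asboolP. Qed.

Lemma uea_rel_sym : symmetric uea_rel.
Proof. by move=> s t; apply/asboolP/asboolP => h A f fP; rewrite (h A f fP). Qed.

Lemma uea_rel_trans : transitive uea_rel.
Proof.
move=> t s u /asboolP st /asboolP tu; apply/asboolP => A f fP.
by rewrite (st A f fP) (tu A f fP).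
Qed.

Canonical uea_equiv := EquivRel uea_rel uea_rel_refl uea_rel_sym uea_rel_trans.

Definition uea := {eq_quot uea_equiv}.
HB.instance Definition _ := Choice.on uea.
HB.instance Definition _ := Quotient.on uea.

Definition uea_inj (x : L) : uea := \pi_uea [:: (1, [:: x])].

(** The algebra morphism [uea br -> A] extending a Lie morphism [f]. *)
Definition uea_lift (A : algType K) (f : L -> A) (u : uea) : A :=
  uea_eval f (repr u).

Lemma uea_piP s t : reflect
  (forall (A : algType K) (f : L -> A),
     lie_morphism f -> uea_eval f s = uea_eval f t)
  (\pi_uea s == \pi_uea t).
Proof. by rewrite eqquotE; exact: asboolP. Qed.

Lemma uea_lift_pi (A : algType K) (f : L -> A) s :
  lie_morphism f -> uea_lift f (\pi_uea s) = uea_eval f s.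
Proof. by move=> fP; have /eqP/uea_piP := reprK (\pi_uea s); apply. Qed.

Lemma uea_ext (t u : uea) :
  (forall (A : algType K) (f : L -> A),
     lie_morphism f -> uea_lift f t = uea_lift f u) -> t = u.
Proof. by move=> h; rewrite -[t]reprK -[u]reprK; apply/eqP/uea_piP. Qed.

Definition uea_zero : uea := \pi_uea [::].
Definition uea_one : uea := \pi_uea [:: (1, [::])].
Definition uea_add (t u : uea) : uea := \pi_uea (repr t ++ repr u).
Definition uea_scale (c : K) (t : uea) : uea :=
  \pi_uea [seq (c * p.1, p.2) | p <- repr t].
Definition uea_opp (t : uea) : uea := uea_scale (-1) t.
Definition uea_mul (t u : uea) : uea :=
  \pi_uea [seq (p.1 * q.1, p.2 ++ q.2) | p <- repr t, q <- repr u].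

Section Lift.
Variables (A : algType K) (f : L -> A).
Hypothesis fP : lie_morphism f.

Lemma uea_lift_inj x : uea_lift f (uea_inj x) = f x.
Proof. by rewrite uea_lift_pi // /uea_eval !big_seq1 scale1r. Qed.
Lemma uea_lift_zero : uea_lift f uea_zero = 0.
Proof. by rewrite uea_lift_pi // /uea_eval big_nil. Qed.
Lemma uea_lift_one : uea_lift f uea_one = 1.
Proof. by rewrite uea_lift_pi // /uea_eval big_seq1 big_nil scale1r. Qed.
Lemma uea_lift_add t u : uea_lift f (uea_add t u) = uea_lift f t + uea_lift f u.
Proof. by rewrite uea_lift_pi // /uea_eval big_cat. Qed.
Lemma uea_lift_scale c t : uea_lift f (uea_scale c t) = c *: uea_lift f t.
Proof.
rewrite uea_lift_pi // /uea_eval big_map scaler_sumr.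
by apply: eq_bigr => p _; rewrite scalerA.
Qed.
Lemma uea_lift_opp t : uea_lift f (uea_opp t) = - uea_lift f t.
Proof. by rewrite uea_lift_scale scaleN1r. Qed.
Lemma uea_lift_mul t u : uea_lift f (uea_mul t u) = uea_lift f t * uea_lift f u.
Proof.
rewrite uea_lift_pi // /uea_eval big_allpairs_dep mulr_suml.
apply: eq_bigr => p _; rewrite mulr_sumr; apply: eq_bigr => q _ /=.
by rewrite big_cat -scalerAl -scalerAr scalerA.
Qed.
End Lift.

Lemma uea_addA : associative uea_add.
Proof. by move=> t u w; apply: uea_ext => A f fP; rewrite !uea_lift_add // addrA. Qed.
Lemma uea_addC : commutative uea_add.
Proof. by move=> t u; apply: uea_ext => A f fP; rewrite !uea_lift_add // addrC. Qed.
Lemma uea_add0 : left_id uea_zero uea_add.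
Proof.
by move=> t; apply: uea_ext => A f fP; rewrite uea_lift_add // uea_lift_zero // add0r.
Qed.
Lemma uea_addN : left_inverse uea_zero uea_opp uea_add.
Proof.
move=> t; apply: uea_ext => A f fP.
by rewrite uea_lift_add // uea_lift_opp // uea_lift_zero // addNr.
Qed.
HB.instance Definition _ := GRing.isZmodule.Build uea
  uea_addA uea_addC uea_add0 uea_addN.

Lemma uea_mulA : associative uea_mul.
Proof. by move=> t u w; apply: uea_ext => A f fP; rewrite !uea_lift_mul // mulrA. Qed.
Lemma uea_mul1 : left_id uea_one uea_mul.
Proof.
by move=> t; apply: uea_ext => A f fP; rewrite uea_lift_mul // uea_lift_one // mul1r.
Qed.
Lemma uea_mulr1 : right_id uea_one uea_mul.
Proof.
by move=> t; apply: uea_ext => A f fP; rewrite uea_lift_mul // uea_lift_one // mulr1.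
Qed.
Lemma uea_mulDl : left_distributive uea_mul +%R.
Proof.
move=> t u w; apply: uea_ext => A f fP.
by rewrite !(uea_lift_mul, uea_lift_add) // mulrDl.
Qed.
Lemma uea_mulDr : right_distributive uea_mul +%R.
Proof.
move=> t u w; apply: uea_ext => A f fP.
by rewrite !(uea_lift_mul, uea_lift_add) // mulrDr.
Qed.
Lemma uea_one_neq0 : uea_one != 0.
Proof.
have fP : lie_morphism (fun _ : L => 0 : K^o).
  by split=> [c x y|x y]; rewrite ?scaler0 ?mulr0 ?addr0 ?subr0.
apply/eqP => /(congr1 (uea_lift (fun=> 0 : K^o))).
by rewrite uea_lift_one // uea_lift_zero // => /eqP; rewrite oner_eq0.
Qed.
HB.instance Definition _ := GRing.Zmodule_isNzRing.Build uea
  uea_mulA uea_mul1 uea_mulr1 uea_mulDl uea_mulDr uea_one_neq0.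

Lemma uea_scaleA a b t : uea_scale a (uea_scale b t) = uea_scale (a * b) t.
Proof. by apply: uea_ext => A f fP; rewrite !uea_lift_scale // scalerA. Qed.
Lemma uea_scale1 : left_id 1 uea_scale.
Proof. by move=> t; apply: uea_ext => A f fP; rewrite uea_lift_scale // scale1r. Qed.
Lemma uea_scaleDr : right_distributive uea_scale +%R.
Proof.
move=> c t u; apply: uea_ext => A f fP.
by rewrite !(uea_lift_scale, uea_lift_add) // scalerDr.
Qed.
Lemma uea_scaleDl t : {morph uea_scale^~ t : a b / a + b}.
Proof.
move=> a b; apply: uea_ext => A f fP.
by rewrite !(uea_lift_scale, uea_lift_add) // scalerDl.
Qed.
HB.instance Definition _ := GRing.Zmodule_isLmodule.Build K uea
  uea_scaleA uea_scale1 uea_scaleDr uea_scaleDl.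

Lemma uea_scaleAl (c : K) (t u : uea) : c *: (t * u) = (c *: t) * u.
Proof.
apply: uea_ext => A f fP.
by rewrite !(uea_lift_scale, uea_lift_mul) // scalerAl.
Qed.
HB.instance Definition _ := GRing.Lmodule_isLalgebra.Build K uea uea_scaleAl.
Lemma uea_scaleAr (c : K) (t u : uea) : c *: (t * u) = t * (c *: u).
Proof.
apply: uea_ext => A f fP.
by rewrite !(uea_lift_scale, uea_lift_mul) // scalerAr.
Qed.
HB.instance Definition _ := GRing.Lalgebra_isAlgebra.Build K uea uea_scaleAr.

Lemma uea_inj_morphism : lie_morphism uea_inj.
Proof.
split=> [c x y|x y]; apply: uea_ext => A f fP.
  by rewrite uea_lift_add // uea_lift_scale // !uea_lift_inj // fP.1.
rewrite uea_lift_inj // uea_lift_add // uea_lift_opp // !uea_lift_mul //.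
by rewrite !uea_lift_inj // fP.2.
Qed.

Lemma uea_lift_morphism (A : algType K) (f : L -> A) : lie_morphism f ->
  [/\ linear (uea_lift f), monoid_morphism (uea_lift f) &
      forall x, uea_lift f (uea_inj x) = f x].
Proof.
move=> fP; split=> [c t u||x]; last exact: uea_lift_inj.
  by rewrite uea_lift_add // uea_lift_scale.
by split=> [|t u]; [exact: uea_lift_one | exact: uea_lift_mul].
Qed.

Lemma uea_sum_words (t : uea) :
  t = \sum_(p <- repr t) p.1 *: \prod_(x <- p.2) uea_inj x.
Proof.
apply: uea_ext => A f fP; rewrite {1}/uea_lift /uea_eval.
elim: (repr t) => [|p s ih]; first by rewrite !big_nil uea_lift_zero.
rewrite !big_cons ih uea_lift_add // uea_lift_scale //; congr (_ *: _ + _).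
elim: p.2 => [|x w ihw]; first by rewrite !big_nil uea_lift_one.
by rewrite !big_cons ihw uea_lift_mul // uea_lift_inj.
Qed.

Lemma uea_lift_unique (A : algType K) (g h : {lrmorphism uea -> A}) :
  (forall x, g (uea_inj x) = h (uea_inj x)) -> g =1 h.
Proof.
move=> gh t; rewrite (uea_sum_words t) !linear_sum; apply: eq_bigr => p _.
rewrite !linearZ /= !rmorph_prod; congr (_ *: _).
by apply: eq_bigr => x _; exact: gh.
Qed.

End UEA.

Section Converse.
Variables (K : fieldType) (A : algType K).
HB.instance Definition _ := GRing.Zmodule_isLmodule.Build K A^c
  (@scalerA K A) (@scale1r K A) (@scalerDr K A) (@scalerDl K A).
Lemma converse_scaleAl (c : K) (x y : A^c) : c *: (x * y) = (c *: x) * y.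
Proof. exact: (@scalerAr K A c y x). Qed.
HB.instance Definition _ := GRing.Lmodule_isLalgebra.Build K A^c converse_scaleAl.
Lemma converse_scaleAr (c : K) (x y : A^c) : c *: (x * y) = x * (c *: y).
Proof. exact: (@scalerAl K A c y x). Qed.
HB.instance Definition _ := GRing.Lalgebra_isAlgebra.Build K A^c converse_scaleAr.
End Converse.

(** The standard Hopf structure: elements of [L] are primitive, the antipode is
    the anti-automorphism equal to [-id] on [L]. *)
Section Standard.
Variables (K : fieldType) (L : lmodType K) (br : L -> L -> L).
Local Notation U := (uea br).

Definition uea_coprod : U -> tens U U :=
  uea_lift (fun x => tpure (uea_inj br x) 1 + tpure 1 (uea_inj br x)).
Definition uea_counit : U -> K := uea_lift (fun _ : L => 0 : K^o).
Definition uea_antipode : U -> U := uea_lift (fun x => - uea_inj br x : U^c).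
End Standard.

(** [fps A] is [A[[xi]]], with [xi] central and [A] not necessarily commutative. *)

Record fps (A : Type) := FPS { coefs : nat -> A }.

Section FpsRing.
Variable A : nzRingType.
Implicit Types x y z : fps A.

HB.instance Definition _ := gen_eqMixin (fps A).
HB.instance Definition _ := gen_choiceMixin (fps A).

Lemma fpsP x y : (forall n, coefs x n = coefs y n) -> x = y.
Proof. by case: x y => [x] [y] /= /funext ->. Qed.

Definition fps_zero : fps A := FPS (fun=> 0).
Definition fps_add x y : fps A := FPS (fun n => coefs x n + coefs y n).
Definition fps_opp x : fps A := FPS (fun n => - coefs x n).
Definition fps_const (a : A) : fps A := FPS (fun n => if n is 0 then a else 0).
Definition fps_one : fps A := fps_const 1.
Definition fps_mul x y : fps A :=
  FPS (fun n => \sum_(i < n.+1) coefs x i * coefs y (n - i)).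

Lemma fps_addA : associative fps_add.
Proof. by move=> x y z; apply: fpsP => n /=; rewrite addrA. Qed.
Lemma fps_addC : commutative fps_add.
Proof. by move=> x y; apply: fpsP => n /=; rewrite addrC. Qed.
Lemma fps_add0 : left_id fps_zero fps_add.
Proof. by move=> x; apply: fpsP => n /=; rewrite add0r. Qed.
Lemma fps_addN : left_inverse fps_zero fps_opp fps_add.
Proof. by move=> x; apply: fpsP => n /=; rewrite addNr. Qed.
HB.instance Definition _ := GRing.isZmodule.Build (fps A)
  fps_addA fps_addC fps_add0 fps_addN.

End FpsRing.

(* Both sides are the sum of [G i j k] over [i + j + k = n]. *)
Lemma sum_triangle (V : nmodType) (G : nat -> nat -> nat -> V) n :
  \sum_(i < n.+1) \sum_(j < i.+1) G j (i - j)%N (n - i)%N =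
  \sum_(i < n.+1) \sum_(j < (n - i).+1) G i j (n - i - j)%N.
Proof.
have -> : \sum_(i < n.+1) \sum_(j < i.+1) G j (i - j)%N (n - i)%N =
  \sum_(i < n.+1) \sum_(j < n.+1 | (j <= i)%N) G j (i - j)%N (n - i)%N.
  apply: eq_bigr => i _.
  by rewrite (big_ord_widen n.+1 (fun j => G j (i - j)%N (n - i)%N)) ?ltnS // -ltnS.
rewrite (exchange_big_dep predT) //=; apply: eq_bigr => j _.
rewrite -(big_mkord (fun i => j <= i)%N (fun i => G j (i - j)%N (n - i)%N)).
rewrite -(big_mkord xpredT (fun k => G j k (n - j - k)%N)).
have jn : (j <= n)%N by rewrite -ltnS.
rewrite (big_cat_nat _ (n := j)) //=; last exact: leqW.
rewrite big_nat_cond big1 ?add0r; last first.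
  by move=> i /andP[/andP[_ lt_ij]]; rewrite leqNgt lt_ij.
rewrite -{1}[val j]add0n big_addn -subSn // big_nat_cond [RHS]big_nat_cond.
apply: eq_big => [k|k _]; first by rewrite leq_addl !andbT.
by rewrite addnK addnC subnDA.
Qed.

Section FpsRing2.
Variable A : nzRingType.
Implicit Types x y z : fps A.

Lemma fps_mulA : associative (@fps_mul A).
Proof.
move=> x y z; apply: fpsP => n /=.
under eq_bigr do rewrite mulr_sumr.
under [RHS]eq_bigr do rewrite mulr_suml.
rewrite (sum_triangle (fun i j k => coefs x i * coefs y j * coefs z k)).
by apply: eq_bigr => i _; apply: eq_bigr => j _; rewrite mulrA.
Qed.
Lemma fps_mul1 : left_id (fps_one A) (@fps_mul A).
Proof.
move=> x; apply: fpsP => n /=; rewrite big_ord_recl /= subn0 mul1r big1 ?addr0 //.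
by move=> i _; rewrite mul0r.
Qed.
Lemma fps_mulr1 : right_id (fps_one A) (@fps_mul A).
Proof.
move=> x; apply: fpsP => n /=; rewrite big_ord_recr /= subnn mulr1 big1 ?add0r //.
by move=> i _; rewrite -[(n - i)%N]prednK ?subn_gt0 // mulr0.
Qed.
Lemma fps_mulDl : left_distributive (@fps_mul A) +%R.
Proof.
move=> x y z; apply: fpsP => n /=.
by rewrite -big_split; apply: eq_bigr => i _; rewrite mulrDl.
Qed.
Lemma fps_mulDr : right_distributive (@fps_mul A) +%R.
Proof.
move=> x y z; apply: fpsP => n /=.
by rewrite -big_split; apply: eq_bigr => i _; rewrite mulrDr.
Qed.
Lemma fps_one_neq0 : fps_one A != 0.
Proof.
by apply/eqP => /(congr1 (fun x : fps A => coefs x 0)) /eqP; rewrite /= oner_eq0.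
Qed.
HB.instance Definition _ := GRing.Zmodule_isNzRing.Build (fps A)
  fps_mulA fps_mul1 fps_mulr1 fps_mulDl fps_mulDr fps_one_neq0.

Definition fps_unit : pred (fps A) :=
  fun x => `[< exists y : fps A, y * x = 1 /\ x * y = 1 >].
Definition fps_inv x : fps A :=
  if pselect (exists y : fps A, y * x = 1 /\ x * y = 1) is left h
  then projT1 (cid h) else x.

Lemma fps_mulVx : {in fps_unit, left_inverse 1 fps_inv *%R}.
Proof.
move=> x /asboolP h; rewrite /fps_inv; case: pselect => // h'.
by case: (projT2 (cid h')).
Qed.
Lemma fps_mulxV : {in fps_unit, right_inverse 1 fps_inv *%R}.
Proof.
move=> x /asboolP h; rewrite /fps_inv; case: pselect => // h'.
by case: (projT2 (cid h')).
Qed.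
Lemma fps_unitP x y : y * x = 1 /\ x * y = 1 -> fps_unit x.
Proof. by move=> h; apply/asboolP; exists y. Qed.
Lemma fps_inv_out : {in [predC fps_unit], fps_inv =1 id}.
Proof.
by move=> x /asboolP h; rewrite /fps_inv; case: pselect.
Qed.
HB.instance Definition _ := GRing.NzRing_hasMulInverse.Build (fps A)
  fps_mulVx fps_mulxV fps_unitP fps_inv_out.

End FpsRing2.

Section FpsCom.
Variable A : comNzRingType.
Lemma fps_mulC : commutative (@fps_mul A).
Proof.
move=> x y; apply: fpsP => n /=; rewrite (reindex_inj rev_ord_inj) /=.
apply: eq_bigr => -[i /= lt_in] _; rewrite subSS subKn; last exact: lt_in.
exact: mulrC.
Qed.
HB.instance Definition _ := GRing.PzRing_hasCommutativeMul.Build (fps A) fps_mulC.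
End FpsCom.

Section FpsAlgebra.
Variables (K : fieldType) (A : algType K).

Definition fps_scale (c : fps K) (x : fps A) : fps A :=
  FPS (fun n => \sum_(i < n.+1) coefs c i *: coefs x (n - i)).

Lemma fps_scaleA a b x : fps_scale a (fps_scale b x) = fps_scale (a * b) x.
Proof.
apply: fpsP => n /=.
under eq_bigr do rewrite scaler_sumr.
under [RHS]eq_bigr do rewrite scaler_suml.
rewrite (sum_triangle (fun i j k => (coefs a i * coefs b j) *: coefs x k)).
by apply: eq_bigr => i _; apply: eq_bigr => j _; rewrite scalerA.
Qed.
Lemma fps_scale1 : left_id 1 fps_scale.
Proof.
move=> x; apply: fpsP => n /=; rewrite big_ord_recl /= subn0 scale1r big1 ?addr0 //.
by move=> i _; rewrite scale0r.
Qed.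
Lemma fps_scaleDr : right_distributive fps_scale +%R.
Proof.
move=> c x y; apply: fpsP => n /=.
by rewrite -big_split; apply: eq_bigr => i _; rewrite scalerDr.
Qed.
Lemma fps_scaleDl x : {morph fps_scale^~ x : a b / a + b}.
Proof.
move=> a b; apply: fpsP => n /=.
by rewrite -big_split; apply: eq_bigr => i _; rewrite scalerDl.
Qed.
HB.instance Definition _ := GRing.Zmodule_isLmodule.Build (fps K) (fps A)
  fps_scaleA fps_scale1 fps_scaleDr fps_scaleDl.

Lemma fps_scaleAl (c : fps K) (x y : fps A) : c *: (x * y) = (c *: x) * y.
Proof.
apply: fpsP => n /=.
under eq_bigr do rewrite scaler_sumr.
under [RHS]eq_bigr do rewrite mulr_suml.
rewrite (sum_triangle (fun i j k => (coefs c i *: coefs x j) * coefs y k)).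
by apply: eq_bigr => i _; apply: eq_bigr => j _; rewrite scalerAl.
Qed.
HB.instance Definition _ :=
  GRing.Lmodule_isLalgebra.Build (fps K) (fps A) fps_scaleAl.

Lemma fps_scaleAr (c : fps K) (x y : fps A) : c *: (x * y) = x * (c *: y).
Proof.
apply: fpsP => n; rewrite -[RHS]/(coefs (fps_mul x (fps_scale c y)) n).
rewrite -[LHS]/(coefs (fps_scale c (fps_mul x y)) n) /=.
under eq_bigr do rewrite scaler_sumr.
under [RHS]eq_bigr do rewrite mulr_sumr.
rewrite -(sum_triangle (fun i j k => coefs c i *: (coefs x j * coefs y k))).
rewrite -(sum_triangle (fun j i k => coefs x j * (coefs c i *: coefs y k))).
apply: eq_bigr => i _; rewrite (reindex_inj rev_ord_inj) /=.
apply: eq_bigr => -[j /= lt_ji] _; rewrite subSS subKn; last exact: lt_ji.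
by rewrite scalerAr.
Qed.
HB.instance Definition _ :=
  GRing.Lalgebra_isAlgebra.Build (fps K) (fps A) fps_scaleAr.
End FpsAlgebra.

Notation "a %:S" := (fps_const a) (at level 2, left associativity, format "a %:S").

Definition fps_xi (K : fieldType) : fps K := FPS (fun n => (n == 1%N)%:R).

(** Exponential of [x] and logarithm of [1 + x], for [x] with zero constant term:
    [x ^+ k] then only has terms of degree at least [k], so that truncating the
    series at [k = n] does not affect the coefficient of degree [n]. *)
Section ExpLog.
Variables (K : numFieldType) (A : algType K).
Definition fps_exp (x : fps A) : fps A :=
  FPS (fun n => \sum_(0 <= k < n.+1) (k`!%:R^-1 : K) *: coefs (x ^+ k) n).
Definition fps_ln1p (x : fps A) : fps A :=
  FPS (fun n => \sum_(1 <= k < n.+1)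
                  ((-1) ^+ k.+1 / k%:R : K) *: coefs (x ^+ k) n).
End ExpLog.

(** The [xi]-adically completed tensor product of [A[[xi]]] and [B[[xi]]] over
    [K[[xi]]] is [(A (x) B)[[xi]]]. *)

Section CompletedTensor.
Variables (K : fieldType).

Definition fps_map (X Y : Type) (f : X -> Y) (x : fps X) : fps Y :=
  FPS (fun n => f (coefs x n)).

Definition fps_tens (A B : algType K) (x : fps A) (y : fps B) : fps (tens A B) :=
  FPS (fun n => \sum_(i < n.+1) tpure (coefs x i) (coefs y (n - i))).

(** For a [K[[xi]]]-bilinear map [f], the [K[[xi]]]-linear (hence [xi]-adically
    continuous) map such that [fps_tens x y |-> f x y]: it sends the series
    [\sum_i t_i xi^i] to [\sum_i f'(t_i) xi^i], where [f' : A (x) B -> C[[xi]]]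
    is induced by the restriction of [f] to [A x B]. *)
Definition fps_tlift (A B : algType K) (C : nzRingType)
    (f : fps A -> fps B -> fps C) (t : fps (tens A B)) : fps C :=
  FPS (fun n => \sum_(i < n.+1)
    coefs (tlift (fun a b => f a%:S b%:S) (coefs t i)) (n - i)).

Variables (A B C : algType K).
Notation "x \ox y" := (fps_tens x y) (at level 40, left associativity).

Definition fps_flip : fps (tens A B) -> fps (tens B A) :=
  fps_tlift (fun x y => y \ox x).

Definition fps_assoc : fps (tens A (tens B C)) -> fps (tens (tens A B) C) :=
  fps_tlift (fun x => fps_tlift (fun y z => x \ox y \ox z)).
End CompletedTensor.

Notation "x \ox y" := (fps_tens x y) (at level 40, left associativity) : ring_scope.

Section Hopf.
Variables (K : fieldType) (A : algType K).
Local Notation H := (fps A).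
Local Notation HH := (fps (tens A A)).
Local Notation HHH := (fps (tens (tens A A) A)).

Definition leg12 : HH -> HHH := fps_tlift (fun x y => x \ox y \ox 1).
Definition leg13 : HH -> HHH := fps_tlift (fun x y => x \ox 1 \ox y).
Definition leg23 : HH -> HHH := fps_tlift (fun x y => 1 \ox x \ox y).

Definition tens_idr (D : H -> HH) : HH -> HHH :=
  fps_tlift (fun x y => D x \ox y).
Definition id_tens (D : H -> HH) : HH -> HHH :=
  fps_tlift (fun x y => fps_assoc (x \ox D y)).

Definition counit_idr (e : H -> fps K) : HH -> H := fps_tlift (fun x y => e x *: y).
Definition id_counit (e : H -> fps K) : HH -> H := fps_tlift (fun x y => e y *: x).

(** Hopf algebra structure on the ring [A[[xi]]] over [K[[xi]]], with completed
    tensor products. *)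
Record hopf_algebra (D : H -> HH) (e : H -> fps K) (S : H -> H) : Prop := {
  hopf_coprod_linear : linear D;
  hopf_coprod_morphism : monoid_morphism D;
  hopf_counit_linear : scalar e;
  hopf_counit_morphism : monoid_morphism e;
  hopf_antipode_linear : linear S;
  hopf_coassoc : forall a, tens_idr D (D a) = id_tens D (D a);
  hopf_counitl : forall a, counit_idr e (D a) = a;
  hopf_counitr : forall a, id_counit e (D a) = a;
  hopf_antipodel : forall a, fps_tlift (fun x y => S x * y) (D a) = e a *: 1;
  hopf_antipoder : forall a, fps_tlift (fun x y => x * S y) (D a) = e a *: 1
}.

Record triangular (D : H -> HH) (R : HH) : Prop := {
  triangular_unit : R \is a GRing.unit;
  triangular_cocomm : forall a, R * D a * R^-1 = fps_flip (D a);
  triangular_coprodl : tens_idr D R = leg13 R * leg23 R;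
  triangular_coprodr : id_tens D R = leg13 R * leg12 R;
  triangular_flip : fps_flip R * R = 1
}.

Record twist (D : H -> HH) (e : H -> fps K) (F : HH) : Prop := {
  twist_unit : F \is a GRing.unit;
  twist_cocycle : leg12 F * tens_idr D F = leg23 F * id_tens D F;
  twist_counitl : counit_idr e F = 1;
  twist_counitr : id_counit e F = 1
}.

Definition twisted_coprod (D : H -> HH) (F : HH) (a : H) : HH := F * D a * F^-1.
Definition twist_elt (S : H -> H) (F : HH) : H := fps_tlift (fun x y => x * S y) F.
Definition twisted_antipode (S : H -> H) (F : HH) (a : H) : H :=
  twist_elt S F * S a * (twist_elt S F)^-1.
End Hopf.

Section LieB.
Variables (K : fieldType) (N : nat).

(** Matrix units, with indices running from 1 to [N]. *)
Definition mxunit (i j : nat) : 'M[K]_N :=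
  \matrix_(a, b) ((a.+1 == i) && (b.+1 == j))%:R.

Definition mxH1N : 'M[K]_N := mxunit 1 1 - mxunit N N.

Definition lieB_basis : seq 'M[K]_N :=
  mxH1N :: mxunit 1 N :: [seq mxunit 1 j | j <- index_iota 2 N]
                      ++ [seq mxunit j N | j <- index_iota 2 N].

Definition lieB : {vspace 'M[K]_N} := <<lieB_basis>>%VS.

Definition mxbracket (x y : 'M[K]_N) : 'M[K]_N := x *m y - y *m x.

Lemma mxunitM i j k l : mxunit i j *m mxunit k l =
  (if (j == k) && (0 < j <= N)%N then mxunit i l else 0).
Proof.
apply/matrixP => a b; rewrite !mxE.
transitivity (\sum_(c < N) (((a.+1 == i) && (b.+1 == l)) && ((c.+1 == j) && (c.+1 == k)))%:R : K).
  by apply: eq_bigr => c _; rewrite !mxE -natrM mulnb; congr (nat_of_bool _)%:R;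
     case: (_ == i); case: (_ == l); rewrite ?andbT ?andbF.
case: ifP => [/andP[/eqP <- /andP[j0 jN]]|jk].
  have lt : (j.-1 < N)%N by rewrite prednK.
  rewrite (bigD1 (Ordinal lt)) //= prednK // eqxx big1 ?addr0 ?mxE ?andbT // => c.
  rewrite -val_eqE /= andbb => cj.
  by case: (c.+1 =P j) cj => [<-|_ _]; rewrite /= ?eqxx ?andbF.
rewrite mxE big1 // => c _; case: (c.+1 =P j) => [cj|]; rewrite ?andbF //=.
by move: jk; rewrite -cj /= ltn_ord !andbT => ->; rewrite andbF.
Qed.

Lemma mem_lieB1N : mxunit 1 N \in lieB.
Proof. by apply: memv_span; rewrite !inE eqxx orbT. Qed.
Lemma mem_lieBH : mxH1N \in lieB.
Proof. by apply: memv_span; rewrite !inE eqxx. Qed.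
Lemma mem_lieB1j j : (1 < j < N)%N -> mxunit 1 j \in lieB.
Proof.
move=> jN; apply: memv_span; rewrite !inE mem_cat; apply/orP; right; apply/orP; right.
by apply/orP; left; apply/mapP; exists j => //; rewrite mem_index_iota.
Qed.
Lemma mem_lieBjN j : (1 < j < N)%N -> mxunit j N \in lieB.
Proof.
move=> jN; apply: memv_span; rewrite !inE mem_cat; apply/orP; right; apply/orP; right.
by apply/orP; right; apply/mapP; exists j => //; rewrite mem_index_iota.
Qed.

Lemma lieB_basisP x : x \in lieB_basis ->
  [\/ x = mxH1N, x = mxunit 1 N, exists2 j, (1 < j < N)%N & x = mxunit 1 j
    | exists2 j, (1 < j < N)%N & x = mxunit j N].
Proof.
rewrite !inE mem_cat => /or4P[/eqP->|/eqP->|/mapP[j]|/mapP[j]].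
- by constructor 1.
- by constructor 2.
- by rewrite mem_index_iota; constructor 3; exists j.
- by rewrite mem_index_iota; constructor 4; exists j.
Qed.

Lemma lieB_closed : (2 < N)%N ->
  {in lieB &, forall x y, mxbracket x y \in lieB}.
Proof.
move=> N2.
have spanL (f : {linear 'M[K]_N -> 'M[K]_N}) (V : {vspace 'M[K]_N}) :
    {in lieB_basis, forall x, f x \in V} -> {in lieB, forall x, f x \in V}.
  move=> fV x xB; have : (lieB <= linfun f @^-1: V)%VS.
    by apply/span_subvP => y /fV; rewrite -memv_preim lfunE.
  by move/subvP/(_ x xB); rewrite -memv_preim lfunE.
have key : {in lieB_basis &, forall x y, mxbracket x y \in lieB}.
  have N1 : (1 == N)%N = false by apply/negbTE; rewrite neq_ltn (ltn_trans _ N2).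
  have N1' : (N == 1)%N = false by rewrite eq_sym.
  have N0 : (0 < N)%N by apply: ltn_trans N2.
  have j1 j : (1 < j < N)%N -> (j == 1)%N = false.
    by case/andP => h _; rewrite eqn_leq leqNgt h.
  have jN j : (1 < j < N)%N -> (j == N)%N = false.
    by case/andP => _ h; rewrite eqn_leq andbC leqNgt h.
  have j1' j : (1 < j < N)%N -> (1 == j)%N = false by rewrite eq_sym; apply: j1.
  have jN' j : (1 < j < N)%N -> (N == j)%N = false by rewrite eq_sym; apply: jN.
  have b1N := mem_lieB1N; have bH := mem_lieBH.
  move=> x y /lieB_basisP[->|->|[j jP ->]|[j jP ->]]
             /lieB_basisP[->|->|[k kP ->]|[k kP ->]];
    try (have b1j := mem_lieB1j jP); try (have bjN := mem_lieBjN jP);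
    try (have b1k := mem_lieB1j kP); try (have bkN := mem_lieBjN kP);
    rewrite /mxbracket ?subrr ?mem0v // /mxH1N ?mulmxBl ?mulmxBr !mxunitM
      ?N1' ?(j1' _ jP) ?(jN' _ jP) ?(j1' _ kP) ?(jN' _ kP) ?(j1 _ jP) ?(jN _ jP)
      ?(j1 _ kP) ?(jN _ kP) ?N1 ?eqxx ?N0 ?leqnn /= ?(subr0, sub0r, opprK, addr0, add0r);
    try (case: ifP => _); try (case: ifP => _);
    by rewrite ?(subr0, sub0r, opprK, addr0, add0r) ?(mem0v, memvN, memvB, memvD).
move=> x y xB yB.
have := @spanL (mulmxr y \- mulmx y) lieB; apply => // z zB /=.
have := @spanL (mulmx z \- mulmxr z) lieB; apply => // w wB /=.
exact: key.
Qed.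

(** The bracket of [lieB] and the matrices spanning it, as elements of the space
    [subvs_of lieB]: by [lieB_closed] and the [mem_lieB] lemmas, [vsproj] is only
    applied to members of [lieB], which it does not change ([vsprojK]). *)
Definition lieB_br (x y : subvs_of lieB) : subvs_of lieB :=
  vsproj lieB (mxbracket (vsval x) (vsval y)).

Definition lieB_gen (X : 'M[K]_N) : fps (uea lieB_br) :=
  (uea_inj lieB_br (vsproj lieB X))%:S.

Definition lieB_coprod :
    fps (uea lieB_br) -> fps (tens (uea lieB_br) (uea lieB_br)) :=
  fps_map (@uea_coprod _ _ lieB_br).
Definition lieB_counit : fps (uea lieB_br) -> fps K :=
  fps_map (@uea_counit _ _ lieB_br).
Definition lieB_antipode : fps (uea lieB_br) -> fps (uea lieB_br) :=
  fps_map (@uea_antipode _ _ lieB_br).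
End LieB.

(* Main.v *)
Require Import Defs.
From HB Require Import structures.
From mathcomp Require Import all_boot all_order all_algebra.
From mathcomp Require Import boolp reals complex ring.

Set Implicit Arguments.
Unset Strict Implicit.
Unset Printing Implicit Defensive.

Import GRing.Theory Num.Theory.
Local Open Scope ring_scope.

(** Write [H = H_1N], [z = E_1N], [x_j = E_1j], [y_j = E_jN], [w = e^(-2 sigma)] and
    [F = J Phi], with [J = exp(H (x) sigma)] and [Phi] the remaining product.
    Conjugation by [Phi] and then by [J] is explicit on the primitive coproducts
    of the generators: [J (p (x) q) = (p (x) q e^(c sigma)) J] when [[H, p] = c p] and
    [q] commutes with [z], and [exp(A) t = (t + [A, t]) exp(A)] when [[A, t]] commutes
    with [A].  This gives the four formulas for [Delta_F].

    The right side of the cocycle identity is [(id (x) Delta_F)(F) F_23].  As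
    [Delta_F(sigma) = sigma (x) 1 + 1 (x) sigma] and
    [Delta_F(y_j w) = y_j w (x) e^(-sigma) + 1 (x) y_j w], the identity reduces to
    [Phi_12 J_13 = J_13 Psi], where [Psi] has the exponents
    [2 xi x_j (x) y_j w (x) e^(-sigma)].

    The Hopf and triangular structures then follow from the general theory of twists
    of cocommutative Hopf algebras, and the antipode formulas from
    [m (S_F (x) id) Delta_F = epsilon].  Identities between [K[[xi]]]-linear maps are
    checked on pure tensors of constants: such maps are automatically continuous. *)

(** * Linear maps between algebras of power series *)

(** The constants are governed by one grading. Say that [p] has weight [c] when [[H, p] = c p]: then
    [z] has weight 2, and [x_j], [y_j] have weight 1. The factor 1/2 in [sigma] gives
    [e^(2 sigma) = 1 + 2 xi z], which is exactly what [J] contributes when it passes an element of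
    weight 2. The weight 2 of [z] also makes half of [ad H] the Euler operator on series in [xi z],
    whence [[H, sigma] = 1 - w]. The factor [w] in [Phi] cancels the group-like [e^(2 sigma)]
    standing before [y_j] in [Delta_F(y_j)], so that [(id (x) Delta_F)(Phi)] splits into two
    commuting exponentials. The obstacle is [sigma] itself, a logarithm whose images under [Delta_F]
    and [S_F] cannot be expanded term by term. They are read off from [e^(2 sigma)], which is affine
    in [z], because the exponential is injective on commuting series without constant term. The
    computation is carried out in an arbitrary algebra with elements having these brackets, and the
    enveloping algebra is substituted at the end. *)

Section Linear.
Variables (R : pzRingType) (V W : lmodType R) (f : V -> W).
Hypothesis fL : linear f.

Lemma lin0 : f 0 = 0.
Proof. by move: (fL (-1) 0 0); rewrite scaler0 addr0 scaleN1r addNr. Qed.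
Lemma linD : {morph f : x y / x + y}.
Proof. by move=> x y; rewrite -[x in LHS]scale1r fL scale1r. Qed.
Lemma linZ c : {morph f : x / c *: x}.
Proof. by move=> x; rewrite -[c *: x]addr0 fL lin0 addr0. Qed.
Lemma linN : {morph f : x / - x}.
Proof. by move=> x; rewrite -!scaleN1r linZ. Qed.
Lemma linB : {morph f : x y / x - y}.
Proof. by move=> x y; rewrite linD linN. Qed.
Lemma lin_sum I r (P : pred I) (E : I -> V) :
  f (\sum_(i <- r | P i) E i) = \sum_(i <- r | P i) f (E i).
Proof. exact: (big_morph f linD lin0). Qed.

End Linear.

Section FpsLinear.
Variables (K : fieldType).
Implicit Types A B C : algType K.

Lemma coefsD (A : nzRingType) (x y : fps A) n : coefs (x + y) n = coefs x n + coefs y n.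
Proof. by []. Qed.
Lemma coefsN (A : nzRingType) (x : fps A) n : coefs (- x) n = - coefs x n.
Proof. by []. Qed.
Lemma coefsM (A : nzRingType) (x y : fps A) n :
  coefs (x * y) n = \sum_(i < n.+1) coefs x i * coefs y (n - i).
Proof. by []. Qed.
Lemma coefsZ A (c : fps K) (x : fps A) n :
  coefs (c *: x) n = \sum_(i < n.+1) coefs c i *: coefs x (n - i).
Proof. by []. Qed.
Lemma coefs_sum (A : nzRingType) I r (P : pred I) (E : I -> fps A) n :
  coefs (\sum_(i <- r | P i) E i) n = \sum_(i <- r | P i) coefs (E i) n.
Proof. by apply: (big_morph (fun x : fps A => coefs x n)). Qed.

Lemma fps_constD (A : nzRingType) (a b : A) : (a + b)%:S = a%:S + b%:S.
Proof. by apply: fpsP => -[|n] //=; rewrite addr0. Qed.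

Lemma fps_const0 (A : nzRingType) : 0%:S = 0 :> fps A.
Proof. by apply: fpsP => -[]. Qed.

Lemma coefs_constM (A : nzRingType) (a : A) (y : fps A) n : coefs (a%:S * y) n = a * coefs y n.
Proof.
rewrite coefsM big_ord_recl big1 ?addr0 ?subn0 // => i _.
by rewrite mul0r.
Qed.

Lemma coefs_constZ A (c : K) (y : fps A) n : coefs (c%:S *: y) n = c *: coefs y n.
Proof.
rewrite coefsZ big_ord_recl big1 ?addr0 ?subn0 // => i _.
by rewrite scale0r.
Qed.

Lemma fps_constM (A : nzRingType) (a b : A) : (a * b)%:S = a%:S * b%:S.
Proof. by apply: fpsP => n; rewrite coefs_constM; case: n => //= n; rewrite mulr0. Qed.

Lemma fps_constZ A (c : K) (a : A) : (c *: a)%:S = c%:S *: a%:S.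
Proof. by apply: fpsP => n; rewrite coefs_constZ; case: n => //= n; rewrite scaler0. Qed.

Lemma coefs_xiZ A (x : fps A) n :
  coefs (fps_xi K *: x) n = if n is m.+1 then coefs x m else 0.
Proof.
rewrite coefsZ; case: n => [|n]; first by rewrite big_ord1 scale0r.
rewrite 2!big_ord_recl big1 /= ?scale0r ?add0r ?scale1r ?addr0 ?subn1 //.
by move=> i _; rewrite scale0r.
Qed.

Lemma coefs_xiXZ A (x : fps A) k n :
  coefs (fps_xi K ^+ k *: x) n = if (n < k)%N then 0 else coefs x (n - k).
Proof.
elim: k x n => [|k ih] x n; first by rewrite scale1r subn0.
by rewrite exprS -scalerA coefs_xiZ; case: n => // n; rewrite ih.
Qed.

Definition fps_drop A n (x : fps A) : fps A := FPS (fun i => coefs x (n + i)).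

(** The remainder is a multiple of [xi ^+ n], and a [K[[xi]]]-linear map keeps it so; this is how
    [coefs_lin] gets continuity out of linearity. *)
Lemma fps_decomp A n (x : fps A) :
  x = \sum_(k < n) fps_xi K ^+ k *: (coefs x k)%:S + fps_xi K ^+ n *: fps_drop n x.
Proof.
apply: fpsP => i; rewrite coefsD coefs_sum coefs_xiXZ.
under eq_bigr do rewrite coefs_xiXZ.
case: ltnP => [lt_in|le_ni]; last first.
  rewrite [X in _ + X]/= subnKC // big1 ?add0r // => k _.
  rewrite ltnNge (leq_trans (ltnW (ltn_ord k)) le_ni) /=.
  by case E: (i - k)%N => [|//]; move/eqP: E; rewrite subn_eq0 leqNgt (leq_trans (ltn_ord k)).
rewrite addr0 (bigD1 (Ordinal lt_in)) //= ltnn subnn big1 ?addr0 //= => k neq.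
case: ltngtP => // [lt|E]; last by case/eqP: neq; apply: val_inj.
by rewrite -[(i - k)%N]prednK ?subn_gt0.
Qed.

Section LinearFps.
Variables (A B : algType K) (f : fps A -> fps B).
Hypothesis fL : linear f.

(* Linearity over [K[[xi]]] forces [xi]-adic continuity. *)
Lemma coefs_lin (x : fps A) n :
  coefs (f x) n = \sum_(k < n.+1) coefs (f (coefs x k)%:S) (n - k).
Proof.
rewrite {1}(fps_decomp n.+1 x) (linD fL) (lin_sum fL) (linZ fL) coefsD coefs_xiXZ ltnSn addr0.
rewrite coefs_sum; apply: eq_bigr => k _.
by rewrite (linZ fL) coefs_xiXZ ltnNge -ltnS ltn_ord.
Qed.
End LinearFps.

Lemma fps_lin_ext A B (f g : fps A -> fps B) : linear f -> linear g ->
  (forall a, f a%:S = g a%:S) -> f =1 g.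
Proof.
move=> fL gL fg x; apply: fpsP => n; rewrite !coefs_lin //.
by apply: eq_bigr => k _; rewrite fg.
Qed.

Definition bilin A B C (f : fps A -> fps B -> fps C) :=
  (forall y, linear (f^~ y)) /\ (forall x, linear (f x)).

Section TensorLift.
Variables (A B C : algType K) (f : fps A -> fps B -> fps C).
Hypothesis fB : bilin f.

Lemma coefs_tlift t n : coefs (tlift (fun a b => f a%:S b%:S) t) n =
  tlift (fun a b => coefs (f a%:S b%:S) n) t.
Proof. by rewrite /tlift /tens_eval coefs_sum. Qed.

(** [f] may send a pair of constants to a series with terms in every degree, so it induces one
    [K]-bilinear map on [A] and [B] for each [n]. *)
Lemma bilinear_coefs n : is_bilinear (fun a b => coefs (f a%:S b%:S) n).
Proof.
by split=> [b|a] c x y; rewrite fps_constD fps_constZ ?(fB.1, fB.2) coefsD coefs_constZ.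
Qed.

Lemma coefs_fps_tlift t n : coefs (fps_tlift f t) n =
  \sum_(i < n.+1) tlift (fun a b => coefs (f a%:S b%:S) (n - i)) (coefs t i).
Proof. by rewrite /=; apply: eq_bigr => i _; rewrite coefs_tlift. Qed.

(** In degree [n] the scalar part of both sides is a sum over [i + j + k = n], with a coefficient of
    [c], a coefficient of [t] and the degree [k] part of [f]; [sum_triangle] matches the two
    groupings. *)
Lemma fps_tlift_linear : linear (fps_tlift f).
Proof.
move=> c t u; apply: fpsP => n; rewrite coefsD coefsZ.
rewrite !(coefs_fps_tlift (_ + _)) (coefs_fps_tlift u).
under eq_bigr => i _.
  rewrite coefsD (tliftD (bilinear_coefs _)) coefsZ.
  rewrite (big_morph _ (tliftD (bilinear_coefs _)) (tlift0 (bilinear_coefs _))).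
  over.
rewrite big_split /=; congr (_ + _).
under [RHS]eq_bigr => i _.
  rewrite -[X in _ *: X]/(coefs (fps_tlift f t) _) coefs_fps_tlift scaler_sumr.
  over.
rewrite -(sum_triangle (fun i j k => coefs c i *:
   tlift (fun a b => coefs (f a%:S b%:S) k) (coefs t j))).
apply: eq_bigr => i _; apply: eq_bigr => j _.
by rewrite (tliftZ (bilinear_coefs _)).
Qed.
End TensorLift.

(** * Pure tensors of power series *)

Section TensorProduct.
Variables (A B : algType K).

Lemma coefs_tens (x : fps A) (y : fps B) n : 
  coefs (x \ox y) n = \sum_(i < n.+1) tpure (coefs x i) (coefs y (n - i)).
Proof. by []. Qed.

Lemma tens_const (a : A) (b : B) : a%:S \ox b%:S = (tpure a b)%:S.
Proof.
apply: fpsP => n; rewrite coefs_tens big_ord_recl big1 ?addr0 ?subn0 /=.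
  by case: n => //= n; rewrite (bilinear0r (tpure_bilinear A B)).
by move=> i _; rewrite (bilinear0l (tpure_bilinear A B)).
Qed.

Lemma tens_bilin : bilin (@fps_tens K A B).
Proof.
have TB := tpure_bilinear A B.
split=> [y|x] c u v; apply: fpsP => n; rewrite coefsD coefsZ !coefs_tens.
  under eq_bigr => i _ do rewrite coefsD (bilinearDl TB) coefsZ
    (big_morph (fun a => tpure a _) (fun _ _ => bilinearDl TB _ _ _) (bilinear0l TB _)).
  rewrite big_split /=; congr (_ + _).
  under [RHS]eq_bigr => i _ do rewrite scaler_sumr.
  rewrite -(sum_triangle (fun i j k => coefs c i *: tpure (coefs u j) (coefs y k))).
    by apply: eq_bigr => i _; apply: eq_bigr => j _; rewrite (bilinearZl TB).
under eq_bigr => i _ do rewrite coefsD (bilinearDr TB) coefsZ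
    (big_morph (tpure _) (fun _ _ => bilinearDr TB _ _ _) (bilinear0r TB _)).
rewrite big_split /=; congr (_ + _).
under [RHS]eq_bigr => i _ do rewrite scaler_sumr.
transitivity (\sum_(i < n.+1) \sum_(j < (n - i).+1)
    coefs c j *: tpure (coefs x i) (coefs u (n - i - j))).
  by apply: eq_bigr => i _; apply: eq_bigr => j _; rewrite (bilinearZr TB).
(* The scalar carries the middle index here. Grouping the first two indices by their sum and
   reversing the inner sum exchanges them. *)
rewrite -(sum_triangle (fun i j k => coefs c j *: tpure (coefs x i) (coefs u k))).
rewrite -(sum_triangle (fun i j k => coefs c i *: tpure (coefs x j) (coefs u k))).
apply: eq_bigr => i _; rewrite (reindex_inj rev_ord_inj) /=.
by apply: eq_bigr => -[j /= lt_ji] _; rewrite subSS subKn //; exact: lt_ji.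
Qed.

Lemma tensPl c x x' (y : fps B) :
  (c *: x + x') \ox y = c *: (x \ox y) + x' \ox y :> fps (tens A B).
Proof. exact: tens_bilin.1. Qed.
Lemma tensPr c (x : fps A) y y' :
  x \ox (c *: y + y') = c *: (x \ox y) + x \ox y' :> fps (tens A B).
Proof. exact: tens_bilin.2. Qed.
Lemma tensDl x x' (y : fps B) : (x + x') \ox y = x \ox y + x' \ox y :> fps (tens A B).
Proof. exact: (linD (tens_bilin.1 y)). Qed.
Lemma tensDr (x : fps A) y y' : x \ox (y + y') = x \ox y + x \ox y' :> fps (tens A B).
Proof. exact: (linD (tens_bilin.2 x)). Qed.
Lemma tensZl c x (y : fps B) : (c *: x) \ox y = c *: (x \ox y) :> fps (tens A B).
Proof. exact: (linZ (tens_bilin.1 y)). Qed.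
Lemma tensZr c (x : fps A) y : x \ox (c *: y) = c *: (x \ox y) :> fps (tens A B).
Proof. exact: (linZ (tens_bilin.2 x)). Qed.
Lemma tensNl x (y : fps B) : (- x) \ox y = - (x \ox y) :> fps (tens A B).
Proof. exact: (linN (tens_bilin.1 y)). Qed.
Lemma tensNr (x : fps A) y : x \ox (- y) = - (x \ox y) :> fps (tens A B).
Proof. exact: (linN (tens_bilin.2 x)). Qed.

Lemma tens0r (x : fps A) : x \ox (0 : fps B) = 0 :> fps (tens A B).
Proof. exact: (lin0 (tens_bilin.2 x)). Qed.
Lemma tens0l (y : fps B) : (0 : fps A) \ox y = 0 :> fps (tens A B).
Proof. exact: (lin0 (tens_bilin.1 y)). Qed.

Lemma tens11 : 1 \ox 1 = 1 :> fps (tens A B).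
Proof. exact: tens_const. Qed.

Lemma fps_tens_ext (C : algType K) (f g : fps (tens A B) -> fps C) :
  linear f -> linear g -> (forall x y, f (x \ox y) = g (x \ox y)) -> f =1 g.
Proof.
move=> fL gL fg; apply: fps_lin_ext => // t; rewrite (tens_sum_pure t).
elim: (repr t) => [|p s ih]; first by rewrite big_nil fps_const0 !lin0.
by rewrite big_cons fps_constD !linD // ih -tens_const fg.
Qed.

Lemma fps_tlift_tens (C : algType K) (f : fps A -> fps B -> fps C) : bilin f ->
  forall x y, fps_tlift f (x \ox y) = f x y.
Proof.
move=> fB; have fL := fps_tlift_linear fB.
move=> x y; move: y; apply: fps_lin_ext; [|exact: fB.2|move=> b].
  by move=> c u v; rewrite tensPr fL.
move: x; apply: fps_lin_ext; [|exact: fB.1|move=> a].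
  by move=> c u v; rewrite tensPl fL.
rewrite tens_const; apply: fpsP => n; rewrite coefs_fps_tlift big_ord_recl big1.
  by rewrite addr0 subn0 (tlift_pure (bilinear_coefs fB _)).
by move=> i _; rewrite (tlift0 (bilinear_coefs fB _)).
Qed.

Lemma tensM (x x' : fps A) (y y' : fps B) :
  (x \ox y) * (x' \ox y') = (x * x') \ox (y * y') :> fps (tens A B).
Proof.
move: x; apply: fps_lin_ext => [c u v|c u v|a].
- by rewrite tensPl mulrDl scalerAl.
- by rewrite mulrDl -scalerAl tensPl.
move: x'; apply: fps_lin_ext => [c u v|c u v|a'].
- by rewrite tensPl mulrDr scalerAr.
- by rewrite mulrDr -scalerAr tensPl.
move: y; apply: fps_lin_ext => [c u v|c u v|b].
- by rewrite tensPr mulrDl scalerAl.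
- by rewrite mulrDl -scalerAl tensPr.
move: y'; apply: fps_lin_ext => [c u v|c u v|b'].
- by rewrite tensPr mulrDr scalerAr.
- by rewrite mulrDr -scalerAr tensPr.
by rewrite !tens_const -!fps_constM !tens_const tpureM.
Qed.
End TensorProduct.

(** * Algebra morphisms between power series algebras *)

Definition alg_mor A B (f : fps A -> fps B) := linear f /\ monoid_morphism f.

Section AlgMor.
Variables (A B : algType K) (f : fps A -> fps B).
Hypothesis fA : alg_mor f.

Lemma am_lin : linear f. Proof. exact: fA.1. Qed.
Lemma am1 : f 1 = 1. Proof. exact: fA.2.1. Qed.
Lemma amM : {morph f : x y / x * y}. Proof. exact: fA.2.2. Qed.
Lemma amX n : {morph f : x / x ^+ n}.
Proof. by elim: n => [|n ih] x; rewrite ?expr0 ?am1 // !exprS amM ih. Qed.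
Lemma am_prod I r (P : pred I) (E : I -> fps A) :
  f (\prod_(i <- r | P i) E i) = \prod_(i <- r | P i) f (E i).
Proof. exact: (big_morph f amM am1). Qed.
Lemma am_unit x : x \is a GRing.unit -> f x \is a GRing.unit.
Proof.
by move=> xU; apply/unitrP; exists (f x^-1); rewrite -!amM mulVr ?mulrV ?am1.
Qed.
Lemma amV x : x \is a GRing.unit -> f x^-1 = (f x)^-1.
Proof.
by move=> xU; apply: (mulrI (am_unit xU)); rewrite -amM !mulrV ?am1 ?am_unit.
Qed.
End AlgMor.

Lemma am_comp A B C (g : fps B -> fps C) (f : fps A -> fps B) :
  alg_mor g -> alg_mor f -> alg_mor (g \o f).
Proof.
move=> gA fA; split; first by move=> c x y; rewrite /= fA.1 gA.1.
by split=> [|x y]; rewrite /= ?(am1 fA) ?(am1 gA) // (amM fA) (amM gA).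
Qed.

Lemma fps_tlift_mor A B C (f : fps A -> fps B -> fps C) : bilin f -> f 1 1 = 1 ->
  (forall x x' y y', f (x * x') (y * y') = f x y * f x' y') -> alg_mor (fps_tlift f).
Proof.
move=> fB f1 fM; have fL := fps_tlift_linear fB.
split=> //; split=> [|t u]; first by rewrite -tens11 fps_tlift_tens.
move: t; apply: fps_tens_ext => [c t t'|c t t'|x y].
- by rewrite mulrDl -scalerAl fL.
- by rewrite fL mulrDl scalerAl.
move: u; apply: fps_tens_ext => [c t t'|c t t'|x' y'].
- by rewrite mulrDr -scalerAr fL.
- by rewrite fL mulrDr scalerAr.
by rewrite tensM !fps_tlift_tens.
Qed.

Section TensMor.
Variables (A B C : algType K) (f : fps A -> fps C) (g : fps B -> fps C).
Hypotheses (fA : alg_mor f) (gA : alg_mor g).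
Hypothesis fg_comm : forall x y, GRing.comm (f x) (g y).

Lemma tens_mor_bilin : bilin (fun x y => f x * g y).
Proof.
split=> [y|x] c u v; first by rewrite fA.1 mulrDl scalerAl.
by rewrite gA.1 mulrDr scalerAr.
Qed.

Lemma tens_mor : alg_mor (fps_tlift (fun x y => f x * g y)).
Proof.
apply: fps_tlift_mor; first exact: tens_mor_bilin.
  by rewrite (am1 fA) (am1 gA) mulr1.
move=> x x' y y'; rewrite (amM fA) (amM gA) !mulrA; congr (_ * _).
by rewrite -!mulrA (fg_comm x' y).
Qed.
End TensMor.
End FpsLinear.

(** * Substitution, exponential and logarithm *)

Section Substitution.
Variables (K : fieldType).
Implicit Types A B : algType K.

(** Regroups a product of two truncated series by total degree; the terms of the square beyond
    degree [n] are those assumed to vanish. *)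
Lemma sum_square_triangle (V : nmodType) n (G : nat -> nat -> V) :
  (forall i j, (n < i + j)%N -> G i j = 0) ->
  \sum_(i < n.+1) \sum_(j < n.+1) G i j = \sum_(m < n.+1) \sum_(i < m.+1) G i (m - i)%N.
Proof.
move=> G0; rewrite (sum_triangle (fun i j _ => G i j)); apply: eq_bigr => i _.
rewrite -(big_mkord xpredT (G i)) -[RHS](big_mkord xpredT (G i)).
rewrite (big_cat_nat (n := (n - i).+1)) ?ltnS ?leq_subr //= [X in _ + X]big_nat_cond.
rewrite [X in _ + X]big1 ?addr0 // => j /andP[/andP[lt _] _]; apply: G0.
by rewrite -ltn_subLR // -ltnS.
Qed.

Lemma coefs0Z A c (x : fps A) : coefs (c *: x) 0 = coefs c 0 *: coefs x 0.
Proof. by rewrite coefsZ big_ord1. Qed.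
Lemma coefs0_tens A B (x : fps A) (y : fps B) :
  coefs (x \ox y) 0 = tpure (coefs x 0) (coefs y 0).
Proof. by rewrite coefs_tens big_ord1. Qed.
Lemma coefs0_lin A B (f : fps A -> fps B) (x : fps A) :
  linear f -> coefs x 0 = 0 -> coefs (f x) 0 = 0.
Proof. by move=> fL x0; rewrite coefs_lin // big_ord1 x0 fps_const0 lin0. Qed.

Lemma coefsX_eq0 A (x : fps A) k n :
  coefs x 0 = 0 -> (n < k)%N -> coefs (x ^+ k) n = 0.
Proof.
move=> x0; elim: k n => // k ih n lt_nk.
rewrite exprS coefsM big_ord_recl x0 mul0r add0r big1 // => i _.
rewrite ih ?mulr0 //= /bump /=.
by case: n lt_nk i => [|n] lt_nk [i lt_i] //=; rewrite subSS (leq_ltn_trans (leq_subr _ _)).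
Qed.

(** [p(x)], meaningful when [x] has zero constant term. *)
Definition fps_subst A (x : fps A) (p : fps K) : fps A :=
  FPS (fun n => \sum_(k < n.+1) coefs p k *: coefs (x ^+ k) n).

Lemma coefs_substE A (x : fps A) p n :
  coefs (fps_subst x p) n = \sum_(k < n.+1) coefs p k *: coefs (x ^+ k) n.
Proof. by []. Qed.

(** Trades the substitution for a polynomial in [x]. Any truncation order [m >= n] will do, since
    [x ^+ k] starts in degree [k]; the freedom in [m] lets all degrees up to [n] share one
    polynomial. *)
Lemma coefs_subst A (x : fps A) p n m : coefs x 0 = 0 -> (n <= m)%N ->
  coefs (fps_subst x p) n = coefs (\sum_(k < m.+1) (coefs p k)%:S *: x ^+ k) n.
Proof.
move=> x0 le_nm; rewrite coefs_sum.
under [RHS]eq_bigr do rewrite coefs_constZ.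
rewrite [LHS]/=.
rewrite -(big_mkord xpredT (fun k => coefs p k *: coefs (x ^+ k) n)).
rewrite -[RHS](big_mkord xpredT (fun k => coefs p k *: coefs (x ^+ k) n)).
rewrite [RHS](big_cat_nat (n := n.+1)) ?ltnS //= [X in _ + X]big_nat_cond.
by rewrite [X in _ + X]big1 ?addr0 // => k /andP[/andP[lt _] _]; rewrite coefsX_eq0 ?scaler0.
Qed.

Lemma coefs_mul_local A (x x' y y' : fps A) n :
  (forall i, (i <= n)%N -> coefs x i = coefs x' i) ->
  (forall i, (i <= n)%N -> coefs y i = coefs y' i) ->
  coefs (x * y) n = coefs (x' * y') n.
Proof.
move=> xx yy; rewrite !coefsM; apply: eq_bigr => i _.
by rewrite xx ?yy ?leq_subr // -ltnS.
Qed.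

Section Subst.
Variables (A : algType K) (x : fps A).
Hypothesis x0 : coefs x 0 = 0.

Lemma fps_substD p q : fps_subst x (p + q) = fps_subst x p + fps_subst x q.
Proof.
apply: fpsP => n; rewrite coefsD /= -big_split; apply: eq_bigr => k _ /=.
by rewrite scalerDl.
Qed.
Lemma fps_substZ c p : fps_subst x (c%:S * p) = c%:S *: fps_subst x p.
Proof.
apply: fpsP => n; rewrite coefs_constZ !coefs_substE scaler_sumr.
by apply: eq_bigr => k _; rewrite coefs_constM -scalerA.
Qed.
Lemma fps_subst1 : fps_subst x 1 = 1.
Proof.
apply: fpsP => n; rewrite /= big_ord_recl big1 ?scale1r ?addr0 //.
by move=> i _; rewrite scale0r.
Qed.
Lemma fps_subst_xi : fps_subst x (fps_xi K) = x.
Proof.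
apply: fpsP => -[|n]; first by rewrite /= big_ord1 scale0r x0.
rewrite /= !big_ord_recl big1 /= ?scale0r ?scale1r ?addr0 ?add0r //.
by move=> i _; rewrite scale0r.
Qed.

Lemma fps_substM p q : fps_subst x (p * q) = fps_subst x p * fps_subst x q.
Proof.
apply: fpsP => n; rewrite (coefs_subst _ x0 (leqnn n)).
transitivity (coefs ((\sum_(k < n.+1) (coefs p k)%:S *: x ^+ k) *
                     (\sum_(k < n.+1) (coefs q k)%:S *: x ^+ k)) n); last first.
  rewrite !coefsM; apply: eq_bigr => i _; rewrite -!(coefs_subst _ x0) ?leq_subr //.
  by rewrite -ltnS.
rewrite big_distrlr /=.
under [in RHS]eq_bigr => i _ do under eq_bigr => j _ do
   rewrite -scalerAl -scalerAr scalerA -exprD.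
rewrite !coefs_sum; under [RHS]eq_bigr do rewrite coefs_sum.
(* Pairs with [i + j > n] involve [x ^+ (i + j)], which has no term of degree [n]. *)
rewrite (sum_square_triangle (G := fun i j =>
  coefs (((coefs p i)%:S * (coefs q j)%:S) *: x ^+ (i + j)) n)); last first.
  move=> i j lt; rewrite -(fps_constM) coefs_constZ.
  by rewrite coefsX_eq0 ?scaler0.
apply: eq_bigr => m _; rewrite coefs_constZ scaler_suml; apply: eq_bigr => i _.
by rewrite -(fps_constM) coefs_constZ subnKC // -ltnS.
Qed.

Lemma fps_substX p n : fps_subst x (p ^+ n) = fps_subst x p ^+ n.
Proof.
by elim: n => [|n ih]; rewrite ?expr0 ?fps_subst1 // !exprS fps_substM ih.
Qed.

(** The relation passes to powers, hence to truncated series. Applied to the exponential it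
    transports conjugations of exponents to exponentials, and [z := x] yields commutation. *)
Lemma fps_subst_intertwine p (y z : fps A) : coefs z 0 = 0 ->
  x * y = y * z -> fps_subst x p * y = y * fps_subst z p.
Proof.
move=> z0 xy.
have xyX k : x ^+ k * y = y * z ^+ k.
  elim: k => [|k ih]; first by rewrite mulr1 mul1r.
  by rewrite exprS -mulrA ih mulrA xy -mulrA -exprS.
apply: fpsP => n; pose T u := \sum_(k < n.+1) (coefs p k)%:S *: u ^+ k : fps A.
transitivity (coefs (T x * y) n).
  by apply: coefs_mul_local => // i le_in; exact: coefs_subst.
transitivity (coefs (y * T z) n).
  rewrite mulr_suml mulr_sumr; congr coefs; apply: eq_bigr => k _.
  by rewrite -scalerAl xyX scalerAr.
by apply: coefs_mul_local => // i le_in; rewrite (coefs_subst _ z0 le_in).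
Qed.

Lemma fps_subst_comm p (y : fps A) : GRing.comm y x -> GRing.comm y (fps_subst x p).
Proof. by move=> xy; apply/esym/fps_subst_intertwine. Qed.

(** Multiplicativity is asked on the powers of [x] only, so that anti-morphisms such as the antipode
    are covered. *)
Lemma fps_subst_map B (f : fps A -> fps B) p : linear f ->
  (forall k, f (x ^+ k) = f x ^+ k) -> f (fps_subst x p) = fps_subst (f x) p.
Proof.
move=> fL fX; have fx0 := coefs0_lin fL x0.
apply: fpsP => n; rewrite (coefs_subst _ fx0 (leqnn n)).
transitivity (coefs (f (\sum_(k < n.+1) (coefs p k)%:S *: x ^+ k)) n).
  rewrite !(coefs_lin fL); apply: eq_bigr => i _.
  by rewrite (coefs_subst p x0 (m := n)) // -ltnS.
by rewrite (lin_sum fL); under eq_bigr do rewrite (linZ fL) fX.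
Qed.
End Subst.

(** Reduces [exp(ln(1 + x)) = 1 + x] in any algebra to the same identity in [K[[xi]]]. The series
    [y] is read over the regular algebra [K^o] so that it can be substituted into [p]. *)
Lemma fps_subst_subst A (x : fps A) (y p : fps K) : coefs x 0 = 0 -> coefs y 0 = 0 ->
  fps_subst x (fps_subst (y : fps K^o) p) = fps_subst (fps_subst x y) p.
Proof.
move=> x0 y0; have xy0 : coefs (fps_subst x y) 0 = 0.
  by rewrite /= big_ord1 y0 scale0r.
apply: fpsP => n; rewrite (coefs_subst _ xy0 (leqnn n)).
transitivity (coefs (fps_subst x (\sum_(k < n.+1) (coefs p k)%:S *: (y : fps K^o) ^+ k)) n).
  rewrite [LHS]/= [RHS]/=; apply: eq_bigr => i _; congr (_ *: _).
  by rewrite -(coefs_subst (A := K^o) p y0) // -ltnS.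
congr coefs; rewrite (big_morph _ (fps_substD x) (_ : _ = 0)); last first.
  by apply: fpsP => m; rewrite /= big1 // => i _; rewrite scale0r.
by apply: eq_bigr => k _; rewrite fps_substZ // fps_substX.
Qed.
End Substitution.

(** * The exponential and logarithm series *)

Section ExpLog.
Variable K : numFieldType.
Implicit Types A B : algType K.

Definition exp_series : fps K := FPS (fun n => n`!%:R^-1).
(** In degree 0 the formula reads [- 1 / 0], which is 0 by convention, so the constant term is the
    right one. *)
Definition ln1p_series : fps K := FPS (fun n => (-1) ^+ n.+1 / n%:R).

Lemma fps_expE A (x : fps A) : fps_exp x = fps_subst x exp_series.
Proof. by apply: fpsP => n; rewrite /= big_mkord. Qed.

Lemma fps_ln1pE A (x : fps A) : fps_ln1p x = fps_subst x ln1p_series.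
Proof.
apply: fpsP => n; rewrite /= -(big_mkord xpredT
  (fun k => ((-1) ^+ k.+1 / k%:R : K) *: coefs (x ^+ k) n)).
by rewrite [RHS]big_ltn // invr0 mulr0 scale0r add0r.
Qed.

Lemma fps_const_nat (B : nzRingType) n : (n%:R : B)%:S = n%:R.
Proof. by elim: n => [|n ih]; rewrite ?fps_const0 // -natr1 fps_constD ih -natr1. Qed.

Section Exp.
Variables (A : algType K) (x : fps A).
Hypothesis x0 : coefs x 0 = 0.

Lemma coefs0_exp : coefs (fps_exp x) 0 = 1.
Proof. by rewrite /= big_nat1 invr1 scale1r. Qed.
Lemma coefs0_ln1p : coefs (fps_ln1p x) 0 = 0.
Proof. by rewrite /= big_geq. Qed.

Lemma fps_exp_intertwine (y z : fps A) : coefs z 0 = 0 ->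
  x * y = y * z -> fps_exp x * y = y * fps_exp z.
Proof. by move=> z0; rewrite !fps_expE; exact: fps_subst_intertwine. Qed.

Lemma fps_exp_comm (y : fps A) : GRing.comm y x -> GRing.comm y (fps_exp x).
Proof. by rewrite fps_expE; exact: fps_subst_comm. Qed.
Lemma fps_ln1p_comm (y : fps A) : GRing.comm y x -> GRing.comm y (fps_ln1p x).
Proof. by rewrite fps_ln1pE; exact: fps_subst_comm. Qed.

Lemma fps_exp_map B (f : fps A -> fps B) : linear f ->
  (forall k, f (x ^+ k) = f x ^+ k) -> f (fps_exp x) = fps_exp (f x).
Proof. by rewrite !fps_expE; exact: fps_subst_map. Qed.
Lemma fps_ln1p_map B (f : fps A -> fps B) : linear f ->
  (forall k, f (x ^+ k) = f x ^+ k) -> f (fps_ln1p x) = fps_ln1p (f x).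
Proof. by rewrite !fps_ln1pE; exact: fps_subst_map. Qed.
Lemma am_exp B (f : fps A -> fps B) : alg_mor f -> f (fps_exp x) = fps_exp (f x).
Proof. by move=> fA; apply: fps_exp_map => [|k]; [exact: fA.1 | exact: amX]. Qed.
Lemma am_ln1p B (f : fps A -> fps B) : alg_mor f -> f (fps_ln1p x) = fps_ln1p (f x).
Proof. by move=> fA; apply: fps_ln1p_map => [|k]; [exact: fA.1 | exact: amX]. Qed.

Lemma coefs_exp n m : (n <= m)%N ->
  coefs (fps_exp x) n = coefs (\sum_(k < m.+1) (k`!%:R^-1 : K)%:S *: x ^+ k) n.
Proof. by rewrite fps_expE => le; rewrite (coefs_subst _ x0 le). Qed.

(** By induction [x^k y = y x^k + k c x^(k-1)], because [c] commutes with [x]; then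
    [k / k! = 1 / (k-1)!] shifts the exponential series by one place. *)
Lemma fps_exp_commutator (y c : fps A) : x * y = y * x + c -> x * c = c * x ->
  fps_exp x * y = (y + c) * fps_exp x.
Proof.
move=> xy xc; apply: fpsP => n.
pose T m := \sum_(k < m.+1) (k`!%:R^-1 : K)%:S *: x ^+ k.
have TE m i : (i <= n)%N -> (n <= m)%N -> coefs (fps_exp x) i = coefs (T m) i.
  by move=> le le'; apply/coefs_exp/(leq_trans le).
have xyX k : x ^+ k * y = y * x ^+ k + (c * x ^+ k.-1) *+ k.
  elim: k => [|k ih]; first by rewrite mulr1 mul1r addr0.
  rewrite exprS -mulrA ih mulrDr mulrnAr !mulrA xy xc mulrDl -!mulrA -addrA mulrS.
  by congr (_ + (_ + _)); case: k {ih} => [|k] //=; rewrite -exprS.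
(* The truncation at [n + 1] becomes one at [n] in the term with [c], because of that shift of
   index. *)
transitivity (coefs (T n.+1 * y) n).
  by apply: coefs_mul_local => // i le_in; rewrite (TE n.+1).
rewrite mulrDl coefsD.
have -> : coefs (y * fps_exp x) n = coefs (y * T n.+1) n.
  by apply: coefs_mul_local => // i le_in; rewrite (TE n.+1).
have -> : coefs (c * fps_exp x) n = coefs (c * T n) n.
  by apply: coefs_mul_local => // i le_in; rewrite (TE n).
rewrite -coefsD; congr coefs.
have -> : T n.+1 * y = \sum_(k < n.+2) (k`!%:R^-1 : K)%:S *: (y * x ^+ k)
                     + \sum_(k < n.+2) (k`!%:R^-1 : K)%:S *: ((c * x ^+ k.-1) *+ k).
  rewrite mulr_suml -big_split; apply: eq_bigr => k _.
  by rewrite -scalerAl xyX scalerDr.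
rewrite !mulr_sumr; congr (_ + _); first by apply: eq_bigr => k _; rewrite scalerAr.
rewrite big_ord_recl scaler0 add0r; apply: eq_bigr => k _.
rewrite -scalerAr -scaler_nat scalerA; congr (_ *: _).
rewrite lift0 -fps_const_nat -fps_constM; congr (_%:S).
by rewrite factS natrM invfM mulrAC mulVf ?mul1r ?pnatr_eq0.
Qed.
End Exp.

Lemma fps_exp0 A : fps_exp (0 : fps A) = 1.
Proof.
apply: fpsP => n; rewrite /= big_ltn // big_nat_cond big1 => [|[|k] //].
  by rewrite addr0 fact0 invr1 scale1r expr0.
by move=> _; rewrite expr0n /= scaler0.
Qed.

(** The binomial formula for commuting elements, applied in each total degree [m] of the product of
    two truncated exponentials. *)
Lemma fps_expD A (x y : fps A) : coefs x 0 = 0 -> coefs y 0 = 0 -> GRing.comm x y ->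
  fps_exp (x + y) = fps_exp x * fps_exp y.
Proof.
move=> x0 y0 xy; have xy0 : coefs (x + y) 0 = 0 by rewrite coefsD x0 y0 addr0.
apply: fpsP => n; rewrite (coefs_exp xy0 (leqnn n)).
transitivity (coefs ((\sum_(k < n.+1) (k`!%:R^-1 : K)%:S *: x ^+ k) *
                     (\sum_(k < n.+1) (k`!%:R^-1 : K)%:S *: y ^+ k)) n); last first.
  by apply: coefs_mul_local => i le_in; rewrite -coefs_exp.
rewrite big_distrlr coefs_sum coefs_sum.
under [RHS]eq_bigr do rewrite coefs_sum.
rewrite (sum_square_triangle (G := fun i j => coefs (((i`!%:R^-1 : K)%:S *: x ^+ i) *
  ((j`!%:R^-1 : K)%:S *: y ^+ j)) n)); last first.
  move=> i j lt_nij; rewrite -scalerAl -scalerAr scalerA -fps_constM coefs_constZ.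
  rewrite coefsM big1 ?scaler0 // => k _.
  have [lt_ki|le_ik] := ltnP k i; first by rewrite (coefsX_eq0 x0) ?mul0r.
  rewrite (coefsX_eq0 y0) ?mulr0 // ltn_subLR; last by rewrite -ltnS.
  by rewrite (leq_trans lt_nij) // leq_add2r.
apply: eq_bigr => m _; rewrite exprDn_comm // scaler_sumr coefs_sum.
rewrite (reindex_inj rev_ord_inj); apply: eq_bigr => i _.
have -> : rev_ord i = (m - i)%N :> nat by rewrite /= subSS.
have le_im : (i <= m)%N by rewrite -ltnS.
rewrite subKn // -scalerAl -scalerAr scalerA -scaler_nat scalerA; congr (coefs (_ *: _) n).
rewrite -fps_const_nat -!fps_constM; congr (_%:S).
have f0 k : (k`!%:R : K) != 0 by rewrite pnatr_eq0 -lt0n fact_gt0.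
apply: (mulfI (f0 m)); rewrite mulrA mulfV // mul1r -(bin_fact le_im) !natrM.
by rewrite bin_sub // -[RHS]mulrA mulrACA !mulfV // !mulr1.
Qed.

Lemma fps_expN A (x : fps A) : coefs x 0 = 0 -> fps_exp x * fps_exp (- x) = 1.
Proof.
move=> x0; rewrite -fps_expD ?subrr ?fps_exp0 //; first by rewrite coefsN x0 oppr0.
by rewrite /GRing.comm mulrN mulNr.
Qed.

Lemma fps_exp_unit A (x : fps A) : coefs x 0 = 0 -> fps_exp x \is a GRing.unit.
Proof.
move=> x0; apply/unitrP; exists (fps_exp (- x)).
by rewrite fps_expN // -{2}[x]opprK fps_expN // coefsN x0 oppr0.
Qed.

Lemma fps_expV A (x : fps A) : coefs x 0 = 0 -> (fps_exp x)^-1 = fps_exp (- x).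
Proof.
by move=> x0; apply: (mulrI (fps_exp_unit x0)); rewrite mulrV ?fps_exp_unit // fps_expN.
Qed.

Lemma fps_exp_prod A (I : eqType) (r : seq I) (a : I -> fps A) :
  {in r, forall i, coefs (a i) 0 = 0} -> {in r &, forall i j, GRing.comm (a i) (a j)} ->
  \prod_(i <- r) fps_exp (a i) = fps_exp (\sum_(i <- r) a i).
Proof.
elim: r => [|i r ih] a0 ac; first by rewrite !big_nil fps_exp0.
have sub j : j \in r -> j \in i :: r by rewrite inE orbC => ->.
rewrite !big_cons ih; first last.
- by move=> j k /sub jr /sub kr; exact: ac.
- by move=> j /sub; exact: a0.
rewrite fps_expD ?a0 ?mem_head //.
  by rewrite coefs_sum big_seq big1 // => j /sub; exact: a0.
by rewrite big_seq; apply: commr_sum => j /sub jr; apply: ac; rewrite ?mem_head.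
Qed.

(** By commutation [exp(x - y) = 1]. If [z = x - y] vanishes up to degree [n], its powers from the
    square on vanish up to degree [n + 1], so the coefficient of [exp z] there is that of [z]. This
    later identifies the images of [sigma] from their exponentials. *)
Lemma fps_exp_inj A (x y : fps A) : coefs x 0 = 0 -> coefs y 0 = 0 -> GRing.comm x y ->
  fps_exp x = fps_exp y -> x = y.
Proof.
move=> x0 y0 xy exy; apply/eqP; rewrite -subr_eq0; apply/eqP.
have yN0 : coefs (- y) 0 = 0 by rewrite coefsN y0 oppr0.
have z0 : coefs (x - y) 0 = 0 by rewrite coefsD x0 yN0 addr0.
have : fps_exp (x - y) = 1.
  by rewrite fps_expD ?exy ?fps_expN // /GRing.comm mulrN mulNr xy.
move: (x - y) z0 => z z0 ez; apply: fpsP => n.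
elim/ltn_ind: n => -[//|n] ih.
have zX k m : (m <= n.+1)%N -> (1 < k)%N -> coefs (z ^+ k) m = 0.
  case: k => // -[//|k] le_mn _; elim: k m le_mn => [|k ihk] m le_mn.
    rewrite coefsM big1 // => i _; case: (ltngtP i n.+1) => [lt||E].
    - by rewrite ih ?mul0r.
    - by rewrite ltnNge -ltnS (leq_trans (ltn_ord i)).
    - by rewrite E (_ : (m - n.+1)%N = 0%N) ?z0 ?mulr0 //; apply/eqP; rewrite subn_eq0.
  rewrite exprS coefsM big1 // => i _; rewrite ihk ?mulr0 //.
  exact: leq_trans (leq_subr _ _) le_mn.
move: (congr1 (fun x => coefs x n.+1) ez); rewrite /= 2?big_ltn // big_nat_cond big1.
  by rewrite !addr0 /= fact0 !invr1 !scale1r add0r.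
by move=> k /andP[/andP[lt _] _]; rewrite zX ?scaler0.
Qed.

(* [xi d/dxi] *)
Definition fps_euler (A : nzRingType) (p : fps A) : fps A := FPS (fun n => coefs p n *+ n).

(** Such a [d] acts on series in [x] as the Euler operator acts on series in [xi]. It will be
    applied to half the commutator with [h], at [x = u]. *)
Lemma fps_subst_euler A (x : fps A) (d : fps A -> fps A) p : coefs x 0 = 0 -> linear d ->
  (forall k, d (x ^+ k) = x ^+ k *+ k) ->
  d (fps_subst x p) = fps_subst x (fps_euler p).
Proof.
move=> x0 dL dX; apply: fpsP => n; rewrite (coefs_subst _ x0 (leqnn n)).
transitivity (coefs (d (\sum_(k < n.+1) (coefs p k)%:S *: x ^+ k)) n).
  rewrite !(coefs_lin dL); apply: eq_bigr => i _.
  by rewrite (coefs_subst p x0 (m := n)) // -ltnS.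
rewrite (lin_sum dL); congr coefs; apply: eq_bigr => k _.
rewrite (linZ dL) dX -scaler_nat scalerA -fps_const_nat -fps_constM.
by rewrite mulr_natr.
Qed.

Lemma fps_eulerM (p q : fps K^o) : fps_euler (p * q) = fps_euler p * q + p * fps_euler q.
Proof.
apply: fpsP => n; rewrite coefsD !coefsM -big_split /= -sumrMnl; apply: eq_bigr => i _.
by rewrite mulrnAl mulrnAr -mulrnDr subnKC // -ltnS.
Qed.

Lemma fps_euler_exp (p : fps K^o) : coefs p 0 = 0 ->
  fps_euler (fps_exp p) = fps_euler p * fps_exp p.
Proof.
move=> p0; have eX k : fps_euler (p ^+ k) = (fps_euler p * p ^+ k.-1) *+ k.
  elim: k => [|k ih].
    by rewrite mulr0n; apply: fpsP => -[|n] /=; rewrite ?mulr0n ?mul0rn.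
  rewrite exprS fps_eulerM ih mulrnAr mulrCA mulrS; congr (_ + _).
  by case: k {ih} => [|k] //=; rewrite -exprS.
apply: fpsP => n.
pose T m : fps K^o := \sum_(k < m.+1) (k`!%:R^-1 : K)%:S *: p ^+ k.
transitivity (coefs (fps_euler (T n.+1)) n).
  by rewrite /fps_euler [LHS]/= [RHS]/= -(coefs_exp p0).
transitivity (coefs (fps_euler p * T n) n); last first.
  by apply: coefs_mul_local => // i le_in; rewrite (coefs_exp p0 le_in).
have euD : {morph @fps_euler K^o : x y / x + y}.
  by move=> x y; apply: fpsP => m; rewrite /= mulrnDl.
have eu0 : @fps_euler K^o 0 = 0 by apply: fpsP => m; rewrite /= mul0rn.
have euZ c (x : fps K^o) : @fps_euler K^o (c%:S *: x) = c%:S *: fps_euler x.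
  apply: fpsP => m; rewrite coefs_constZ.
  by rewrite -[LHS]/(coefs (c%:S *: x) m *+ m) coefs_constZ scalerMnr.
congr coefs; rewrite /T (big_morph _ euD eu0) big_ord_recl euZ eX mulr0n scaler0 add0r.
rewrite mulr_sumr; apply: eq_bigr => k _; rewrite euZ eX lift0 -scalerAr.
rewrite -scaler_nat scalerA; congr (_ *: _).
rewrite -fps_const_nat -fps_constM; congr (_%:S).
by rewrite factS natrM invfM mulrAC mulVf ?mul1r ?pnatr_eq0.
Qed.

(** The Euler operator cancels the denominators of the logarithm and leaves the geometric series of
    [xi / (1 + xi)]. *)
Lemma fps_euler_ln1p : (1 + fps_xi K) * fps_euler ln1p_series = fps_xi K.
Proof.
have xiE (q : fps K) n : coefs (fps_xi K * q) n = if n is m.+1 then coefs q m else 0.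
  exact: (@coefs_xiZ K K^o q n).
have eE n : coefs (fps_euler ln1p_series) n = if n is _.+1 then (-1) ^+ n.+1 else 0.
  case: n => [|n]; first by rewrite /= mulr0n.
  rewrite -[LHS]/(((-1) ^+ n.+2 / n.+1%:R) *+ n.+1).
  by rewrite -mulr_natr mulfVK ?pnatr_eq0.
rewrite mulrDl mul1r; apply: fpsP => n; rewrite coefsD xiE eE.
case: n => [|[|n]]; rewrite ?eE ?addr0 //; first by rewrite expr2 mulrNN mulr1.
by rewrite exprS mulN1r addNr.
Qed.

(** The left side [g] satisfies [(1 + xi) xi g' = xi g], that is [(n + 1) g_(n+1) = (1 - n) g_n].
    With [g_0 = 1] this forces [g_1 = 1] and [g_n = 0] from [n = 2] on. *)
Lemma exp_ln1p_series : fps_exp (ln1p_series : fps K^o) = 1 + fps_xi K.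
Proof.
have xiE (q : fps K) n : coefs (fps_xi K * q) n = if n is m.+1 then coefs q m else 0.
  exact: (@coefs_xiZ K K^o q n).
have l0 : coefs (ln1p_series : fps K^o) 0 = 0 by rewrite /= invr0 mulr0.
set g := fps_exp _.
have : (1 + fps_xi K) * fps_euler (g : fps K) = fps_xi K * g.
  rewrite /g fps_euler_exp // -[in RHS]fps_euler_ln1p -[RHS]mulrA; congr (_ * _).
rewrite mulrDl mul1r => gE.
have rec n : coefs g n.+1 *+ n.+1 + coefs g n *+ n = coefs g n.
  by move: (congr1 (fun x => coefs x n.+1) gE); rewrite coefsD !xiE.
have g0 : coefs g 0 = 1 by exact: coefs0_exp.
have g1 : coefs g 1 = 1 by move: (rec 0%N); rewrite mulr1n mulr0n addr0 g0.
clearbody g; apply: fpsP => -[|[|n]]; rewrite coefsD ?g0 ?g1 /= ?addr0 ?add0r //.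
elim: n => [|n ih].
  move: (rec 1%N) => /eqP; rewrite -subr_eq0 mulr1n addrK => /eqP h.
  by apply/eqP; move/eqP: h; rewrite mulrn_eq0.
by move: (rec n.+2); rewrite ih mul0rn addr0 => /eqP; rewrite mulrn_eq0 => /eqP.
Qed.

Lemma fps_exp_ln1p A (x : fps A) : coefs x 0 = 0 -> fps_exp (fps_ln1p x) = 1 + x.
Proof.
move=> x0; rewrite fps_expE fps_ln1pE -fps_subst_subst //; last by rewrite /= invr0 mulr0.
rewrite -(fps_expE (A := K^o)) exp_ln1p_series fps_substD // fps_subst1 //.
by rewrite fps_subst_xi.
Qed.

Lemma fps_ln1p_derivation A (x : fps A) (d : fps A -> fps A) : coefs x 0 = 0 -> linear d ->
  (forall k, d (x ^+ k) = x ^+ k *+ k) -> (1 + x) * d (fps_ln1p x) = x.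
Proof.
move=> x0 dL dX; rewrite fps_ln1pE (fps_subst_euler _ x0 dL dX).
have -> : 1 + x = fps_subst x (1 + fps_xi K).
  by rewrite fps_substD // fps_subst1 // fps_subst_xi.
by rewrite -fps_substM // fps_euler_ln1p fps_subst_xi.
Qed.
End ExpLog.

(** * Tensor legs *)

Section Legs.
Variables (K : fieldType).
Implicit Types A B C : algType K.

Lemma flip_bilin A B : bilin (fun (x : fps A) (y : fps B) => y \ox x).
Proof. by split=> [y|x] c u v; rewrite ?tensPl ?tensPr. Qed.

Lemma fps_flip_tens A B (x : fps A) (y : fps B) : fps_flip (x \ox y) = y \ox x.
Proof. by rewrite /fps_flip fps_tlift_tens //; exact: flip_bilin. Qed.

Lemma fps_flip_mor A B : alg_mor (@fps_flip K A B).
Proof.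
apply: fps_tlift_mor => [||x x' y y']; first exact: flip_bilin.
- exact: tens11.
- by rewrite tensM.
Qed.

Lemma fps_flipK A B : cancel (@fps_flip K A B) (@fps_flip K B A).
Proof.
apply: fps_tens_ext => [c u v|//|x y]; last by rewrite !fps_flip_tens.
by rewrite !(am_lin (fps_flip_mor _ _)).
Qed.

Section Assoc.
Variables (A B C : algType K).

Lemma assoc_bilin1 (x : fps A) : bilin (fun (y : fps B) (z : fps C) => x \ox y \ox z).
Proof. by split=> [z|y] c u v; rewrite ?tensPr ?tensPl. Qed.

Lemma assoc_bilin : bilin (fun (x : fps A) =>
  fps_tlift (fun (y : fps B) (z : fps C) => x \ox y \ox z)).
Proof.
split=> [t|x]; last exact/fps_tlift_linear/assoc_bilin1.
move=> c u v; move: t; have L x := fps_tlift_linear (assoc_bilin1 x).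
apply: fps_tens_ext => [d t t'|d t t'|y z]; first exact: L.
  by rewrite !L !scalerDr !scalerA addrACA mulrC.
by rewrite !fps_tlift_tens ?tensPl //; exact: assoc_bilin1.
Qed.

Lemma fps_assoc_tens (x : fps A) (y : fps B) (z : fps C) :
  fps_assoc (x \ox (y \ox z)) = x \ox y \ox z.
Proof.
rewrite /fps_assoc fps_tlift_tens; last exact: assoc_bilin.
by rewrite fps_tlift_tens //; exact: assoc_bilin1.
Qed.

Lemma fps_assoc_mor : alg_mor (@fps_assoc K A B C).
Proof.
have L x := fps_tlift_linear (assoc_bilin1 x).
apply: fps_tlift_mor => [||x x' t u]; first exact: assoc_bilin.
  rewrite -[X in fps_tlift _ X]tens11 fps_tlift_tens; last exact: assoc_bilin1.
  by rewrite !tens11.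
move: t; apply: fps_tens_ext => [c t t'|c t t'|y z].
- by rewrite mulrDl -scalerAl L.
- by rewrite L mulrDl scalerAl.
move: u; apply: fps_tens_ext => [c t t'|c t t'|y' z'].
- by rewrite mulrDr -scalerAr L.
- by rewrite L mulrDr scalerAr.
by rewrite tensM !fps_tlift_tens ?tensM //; exact: assoc_bilin1.
Qed.
End Assoc.

Lemma fps_tens3_ext A B C (E : algType K) (f g : fps (tens (tens A B) C) -> fps E) :
  linear f -> linear g ->
  (forall x y z, f (x \ox y \ox z) = g (x \ox y \ox z)) -> f =1 g.
Proof.
move=> fL gL fg; apply: fps_tens_ext => // t z; move: t.
by apply: fps_tens_ext => [c t t'|c t t'|x y]; rewrite ?tensPl ?fL ?gL ?fg.
Qed.

Section ThreeLegs.
Variable A : algType K.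
Local Notation H := (fps A).
Local Notation HH := (fps (tens A A)).
Local Notation HHH := (fps (tens (tens A A) A)).
Implicit Types (x y z : H) (t : HH).

Lemma leg12_mor : alg_mor (@leg12 K A).
Proof.
apply: fps_tlift_mor => [||x x' y y']; rewrite ?tens11 ?tensM ?mulr1 //.
by split=> [y|x] c u v; rewrite ?tensPr ?tensPl.
Qed.
Lemma leg13_mor : alg_mor (@leg13 K A).
Proof.
apply: fps_tlift_mor => [||x x' y y']; rewrite ?tens11 ?tensM ?mulr1 //.
by split=> [y|x] c u v; rewrite ?tensPr ?tensPl.
Qed.
Lemma leg23_mor : alg_mor (@leg23 K A).
Proof.
apply: fps_tlift_mor => [||x x' y y']; rewrite ?tens11 ?tensM ?mulr1 //.
by split=> [y|x] c u v; rewrite ?tensPr ?tensPl.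
Qed.

Lemma leg12_tens x y : leg12 (x \ox y) = x \ox y \ox 1.
Proof.
by rewrite /leg12 fps_tlift_tens //; split=> [z|z] c u v; rewrite ?tensPr ?tensPl.
Qed.
Lemma leg13_tens x y : leg13 (x \ox y) = x \ox 1 \ox y.
Proof.
by rewrite /leg13 fps_tlift_tens //; split=> [z|z] c u v; rewrite ?tensPr ?tensPl.
Qed.
Lemma leg23_tens x y : leg23 (x \ox y) = 1 \ox x \ox y.
Proof.
by rewrite /leg23 fps_tlift_tens //; split=> [z|z] c u v; rewrite ?tensPr ?tensPl.
Qed.

Lemma leg12E t : leg12 t = t \ox 1.
Proof.
move: t; apply: fps_tens_ext => [||x y]; first exact: am_lin leg12_mor.
  by move=> c u v; rewrite tensPl.
exact: leg12_tens.
Qed.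
Lemma leg23E t : leg23 t = fps_assoc (1 \ox t).
Proof.
move: t; apply: fps_tens_ext => [||x y]; first exact: am_lin leg23_mor.
  by move=> c u v; rewrite tensPr (am_lin (fps_assoc_mor A A A)).
by rewrite leg23_tens fps_assoc_tens.
Qed.

Section Coproduct.
Variable D : H -> HH.
Hypothesis DL : linear D.

Lemma tens_idr_bilin : bilin (fun x y => D x \ox y).
Proof. by split=> [y|x] c u v; rewrite ?DL ?tensPr ?tensPl. Qed.
Lemma id_tens_bilin : bilin (fun x y => fps_assoc (x \ox D y)).
Proof.
have aL := am_lin (fps_assoc_mor A A A).
by split=> [y|x] c u v; [rewrite tensPl aL | rewrite DL tensPr aL].
Qed.
Lemma tens_idr_linear : linear (tens_idr D).
Proof. exact: fps_tlift_linear tens_idr_bilin. Qed.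
Lemma id_tens_linear : linear (id_tens D).
Proof. exact: fps_tlift_linear id_tens_bilin. Qed.
Lemma tens_idr_tens x y : tens_idr D (x \ox y) = D x \ox y.
Proof. by rewrite /tens_idr fps_tlift_tens //; exact: tens_idr_bilin. Qed.
Lemma id_tens_tens x y : id_tens D (x \ox y) = fps_assoc (x \ox D y).
Proof. by rewrite /id_tens fps_tlift_tens //; exact: id_tens_bilin. Qed.
End Coproduct.

Lemma tens_idr_mor (D : H -> HH) : alg_mor D -> alg_mor (tens_idr D).
Proof.
move=> DA; apply: fps_tlift_mor => [||x x' y y'].
- exact: tens_idr_bilin DA.1.
- by rewrite (am1 DA) tens11.
- by rewrite (amM DA) tensM.
Qed.
Lemma id_tens_mor (D : H -> HH) : alg_mor D -> alg_mor (id_tens D).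
Proof.
move=> DA; apply: fps_tlift_mor => [||x x' y y'].
- exact: id_tens_bilin DA.1.
- by rewrite (am1 DA) tens11 (am1 (fps_assoc_mor A A A)).
- by rewrite (amM DA) -tensM (amM (fps_assoc_mor A A A)).
Qed.

Section Counit.
Variable e : H -> fps K.
Hypotheses (eL : scalar e) (eM : monoid_morphism e).

Lemma counit_idr_bilin : bilin (fun x y => e x *: y).
Proof.
split=> [y|x] c u v; first by rewrite eL scalerDl scalerA.
by rewrite scalerDr !scalerA mulrC.
Qed.
Lemma id_counit_bilin : bilin (fun x y => e y *: x).
Proof.
split=> [y|x] c u v; last by rewrite eL scalerDl scalerA.
by rewrite scalerDr !scalerA mulrC.
Qed.
Lemma counit_idr_tens x y : counit_idr e (x \ox y) = e x *: y.
Proof. by rewrite /counit_idr fps_tlift_tens //; exact: counit_idr_bilin. Qed.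
Lemma id_counit_tens x y : id_counit e (x \ox y) = e y *: x.
Proof. by rewrite /id_counit fps_tlift_tens //; exact: id_counit_bilin. Qed.
Lemma counit_idr_mor : alg_mor (counit_idr e).
Proof.
apply: fps_tlift_mor => [||x x' y y']; first exact: counit_idr_bilin.
  by rewrite eM.1 scale1r.
by rewrite eM.2 -scalerAl -scalerAr scalerA.
Qed.
Lemma id_counit_mor : alg_mor (id_counit e).
Proof.
apply: fps_tlift_mor => [||x x' y y']; first exact: id_counit_bilin.
  by rewrite eM.1 scale1r.
by rewrite eM.2 -scalerAl -scalerAr scalerA.
Qed.
End Counit.

(* Meant for morphisms [f] and [g] into complementary legs. *)
Definition fps_perm (f : HH -> HHH) (g : H -> HHH) : HHH -> HHH :=
  fps_tlift (fun t z => f t * g z).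

Definition leg1 x : HHH := x \ox 1 \ox 1.
Definition leg2 x : HHH := 1 \ox x \ox 1.

Section Perm.
Variables (f : HH -> HHH) (g : H -> HHH).
Hypotheses (fA : alg_mor f) (gA : alg_mor g).
Hypothesis fg_comm : forall x y z, GRing.comm (f (x \ox y)) (g z).

Lemma fps_perm_mor : alg_mor (fps_perm f g).
Proof.
apply: tens_mor => // t z; rewrite /GRing.comm; move: t.
apply: fps_tens_ext => [c u v|c u v|x y]; last exact: fg_comm.
  by rewrite fA.1 mulrDl scalerAl.
by rewrite fA.1 mulrDr scalerAr.
Qed.

Lemma fps_perm_tens t z : fps_perm f g (t \ox z) = f t * g z.
Proof. by rewrite /fps_perm fps_tlift_tens //; exact: tens_mor_bilin. Qed.
End Perm.

Lemma leg1_mor : alg_mor leg1.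
Proof.
split; last by split=> [|x y]; rewrite /leg1 ?tens11 ?tensM ?mulr1.
by move=> c x y; rewrite /leg1 !tensPl.
Qed.
Lemma leg2_mor : alg_mor leg2.
Proof.
split; last by split=> [|x y]; rewrite /leg2 ?tens11 ?tensM ?mulr1.
by move=> c x y; rewrite /leg2 tensPr tensPl.
Qed.

Lemma leg13_leg2_comm t x : GRing.comm (leg13 t) (leg2 x).
Proof.
rewrite /GRing.comm; move: t; apply: fps_tens_ext => [c u v|c u v|y z].
- by rewrite (am_lin leg13_mor) mulrDl scalerAl.
- by rewrite (am_lin leg13_mor) mulrDr scalerAr.
by rewrite leg13_tens !tensM !mulr1 !mul1r.
Qed.

(** In these three names the digits list which input factor lands in each output slot. They
    transport the cocycle identity to other placements of the legs, as the formulas for the R-matrix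
    require. *)
Definition perm132 := fps_perm (@leg13 K A) leg2.
Definition perm231 := fps_perm (fun t => leg13 (fps_flip t)) leg2.
Definition perm312 := fps_perm (@leg23 K A) leg1.

Lemma perm132_mor : alg_mor perm132.
Proof.
apply: fps_perm_mor => [||x y z]; [exact: leg13_mor | exact: leg2_mor |].
by rewrite leg13_tens /GRing.comm !tensM !mulr1 !mul1r.
Qed.
Lemma perm231_mor : alg_mor perm231.
Proof.
apply: fps_perm_mor => [||x y z]; last 1 first.
- by rewrite fps_flip_tens leg13_tens /GRing.comm !tensM !mulr1 !mul1r.
- exact: (am_comp leg13_mor (fps_flip_mor A A)).
- exact: leg2_mor.
Qed.
Lemma perm312_mor : alg_mor perm312.
Proof.
apply: fps_perm_mor => [||x y z]; [exact: leg23_mor | exact: leg1_mor |].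
by rewrite leg23_tens /GRing.comm !tensM !mulr1 !mul1r.
Qed.

Lemma perm132_tens x y z : perm132 (x \ox y \ox z) = x \ox z \ox y.
Proof.
rewrite /perm132 fps_perm_tens ?leg13_tens /leg2 ?tensM ?mulr1 ?mul1r //.
- exact: leg13_mor.
- exact: leg2_mor.
Qed.
Lemma perm231_tens x y z : perm231 (x \ox y \ox z) = y \ox z \ox x.
Proof.
rewrite /perm231 fps_perm_tens ?fps_flip_tens ?leg13_tens /leg2 ?tensM ?mulr1 ?mul1r //.
- exact: (am_comp leg13_mor (fps_flip_mor A A)).
- exact: leg2_mor.
Qed.
Lemma perm312_tens x y z : perm312 (x \ox y \ox z) = z \ox x \ox y.
Proof.
rewrite /perm312 fps_perm_tens ?leg23_tens /leg1 ?tensM ?mulr1 ?mul1r //.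
- exact: leg23_mor.
- exact: leg1_mor.
Qed.

Lemma perm132_assoc x t : perm132 (fps_assoc (x \ox t)) = fps_assoc (x \ox fps_flip t).
Proof.
have aL := am_lin (fps_assoc_mor A A A).
move: t; apply: fps_tens_ext => [c u v|c u v|y z].
- by rewrite tensPr aL (am_lin perm132_mor).
- by rewrite (am_lin (fps_flip_mor A A)) tensPr aL.
by rewrite fps_flip_tens !fps_assoc_tens perm132_tens.
Qed.
Lemma perm231_assoc x t : perm231 (fps_assoc (x \ox t)) = t \ox x.
Proof.
have aL := am_lin (fps_assoc_mor A A A).
move: t; apply: fps_tens_ext => [c u v|c u v|y z].
- by rewrite tensPr aL (am_lin perm231_mor).
- by rewrite tensPl.
by rewrite fps_assoc_tens perm231_tens.
Qed.
Lemma perm231_perm132 t z : perm231 (t \ox z) = perm132 (fps_flip t \ox z).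
Proof.
move: t; apply: fps_tens_ext => [c u v|c u v|x y].
- by rewrite tensPl (am_lin perm231_mor).
- by rewrite (am_lin (fps_flip_mor A A)) tensPl (am_lin perm132_mor).
by rewrite fps_flip_tens perm132_tens perm231_tens.
Qed.
Lemma perm312E t z : perm312 (t \ox z) = fps_assoc (z \ox t).
Proof.
have aL := am_lin (fps_assoc_mor A A A).
move: t; apply: fps_tens_ext => [c u v|c u v|x y].
- by rewrite tensPl (am_lin perm312_mor).
- by rewrite tensPr aL.
by rewrite perm312_tens fps_assoc_tens.
Qed.
Lemma perm132_leg12 t : perm132 (leg12 t) = leg13 t.
Proof.
move: t; apply: (fps_tens_ext (am_lin (am_comp perm132_mor leg12_mor))
  (am_lin (leg13_mor))) => x y.
by rewrite /comp leg12_tens perm132_tens leg13_tens.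
Qed.
Lemma perm132_leg23 t : perm132 (leg23 t) = leg23 (fps_flip t).
Proof.
move: t; apply: (fps_tens_ext (am_lin (am_comp perm132_mor leg23_mor))
  (am_lin (am_comp leg23_mor (fps_flip_mor A A)))) => x y.
by rewrite /comp leg23_tens perm132_tens fps_flip_tens leg23_tens.
Qed.
Lemma perm231_leg12 t : perm231 (leg12 t) = leg13 (fps_flip t).
Proof.
move: t; apply: (fps_tens_ext (am_lin (am_comp perm231_mor leg12_mor))
  (am_lin (am_comp leg13_mor (fps_flip_mor A A)))) => x y.
by rewrite /comp leg12_tens perm231_tens fps_flip_tens leg13_tens.
Qed.
Lemma perm231_leg23 t : perm231 (leg23 t) = leg12 t.
Proof.
move: t; apply: (fps_tens_ext (am_lin (am_comp perm231_mor leg23_mor))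
  (am_lin (leg12_mor))) => x y.
by rewrite /comp leg23_tens perm231_tens leg12_tens.
Qed.
Lemma perm312_leg13 t : perm312 (leg13 t) = leg12 (fps_flip t).
Proof.
move: t; apply: (fps_tens_ext (am_lin (am_comp perm312_mor leg13_mor))
  (am_lin (am_comp leg12_mor (fps_flip_mor A A)))) => x y.
by rewrite /comp leg13_tens perm312_tens fps_flip_tens leg12_tens.
Qed.
Lemma perm312_leg23 t : perm312 (leg23 t) = leg13 (fps_flip t).
Proof.
move: t; apply: (fps_tens_ext (am_lin (am_comp perm312_mor leg23_mor))
  (am_lin (am_comp leg13_mor (fps_flip_mor A A)))) => x y.
by rewrite /comp leg23_tens perm312_tens fps_flip_tens leg13_tens.
Qed.

Section PermCoproduct.
Variable D : H -> HH.
Hypothesis DA : alg_mor D.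

Lemma perm231_id_tens t : perm231 (id_tens D t) = tens_idr D (fps_flip t).
Proof.
move: t; apply: (fps_tens_ext (am_lin (am_comp perm231_mor (id_tens_mor DA)))
  (am_lin (am_comp (tens_idr_mor DA) (fps_flip_mor A A)))) => x y.
by rewrite /comp (id_tens_tens DA.1) perm231_assoc fps_flip_tens (tens_idr_tens DA.1).
Qed.
Lemma perm312_tens_idr t : perm312 (tens_idr D t) = id_tens D (fps_flip t).
Proof.
move: t; apply: (fps_tens_ext (am_lin (am_comp perm312_mor (tens_idr_mor DA)))
  (am_lin (am_comp (id_tens_mor DA) (fps_flip_mor A A)))) => x y.
by rewrite /comp (tens_idr_tens DA.1) perm312E fps_flip_tens (id_tens_tens DA.1).
Qed.

Hypothesis D_cocomm : forall x, fps_flip (D x) = D x.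

Lemma perm132_id_tens t : perm132 (id_tens D t) = id_tens D t.
Proof.
move: t; apply: (fps_tens_ext (am_lin (am_comp perm132_mor (id_tens_mor DA)))
  (am_lin (id_tens_mor DA))) => x y.
by rewrite /comp (id_tens_tens DA.1) perm132_assoc D_cocomm.
Qed.
(** [perm231] is [perm132] preceded by the exchange of the first two factors, and a cocommutative
    coproduct does not see that exchange. *)
Lemma perm231_tens_idr t : perm231 (tens_idr D t) = perm132 (tens_idr D t).
Proof.
move: t; apply: (fps_tens_ext (am_lin (am_comp perm231_mor (tens_idr_mor DA)))
  (am_lin (am_comp perm132_mor (tens_idr_mor DA)))) => x y.
by rewrite /comp (tens_idr_tens DA.1) perm231_perm132 D_cocomm.
Qed.
End PermCoproduct.
End ThreeLegs.
End Legs.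

(** * Twists of cocommutative Hopf algebras *)

Section AntipodeContraction.
Variables (K : fieldType) (A : algType K) (S : fps A -> fps A).
Hypotheses (SL : linear S) (S1 : S 1 = 1) (SM : forall x y, S (x * y) = S y * S x).

(** The inserted [c] makes these contractions composable: contracting a product of tensors is
    contracting one factor with a [c] obtained from the other ([antipodelM], [antipoderM]). *)
Definition antipodel (c : fps A) : fps (tens A A) -> fps A :=
  fps_tlift (fun x y => S x * c * y).
Definition antipoder (c : fps A) : fps (tens A A) -> fps A :=
  fps_tlift (fun x y => x * c * S y).

Lemma antipodel_bilin c : bilin (fun x y => S x * c * y).
Proof.
split=> [y|x] d a b; first by rewrite SL !mulrDl -!scalerAl.
by rewrite mulrDr scalerAr.
Qed.
Lemma antipoder_bilin c : bilin (fun x y => x * c * S y).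
Proof.
split=> [y|x] d a b; first by rewrite !mulrDl -!scalerAl.
by rewrite SL mulrDr scalerAr.
Qed.
Lemma antipodel_linear c : linear (antipodel c).
Proof. exact: fps_tlift_linear (antipodel_bilin c). Qed.
Lemma antipoder_linear c : linear (antipoder c).
Proof. exact: fps_tlift_linear (antipoder_bilin c). Qed.
Lemma antipodel_tens c x y : antipodel c (x \ox y) = S x * c * y.
Proof. exact: fps_tlift_tens (antipodel_bilin c) x y. Qed.
Lemma antipoder_tens c x y : antipoder c (x \ox y) = x * c * S y.
Proof. exact: fps_tlift_tens (antipoder_bilin c) x y. Qed.

Lemma antipodelM c s t : antipodel c (s * t) = antipodel (antipodel c s) t.
Proof.
move: t; apply: fps_tens_ext => [k t t'|k t t'|x y].
- by rewrite mulrDr -scalerAr antipodel_linear.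
- by rewrite antipodel_linear.
rewrite antipodel_tens; move: s; apply: fps_tens_ext => [k t t'|k t t'|x' y'].
- by rewrite mulrDl -scalerAl antipodel_linear.
- by rewrite antipodel_linear mulrDr mulrDl -scalerAr -scalerAl.
by rewrite tensM !antipodel_tens SM !mulrA.
Qed.
Lemma antipoderM c s t : antipoder c (s * t) = antipoder (antipoder c t) s.
Proof.
move: s; apply: fps_tens_ext => [k t1 t'|k t1 t'|x y].
- by rewrite mulrDl -scalerAl antipoder_linear.
- by rewrite antipoder_linear.
rewrite antipoder_tens; move: t; apply: fps_tens_ext => [k t t'|k t t'|x' y'].
- by rewrite mulrDr -scalerAr antipoder_linear.
- by rewrite antipoder_linear mulrDr mulrDl -scalerAr -scalerAl.
by rewrite tensM !antipoder_tens SM !mulrA.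
Qed.
Lemma antipodel1 c : antipodel c 1 = c.
Proof. by rewrite -tens11 antipodel_tens S1 mul1r mulr1. Qed.
Lemma antipoder1 c : antipoder c 1 = c.
Proof. by rewrite -tens11 antipoder_tens S1 mul1r mulr1. Qed.
Lemma antipodelZ k c t : antipodel (k *: c) t = k *: antipodel c t.
Proof.
move: t; apply: fps_tens_ext => [d x y|d x y|x y]; first exact: antipodel_linear.
  by rewrite antipodel_linear scalerDr !scalerA mulrC.
by rewrite !antipodel_tens -scalerAr -scalerAl.
Qed.
Lemma antipoderZ k c t : antipoder (k *: c) t = k *: antipoder c t.
Proof.
move: t; apply: fps_tens_ext => [d x y|d x y|x y]; first exact: antipoder_linear.
  by rewrite antipoder_linear scalerDr !scalerA mulrC.
by rewrite !antipoder_tens -scalerAr -scalerAl.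
Qed.
End AntipodeContraction.

Section Conjugation.
Variables (K : fieldType).

Lemma conj_mor (B C : algType K) (f : fps B -> fps C) (u : fps C) :
  alg_mor f -> u \is a GRing.unit -> alg_mor (fun x => u * f x * u^-1).
Proof.
move=> fA uU; split; first by move=> c x y; rewrite fA.1 mulrDr mulrDl -scalerAr -scalerAl.
split=> [|x y]; first by rewrite (am1 fA) mulr1 mulrV.
by rewrite (amM fA) !mulrA -[_ * u^-1 * u]mulrA mulVr ?mulr1.
Qed.

Lemma am_conj (B C : algType K) (f : fps B -> fps C) (x y : fps B) : alg_mor f ->
  x \is a GRing.unit -> f (x * y * x^-1) = f x * f y * (f x)^-1.
Proof. by move=> fA xU; rewrite !(amM fA) (amV fA). Qed.

Lemma conj_conj (R : unitRingType) (x y z : R) :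
  x \is a GRing.unit -> y \is a GRing.unit ->
  x * (y * z * y^-1) * x^-1 = (x * y) * z * (x * y)^-1.
Proof. by move=> xU yU; rewrite invrM // !mulrA. Qed.
End Conjugation.

Section TwistedCoproduct.
Variables (K : fieldType) (A : algType K).
Local Notation H := (fps A).
Local Notation HH := (fps (tens A A)).
Variables (D : H -> HH) (F : HH).
Hypotheses (Dmor : alg_mor D) (FU : F \is a GRing.unit).
Local Notation DF := (twisted_coprod D F).

Lemma twisted_coprod_mor : alg_mor DF.
Proof. exact: conj_mor. Qed.

Lemma tens_idr_twisted t : tens_idr DF t = leg12 F * tens_idr D t * (leg12 F)^-1.
Proof.
have L := am_lin (conj_mor (tens_idr_mor Dmor) (am_unit (@leg12_mor K A) FU)).
move: t; apply: fps_tens_ext => [|//|x y].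
  exact: tens_idr_linear twisted_coprod_mor.1.
rewrite (tens_idr_tens twisted_coprod_mor.1) (tens_idr_tens Dmor.1).
by rewrite -(amV (@leg12_mor K A)) // !leg12E !tensM mulr1 mul1r.
Qed.

Lemma id_tens_twisted t : id_tens DF t = leg23 F * id_tens D t * (leg23 F)^-1.
Proof.
have L := am_lin (conj_mor (id_tens_mor Dmor) (am_unit (@leg23_mor K A) FU)).
move: t; apply: fps_tens_ext => [|//|x y].
  exact: id_tens_linear twisted_coprod_mor.1.
rewrite (id_tens_tens twisted_coprod_mor.1) (id_tens_tens Dmor.1).
by rewrite -(amV (@leg23_mor K A)) // !leg23E -!(amM (fps_assoc_mor A A A)) !tensM mulr1 mul1r.
Qed.

End TwistedCoproduct.

(** * Hopf structure and R-matrix of a twist *)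

Section TwistedHopf.
Variables (K : fieldType) (A : algType K).
Local Notation H := (fps A).
Local Notation HH := (fps (tens A A)).
Local Notation HHH := (fps (tens (tens A A) A)).
Variables (D : H -> HH) (e : H -> fps K) (S : H -> H) (F : HH).
Hypotheses (hopfD : hopf_algebra D e S) (twistF : twist D e F).
Hypotheses (S1 : S 1 = 1) (SM : forall x y, S (x * y) = S y * S x).
Hypothesis D_cocomm : forall x, fps_flip (D x) = D x.

Let Dmor : alg_mor D := conj (hopf_coprod_linear hopfD) (hopf_coprod_morphism hopfD).
Let SL : linear S := hopf_antipode_linear hopfD.
Let eL : scalar e := hopf_counit_linear hopfD.
Let eM : monoid_morphism e := hopf_counit_morphism hopfD.
Let FU : F \is a GRing.unit := twist_unit twistF.
Let assocmor := fps_assoc_mor A A A.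
Let flipmor := fps_flip_mor A A.
Let cmor := counit_idr_mor eL eM.
Let c'mor := id_counit_mor eL eM.

Local Notation DF := (twisted_coprod D F).
Local Notation v := (twist_elt S F).
Local Notation SF := (twisted_antipode S F).
Local Notation RF := (fps_flip F * F^-1).

Let twisted_coprod_mor := twisted_coprod_mor Dmor FU.
Let tens_idr_twisted := tens_idr_twisted Dmor FU.
Let id_tens_twisted := id_tens_twisted Dmor FU.

(** Both sides are conjugates of the same iterated coproduct of [a], one by the left and the other
    by the right side of the cocycle identity. *)
Lemma twisted_coassoc a : tens_idr DF (DF a) = id_tens DF (DF a).
Proof.
have m12 := @leg12_mor K A; have m23 := @leg23_mor K A.
have mD := tens_idr_mor Dmor; have mD' := id_tens_mor Dmor.
rewrite tens_idr_twisted id_tens_twisted /twisted_coprod (am_conj _ mD FU) (am_conj _ mD' FU).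
apply: (etrans (conj_conj _ (am_unit m12 FU) (am_unit mD FU))).
apply/esym/(etrans (conj_conj _ (am_unit m23 FU) (am_unit mD' FU))).
by rewrite (twist_cocycle twistF) (hopf_coassoc hopfD).
Qed.

Lemma twisted_counitl a : counit_idr e (DF a) = a.
Proof.
rewrite (am_conj _ cmor FU) (twist_counitl twistF) (hopf_counitl hopfD).
by rewrite mul1r divr1.
Qed.
Lemma twisted_counitr a : id_counit e (DF a) = a.
Proof.
rewrite (am_conj _ c'mor FU) (twist_counitr twistF) (hopf_counitr hopfD).
by rewrite mul1r divr1.
Qed.

Local Notation l := (antipodel S).
Local Notation r := (antipoder S).
Let l_linear := antipodel_linear SL.
Let r_linear := antipoder_linear SL.
Let l_tens := antipodel_tens SL.
Let r_tens := antipoder_tens SL.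
Let lM := antipodelM SL SM.
Let rM := antipoderM SL SM.
Let l1 := antipodel1 SL S1.
Let r1 := antipoder1 SL S1.
Let lZ := antipodelZ SL.
Let rZ := antipoderZ SL.

Lemma lD a : l 1 (D a) = e a *: 1.
Proof.
rewrite -(hopf_antipodel hopfD) /antipodel; congr (fps_tlift _ _).
by apply/funext => x; apply/funext => y; rewrite mulr1.
Qed.
Lemma rD a : r 1 (D a) = e a *: 1.
Proof.
rewrite -(hopf_antipoder hopfD) /antipoder; congr (fps_tlift _ _).
by apply/funext => x; apply/funext => y; rewrite mulr1.
Qed.
Lemma twist_eltE : v = r 1 F.
Proof.
rewrite /twist_elt /antipoder; congr (fps_tlift _ _).
by apply/funext => x; apply/funext => y; rewrite mulr1.
Qed.

Let Ml : HHH -> H := fps_tlift (fun t z => l 1 t * S z).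
Let Mr : HHH -> H := fps_tlift (fun t z => r 1 t * z).

Lemma Ml_bilin : bilin (fun t z => l 1 t * S z).
Proof.
split=> [y|x] d a b; first by rewrite l_linear mulrDl -scalerAl.
by rewrite SL mulrDr scalerAr.
Qed.
Lemma Mr_bilin : bilin (fun t z => r 1 t * z).
Proof.
split=> [y|x] d a b; first by rewrite r_linear mulrDl -scalerAl.
by rewrite mulrDr scalerAr.
Qed.
Lemma Ml_linear : linear Ml. Proof. exact: fps_tlift_linear Ml_bilin. Qed.
Lemma Mr_linear : linear Mr. Proof. exact: fps_tlift_linear Mr_bilin. Qed.
Lemma Ml_tens t z : Ml (t \ox z) = l 1 t * S z.
Proof. exact: fps_tlift_tens Ml_bilin t z. Qed.
Lemma Mr_tens t z : Mr (t \ox z) = r 1 t * z.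
Proof. exact: fps_tlift_tens Mr_bilin t z. Qed.

(** The middle factor is a product of the second leg of [s] and the first leg of [t], so
    [S(x) y S(z)] splits between them. *)
Lemma Ml_leg s t : Ml (leg12 s * leg23 t) = l 1 s * r 1 t.
Proof.
have m12 := am_lin (@leg12_mor K A); have m23 := am_lin (@leg23_mor K A).
move: t; apply: fps_tens_ext => [k t t'|k t t'|x y].
- by rewrite m23 mulrDr -scalerAr Ml_linear.
- by rewrite r_linear mulrDr -scalerAr.
move: s; apply: fps_tens_ext => [k t t'|k t t'|x' y'].
- by rewrite m12 mulrDl -scalerAl Ml_linear.
- by rewrite l_linear mulrDl -scalerAl.
rewrite leg12_tens leg23_tens !tensM mul1r mulr1 Ml_tens !l_tens r_tens !mulr1 !mulrA.
reflexivity.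
Qed.
Lemma Mr_leg s t : Mr (leg23 s * leg12 t) = r 1 t * l 1 s.
Proof.
have m12 := am_lin (@leg12_mor K A); have m23 := am_lin (@leg23_mor K A).
move: t; apply: fps_tens_ext => [k t t'|k t t'|x y].
- by rewrite m12 mulrDr -scalerAr Mr_linear.
- by rewrite r_linear mulrDl -scalerAl.
move: s; apply: fps_tens_ext => [k t t'|k t t'|x' y'].
- by rewrite m23 mulrDl -scalerAl Mr_linear.
- by rewrite l_linear mulrDr -scalerAr.
by rewrite leg12_tens leg23_tens !tensM mul1r mulr1 Mr_tens l_tens !r_tens SM !mulr1 !mulrA.
Qed.

(** By [antipodelM] the coproduct is contracted innermost, where [m (S (x) id) Delta] turns it into
    the counit; the last leg of [s] comes out to the right because [S] reverses products. *)
Lemma Ml_coprod s t : Ml (tens_idr D s * t) = Ml t * S (counit_idr e s).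
Proof.
have mD := tens_idr_linear Dmor.1.
move: s; apply: fps_tens_ext => [k s s'|k s s'|x y].
- by rewrite mD mulrDl -scalerAl Ml_linear.
- by rewrite (am_lin cmor) SL mulrDr -scalerAr.
rewrite (tens_idr_tens Dmor.1) (counit_idr_tens eL) (linZ SL).
move: t; apply: fps_tens_ext => [k t t'|k t t'|w z].
- by rewrite mulrDr -scalerAr Ml_linear.
- by rewrite Ml_linear mulrDl -scalerAl.
rewrite tensM !Ml_tens lM lD lZ SM -scalerAl -scalerAr !mulrA //.
Qed.
Lemma Mr_coprod s t : Mr (id_tens D s * t) = id_counit e s * Mr t.
Proof.
have mD := id_tens_linear Dmor.1.
move: s; apply: fps_tens_ext => [k s s'|k s s'|x y].
- by rewrite mD mulrDl -scalerAl Mr_linear.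
- by rewrite (am_lin c'mor) mulrDl -scalerAl.
rewrite (id_tens_tens Dmor.1) (id_counit_tens eL) -scalerAl scalerAr.
move: t; apply: fps_tens3_ext => [k t t'|k t t'|p q z].
- by rewrite mulrDr -scalerAr Mr_linear.
- by rewrite Mr_linear scalerDr mulrDr scalerA mulrC -scalerA -scalerAr.
have -> : Mr (fps_assoc (x \ox D y) * (p \ox q \ox z)) = x * (p * S q) * (l 1 (D y) * z).
  move: (D y); apply: fps_tens_ext => [k t t'|k t t'|w w'].
  - by rewrite tensPr (am_lin assocmor) mulrDl -scalerAl Mr_linear.
  - by rewrite l_linear mulrDl mulrDr -scalerAl -scalerAr.
  by rewrite fps_assoc_tens !tensM Mr_tens r_tens l_tens SM !mulr1 !mulrA.
by rewrite lD Mr_tens r_tens mulr1 -scalerAl mul1r -!scalerAr !mulrA.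
Qed.

(* Apply [x (x) y (x) z |-> x S(y) z] to
   [F_23^-1 F_12 = (id (x) Delta)(F) (Delta (x) id)(F^-1)], and
   [x (x) y (x) z |-> S(x) y S(z)] to the inverse identity. *)
Lemma twist_eltV : r 1 F * l 1 F^-1 = 1 /\ l 1 F^-1 * r 1 F = 1.
Proof.
have m12 := @leg12_mor K A; have m23 := @leg23_mor K A.
have mD := tens_idr_mor Dmor; have mD' := id_tens_mor Dmor.
have U1 := am_unit m12 FU; have U2 := am_unit m23 FU.
have U3 := am_unit mD FU; have U4 := am_unit mD' FU.
have coc := twist_cocycle twistF; split.
  rewrite -Mr_leg (amV m23) //.
  have -> : (leg23 F)^-1 * leg12 F = id_tens D F * tens_idr D F^-1.
    rewrite (amV mD) //; apply: (canRL (mulrK U3)); rewrite -mulrA coc.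
    by rewrite mulrA mulVr ?mul1r.
  rewrite Mr_coprod (twist_counitr twistF) mul1r.
  have -> t : Mr (tens_idr D t) = counit_idr e t.
    move: t; apply: fps_tens_ext => [k t t'|k t t'|x y].
    - by rewrite (am_lin mD) Mr_linear.
    - exact: (am_lin cmor).
    by rewrite (tens_idr_tens Dmor.1) Mr_tens rD (counit_idr_tens eL) -scalerAl mul1r.
  by rewrite (amV cmor) // (twist_counitl twistF) invr1.
rewrite -Ml_leg (amV m12) //.
have -> : (leg12 F)^-1 * leg23 F = tens_idr D F * id_tens D F^-1.
  rewrite (amV mD') //; apply: (canRL (mulrK U4)); rewrite -mulrA -coc.
  by rewrite mulrA mulVr ?mul1r.
rewrite Ml_coprod (twist_counitl twistF) S1 mulr1.
have -> t : Ml (id_tens D t) = S (id_counit e t).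
  move: t; apply: fps_tens_ext => [k t t'|k t t'|x y].
  - by rewrite (am_lin mD') Ml_linear.
  - by rewrite (am_lin c'mor) SL.
  rewrite (id_tens_tens Dmor.1) (id_counit_tens eL) (linZ SL).
  have -> s : Ml (fps_assoc (x \ox s)) = S x * r 1 s.
    move: s; apply: fps_tens_ext => [k t t'|k t t'|w w'].
    - by rewrite tensPr (am_lin assocmor) Ml_linear.
    - by rewrite r_linear mulrDr -scalerAr.
    by rewrite fps_assoc_tens Ml_tens r_tens l_tens !mulr1 mulrA.
  by rewrite rD -scalerAr mulr1.
by rewrite (amV c'mor) // (twist_counitr twistF) invr1 S1.
Qed.

Lemma twist_elt_unit : v \is a GRing.unit.
Proof.
by apply/unitrP; exists (l 1 F^-1); rewrite twist_eltE; have [-> ->] := twist_eltV.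
Qed.

Lemma twist_elt_inv : v^-1 = l 1 F^-1.
Proof.
apply: (mulrI twist_elt_unit); rewrite mulrV ?twist_elt_unit // twist_eltE.
by have [-> _] := twist_eltV.
Qed.

Lemma twisted_antipode_linear : linear SF.
Proof.
move=> c x y; rewrite /twisted_antipode SL mulrDr mulrDl.
by rewrite -scalerAr -scalerAl.
Qed.

(** The contraction is [v] times the one with [v^-1] inserted. As [v^-1] is itself the contraction
    of [F^-1], the outer [F] of [F Delta(a) F^-1] brings the inserted element back to 1, [Delta(a)]
    gives the counit, and the remaining [F^-1] gives [v^-1]. *)
Lemma twisted_antipodel a : fps_tlift (fun x y => SF x * y) (DF a) = e a *: 1.
Proof.
have SB : bilin (fun x y => SF x * y).
  split=> [y|x] c p q; first by rewrite twisted_antipode_linear mulrDl -scalerAl.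
  by rewrite mulrDr scalerAr.
have -> t : fps_tlift (fun x y => SF x * y) t = v * l v^-1 t.
  move: t; apply: fps_tens_ext => [|c p q|x y]; first exact: fps_tlift_linear SB.
    by rewrite l_linear mulrDr scalerAr.
  by rewrite fps_tlift_tens // l_tens !mulrA.
rewrite /twisted_coprod !lM {1}twist_elt_inv -(lM _ F^-1 F) mulVr //.
rewrite l1 lD lZ -twist_elt_inv -scalerAr.
by rewrite mulrV ?twist_elt_unit.
Qed.

Lemma twisted_antipoder a : fps_tlift (fun x y => x * SF y) (DF a) = e a *: 1.
Proof.
have SB : bilin (fun x y => x * SF y).
  split=> [y|x] c p q; last by rewrite twisted_antipode_linear mulrDr -scalerAr.
  by rewrite mulrDl scalerAl.
have -> t : fps_tlift (fun x y => x * SF y) t = r v t * v^-1.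
  move: t; apply: fps_tens_ext => [|c p q|x y]; first exact: fps_tlift_linear SB.
    by rewrite r_linear mulrDl scalerAl.
  by rewrite fps_tlift_tens // r_tens !mulrA.
rewrite /twisted_coprod !rM {1}twist_eltE -(rM _ F^-1 F) mulVr //.
rewrite r1 rD rZ -twist_eltE -scalerAl.
by rewrite mulrV ?twist_elt_unit.
Qed.

Theorem twisted_hopf_algebra : hopf_algebra DF e SF.
Proof.
split; [exact: twisted_coprod_mor.1 | exact: twisted_coprod_mor.2 | exact: eL | exact: eM
  | exact: twisted_antipode_linear | exact: twisted_coassoc | exact: twisted_counitl
  | exact: twisted_counitr | exact: twisted_antipodel | exact: twisted_antipoder].
Qed.

Theorem twisted_triangular : triangular DF RF.
Proof.
have m12 := @leg12_mor K A; have m23 := @leg23_mor K A; have m13 := @leg13_mor K A.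
have mD := tens_idr_mor Dmor; have mD' := id_tens_mor Dmor.
have F'U := am_unit flipmor FU.
have FVU : F^-1 \is a GRing.unit by rewrite unitrV.
have RU : RF \is a GRing.unit by rewrite unitrMl.
have flipR : fps_flip RF * RF = 1.
  rewrite (amM flipmor) (amV flipmor) // fps_flipK mulrA.
  by rewrite -[F * _ * _]mulrA mulVr // mulr1 mulrV.
have coc := twist_cocycle twistF.
have p132 := perm132_mor A; have p231 := perm231_mor A; have p312 := perm312_mor A.
(* The cocycle identity with its last two factors exchanged, and rotated. *)
have coc132 : leg13 F * perm132 (tens_idr D F) = leg23 (fps_flip F) * id_tens D F.
  move/(congr1 (@perm132 K A)): coc; rewrite (amM p132) perm132_leg12 => ->.
  by rewrite (amM p132) perm132_leg23 perm132_id_tens.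
have coc231 : leg13 (fps_flip F) * perm132 (tens_idr D F) =
    leg12 F * tens_idr D (fps_flip F).
  move/(congr1 (@perm231 K A)): coc; rewrite (amM p231) perm231_leg12.
  rewrite (perm231_tens_idr Dmor) // => ->.
  by rewrite (amM p231) perm231_leg23 perm231_id_tens.
have U12 := am_unit m12 FU; have U23 := am_unit m23 FU; have U13 := am_unit m13 FU.
have UD := am_unit mD FU; have UD' := am_unit mD' FU.
(* [coc231] rewrites the image of [F_21], the cocycle identity the image of [F^-1], and [coc132] the
   quotient left in the middle. *)
have coprodl : tens_idr DF RF = leg13 RF * leg23 RF.
  rewrite tens_idr_twisted (amM mD) (amV mD) // mulrA -coc231 -mulrA -invrM // coc.
  rewrite invrM // (amM m13) (amM m23) (amV m13) // (amV m23) // -!mulrA; congr (_ * _).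
  rewrite mulrA [RHS]mulrA; congr (_ * _); apply: (canLR (mulrK UD')).
  by rewrite -mulrA -coc132 mulKr.
split=> //.
- move=> a; rewrite [X in _ = fps_flip X]/twisted_coprod (am_conj _ flipmor FU) D_cocomm.
  rewrite invrM // invrK /twisted_coprod !mulrA mulrVK // -!mulrA; congr (_ * _).
  by rewrite [F^-1 * _]mulKr // mulKr.
(* Since [R_21 = R^-1], rotating the three factors turns the first coproduct formula into the
   inverse of the second. *)
have flipRV : fps_flip RF = RF^-1.
  by rewrite -[RHS]mul1r; apply: (canRL (mulrK RU)); exact: flipR.
have mDF := id_tens_mor twisted_coprod_mor.
have := congr1 (@perm312 K A) coprodl; rewrite (amM p312) perm312_leg13 perm312_leg23.
rewrite (perm312_tens_idr twisted_coprod_mor) flipRV (amV mDF) // (amV m12) // (amV m13) //.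
rewrite -(invrM (am_unit m13 RU) (am_unit m12 RU)); exact: invr_inj.
Qed.
End TwistedHopf.

(** * The Hopf algebra of an enveloping algebra *)

Section FpsMap.
Variables (K : fieldType) (A B : algType K) (f : A -> B).

Lemma fps_map_linear : linear f -> linear (fps_map f).
Proof.
move=> fL c x y; apply: fpsP => n; rewrite coefsD coefsZ.
rewrite -[LHS]/(f (coefs (c *: x + y) n)) coefsD coefsZ (linD fL) (lin_sum fL).
congr (_ + _); apply: eq_bigr => i _.
by rewrite (linZ fL).
Qed.

Lemma fps_map_const a : linear f -> fps_map f a%:S = (f a)%:S.
Proof. by move=> /lin0 f0; apply: fpsP => -[|n] /=. Qed.

Lemma fps_map_mor : linear f -> monoid_morphism f -> alg_mor (fps_map f).
Proof.
move=> fL [f1 fM]; have mL := fps_map_linear fL; split=> //.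
have mC a : fps_map f a%:S = (f a)%:S by exact: fps_map_const.
split=> [|x y]; first by rewrite [LHS]mC f1.
move: x; apply: fps_lin_ext => [c u v|c u v|a].
- by rewrite mulrDl -scalerAl mL.
- by rewrite mL mulrDl scalerAl.
move: y; apply: fps_lin_ext => [c u v|c u v|b].
- by rewrite mulrDr -scalerAr mL.
- by rewrite mL mulrDr scalerAr.
by rewrite -fps_constM !mC fM fps_constM.
Qed.

Lemma fps_map_anti : linear f -> (forall x y, f (x * y) = f y * f x) ->
  forall x y, fps_map f (x * y) = fps_map f y * fps_map f x.
Proof.
move=> fL fM x y; have mL := fps_map_linear fL.
have mC a : fps_map f a%:S = (f a)%:S by exact: fps_map_const.
move: x; apply: fps_lin_ext => [c u v|c u v|a].
- by rewrite mulrDl -scalerAl mL.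
- by rewrite mL mulrDr scalerAr.
move: y; apply: fps_lin_ext => [c u v|c u v|b].
- by rewrite mulrDr -scalerAr mL.
- by rewrite mL mulrDl scalerAl.
by rewrite -fps_constM !mC fM fps_constM.
Qed.
End FpsMap.

(** The cross terms cancel. With [x (x) 1 + 1 (x) x] in both places it shows that the primitive
    coproduct respects brackets. *)
Lemma commutatorD (R : nzRingType) (a b c d : R) : a * d = d * a -> b * c = c * b ->
  (a + b) * (c + d) - (c + d) * (a + b) = (a * c - c * a) + (b * d - d * b).
Proof.
move=> ad bc; rewrite !mulrDl !mulrDr ad bc.
rewrite [c * b + _]addrC addrACA [d * a + d * b]addrC [X in _ - X]addrACA.
by rewrite [c * b + d * a]addrC opprD [LHS]addrACA subrr addr0 opprD [LHS]addrACA.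
Qed.

Section UEAHopf.
Variables (K : fieldType) (L : lmodType K) (br : L -> L -> L).
Local Notation U := (uea br).
Local Notation gen x := ((uea_inj br x)%:S : fps U).
Local Notation D := (fps_map (@uea_coprod _ _ br)).
Local Notation e := (fps_map (@uea_counit _ _ br)).
Local Notation S := (fps_map (@uea_antipode _ _ br)).

(** Words rather than generators, because the contractions with the antipode to which it is applied
    are not multiplicative. *)
Lemma fps_uea_ext (C : algType K) (f g : fps U -> fps C) : linear f -> linear g ->
  (forall w, f (\prod_(x <- w) gen x) = g (\prod_(x <- w) gen x)) -> f =1 g.
Proof.
move=> fL gL fg; apply: fps_lin_ext => // u; rewrite (uea_sum_words u).
have -> : (\sum_(p <- repr u) p.1 *: \prod_(x <- p.2) uea_inj br x)%:S =
    \sum_(p <- repr u) (p.1)%:S *: \prod_(x <- p.2) gen x :> fps U.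
  rewrite (big_morph _ (@fps_constD U) (@fps_const0 U)); apply: eq_bigr => p _.
  by rewrite fps_constZ (big_morph _ (@fps_constM U) (erefl _ : 1%:S = 1)).
rewrite !lin_sum //; apply: eq_bigr => p _.
by rewrite !linZ // fg.
Qed.

Lemma fps_uea_mor_ext (C : algType K) (f g : fps U -> fps C) : alg_mor f -> alg_mor g ->
  (forall x, f (gen x) = g (gen x)) -> f =1 g.
Proof.
move=> fA gA fg; apply: fps_uea_ext => [||w]; [exact: fA.1 | exact: gA.1 |].
by rewrite (am_prod fA) (am_prod gA); apply: eq_bigr.
Qed.


Lemma uea_coprod_lie :
  lie_morphism br (fun x => tpure (uea_inj br x) 1 + tpure 1 (uea_inj br x)).
Proof.
have TB := tpure_bilinear U U; have [iL iM] := uea_inj_morphism br.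
split=> [c x y|x y].
  by rewrite iL (TB.1 1) (TB.2 1) scalerDr addrACA.
have subl a b : tpure (a - b) 1 = tpure a 1 - tpure b 1 :> tens U U.
  by rewrite addrC -scaleN1r (TB.1 1) scaleN1r addrC.
have subr a b : tpure 1 (a - b) = tpure 1 a - tpure 1 b :> tens U U.
  by rewrite addrC -scaleN1r (TB.2 1) scaleN1r addrC.
by rewrite iM commutatorD !tpureM ?mulr1 ?mul1r // subl subr.
Qed.

Lemma uea_counit_lie : lie_morphism br (fun _ => 0 : K^o).
Proof. by split=> [c x y|x y]; rewrite ?scaler0 ?mulr0 ?addr0 ?subr0. Qed.

Lemma uea_antipode_lie : lie_morphism br (fun x => - uea_inj br x : U^c).
Proof.
have [iL iM] := uea_inj_morphism br; split=> [c x y|x y].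
  by rewrite iL opprD scalerN.
rewrite iM opprB.
have E (a b : U) : (a : U^c) * (b : U^c) = b * a by [].
by rewrite !E !mulrNN.
Qed.

Lemma uea_coprod_mor : alg_mor D.
Proof.
by have [fL fM _] := uea_lift_morphism uea_coprod_lie; exact: fps_map_mor.
Qed.
Lemma uea_coprod_gen x : D (gen x) = gen x \ox 1 + 1 \ox gen x.
Proof.
have [fL fM fE] := uea_lift_morphism uea_coprod_lie.
by rewrite (fps_map_const _ fL) [X in X%:S]fE fps_constD -!tens_const.
Qed.

Lemma uea_counit_scalar : scalar e.
Proof.
have [fL _ _] := uea_lift_morphism uea_counit_lie.
exact: (@fps_map_linear _ _ K^o _ fL).
Qed.
Lemma uea_counit_mor : monoid_morphism e.
Proof.
have [fL fM _] := uea_lift_morphism uea_counit_lie.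
exact: (@fps_map_mor _ _ K^o _ fL fM).2.
Qed.
Lemma uea_counit_gen x : e (gen x) = 0.
Proof.
have [fL _ fE] := uea_lift_morphism uea_counit_lie.
by rewrite (@fps_map_const _ _ K^o _ _ fL) [X in X%:S]fE fps_const0.
Qed.

Lemma uea_antipode_linear : linear S.
Proof.
have [fL _ _] := uea_lift_morphism uea_antipode_lie.
exact: (@fps_map_linear _ _ U _ fL).
Qed.
Lemma uea_antipode1 : S 1 = 1.
Proof.
have [fL [f1 _] _] := uea_lift_morphism uea_antipode_lie.
by rewrite [LHS](@fps_map_const _ _ U _ _ fL) [X in X%:S]f1.
Qed.
Lemma uea_antipode_gen x : S (gen x) = - gen x.
Proof.
have [fL _ fE] := uea_lift_morphism uea_antipode_lie.
rewrite (@fps_map_const _ _ U _ _ fL) [X in X%:S]fE.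
by apply: fpsP => -[|n] /=; rewrite ?oppr0.
Qed.
Lemma uea_antipodeM x y : S (x * y) = S y * S x.
Proof.
have [fL [_ fM] _] := uea_lift_morphism uea_antipode_lie.
exact: (@fps_map_anti _ _ U _ fL fM).
Qed.

Lemma uea_cocomm t : fps_flip (D t) = D t.
Proof.
have DA := uea_coprod_mor.
move: t; apply: (fps_uea_mor_ext (am_comp (fps_flip_mor U U) DA) DA) => x.
rewrite /comp !uea_coprod_gen (linD (am_lin (fps_flip_mor U U))) !fps_flip_tens.
by rewrite addrC.
Qed.

Lemma uea_antipodel t : fps_tlift (fun x y => S x * y) (D t) = e t *: 1.
Proof.
have SL := uea_antipode_linear.
have -> : fps_tlift (fun x y => S x * y) (D t) = antipodel S 1 (D t).
  rewrite /antipodel; congr (fps_tlift _ _); apply/funext => x.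
  by apply/funext => y; rewrite mulr1.
have lL := antipodel_linear SL 1.
move: t; apply: fps_uea_ext => [c x y|c x y|].
- by rewrite uea_coprod_mor.1 lL.
- by rewrite uea_counit_scalar scalerDl scalerA.
(* The first letter is contracted innermost and gives 0 at once. *)
elim=> [|x w _].
  rewrite big_nil (am1 uea_coprod_mor) uea_counit_mor.1 scale1r.
  exact: antipodel1 SL uea_antipode1 1.
rewrite big_cons (amM uea_coprod_mor) uea_counit_mor.2 uea_counit_gen mul0r scale0r.
rewrite (antipodelM SL uea_antipodeM).
have -> : antipodel S 1 (D (gen x)) = 0.
  rewrite uea_coprod_gen (linD lL) !(antipodel_tens SL) uea_antipode_gen uea_antipode1.
  by rewrite !mulr1 mul1r addNr.
have -> : 0 = (0 : fps K) *: (1 : fps U) by rewrite scale0r.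
by rewrite (antipodelZ SL) !scale0r.
Qed.

Lemma uea_antipoder t : fps_tlift (fun x y => x * S y) (D t) = e t *: 1.
Proof.
have SL := uea_antipode_linear.
have -> : fps_tlift (fun x y => x * S y) (D t) = antipoder S 1 (D t).
  rewrite /antipoder; congr (fps_tlift _ _); apply/funext => x.
  by apply/funext => y; rewrite mulr1.
have rL := antipoder_linear SL 1.
move: t; apply: fps_uea_ext => [c x y|c x y|].
- by rewrite uea_coprod_mor.1 rL.
- by rewrite uea_counit_scalar scalerDl scalerA.
(* Here the tail of the word is contracted innermost: the induction hypothesis makes it a scalar,
   and the first letter then gives 0. *)
elim=> [|x w ih].
  rewrite big_nil (am1 uea_coprod_mor) uea_counit_mor.1 scale1r.
  exact: antipoder1 SL uea_antipode1 1.
rewrite big_cons (amM uea_coprod_mor) uea_counit_mor.2 uea_counit_gen mul0r scale0r.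
rewrite (antipoderM SL uea_antipodeM).
rewrite [X in antipoder S X _]ih (antipoderZ SL).
rewrite uea_coprod_gen (linD rL) !(antipoder_tens SL) uea_antipode_gen uea_antipode1.
by rewrite !mulr1 mul1r subrr scaler0.
Qed.

Theorem uea_hopf : hopf_algebra D e S.
Proof.
have DA := uea_coprod_mor; have eL := uea_counit_scalar; have eM := uea_counit_mor.
split; [exact: DA.1 | exact: DA.2 | exact: eL | exact: eM | exact: uea_antipode_linear
  | | | | exact: uea_antipodel | exact: uea_antipoder].
- apply: (fps_uea_mor_ext (am_comp (tens_idr_mor DA) DA) (am_comp (id_tens_mor DA) DA)) => x.
  rewrite /comp uea_coprod_gen (linD (tens_idr_linear DA.1)) (linD (id_tens_linear DA.1)).
  rewrite !(tens_idr_tens DA.1) !(id_tens_tens DA.1) (am1 DA) uea_coprod_gen.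
  rewrite tensDl tensDr (linD (am_lin (fps_assoc_mor U U U))) -tens11.
  by rewrite !fps_assoc_tens tens11 addrA.
- have idA : alg_mor (@id (fps U)) by [].
  apply: (fps_uea_mor_ext (am_comp (counit_idr_mor eL eM) DA) idA) => x.
  rewrite /comp uea_coprod_gen (linD (am_lin (counit_idr_mor eL eM))).
  by rewrite !(counit_idr_tens eL) uea_counit_gen eM.1 scale0r scale1r add0r.
- have idA : alg_mor (@id (fps U)) by [].
  apply: (fps_uea_mor_ext (am_comp (id_counit_mor eL eM) DA) idA) => x.
  rewrite /comp uea_coprod_gen (linD (am_lin (id_counit_mor eL eM))).
  by rewrite !(id_counit_tens eL) uea_counit_gen eM.1 scale0r scale1r addr0.
Qed.
End UEAHopf.

(** * The extended Jordanian twist *)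

Section ExpShift.
Variables (K : numFieldType) (A : algType K).

(** With [a = h (x) s], a first leg of weight [c] shifts the exponent by [b = 1 (x) c s]. Every
    power of [e^sigma] created by [J] arises in this way. *)
Lemma fps_exp_shift (a b p : fps A) : coefs a 0 = 0 -> coefs b 0 = 0 ->
  GRing.comm a b -> a * p = p * (a + b) -> fps_exp a * p = p * fps_exp b * fps_exp a.
Proof.
move=> a0 b0 ab ap; have ab0 : coefs (a + b) 0 = 0 by rewrite coefsD a0 b0 addr0.
by rewrite (fps_exp_intertwine a0 ab0 ap) addrC fps_expD // mulrA.
Qed.

Lemma comm_scale c (t x : fps A) : GRing.comm t x -> GRing.comm t (c *: x).
Proof. by rewrite /GRing.comm -scalerAr => ->; rewrite scalerAl. Qed.

Lemma fps_nat_unit n : n.+1%:R \is a @GRing.unit (fps K).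
Proof.
apply/unitrP; exists (n.+1%:R^-1 : K)%:S.
by rewrite -fps_const_nat -!fps_constM mulVf ?mulfV ?pnatr_eq0.
Qed.

Lemma fps_ln1p0 : fps_ln1p (0 : fps A) = 0.
Proof.
apply: (fps_exp_inj (coefs0_ln1p _)) => //; first by rewrite /GRing.comm mulr0 mul0r.
by rewrite fps_exp_ln1p // fps_exp0 addr0.
Qed.

Lemma coefs0_xiZ (c : fps K) (x : fps A) : coefs ((c * fps_xi K) *: x) 0 = 0.
Proof. by rewrite mulrC -scalerA coefs_xiZ. Qed.
End ExpShift.

Lemma subrDKl (V : zmodType) (p q : V) : p - (p + q) = - q.
Proof. by rewrite opprD addNKr. Qed.

Lemma subrDK4 (V : zmodType) (p q t w : V) : p + t - (p + q + (t - q + w)) = - w.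
Proof. by rewrite [p + q + _]addrA [p + q + _]addrACA subrr addr0 subrDKl. Qed.

Section ChainTwist.
Variables (K : numFieldType) (A : algType K).
Local Notation H := (fps A).
Local Notation HH := (fps (tens A A)).
Variables (h z : H).
Hypothesis hz : h * z = z * h + z *+ 2.

Local Notation xi := (fps_xi K).
(* The equations below are hypotheses rather than local definitions, so that
   conversion never unfolds the series. *)
Variables (u s : H) (E : fps K -> H).
Hypothesis uE : u = (2 * xi) *: z.
Hypothesis sE : s = 2^-1 *: fps_ln1p u.
Hypothesis EE : forall k, E k = fps_exp (k *: s).

Lemma coefs0_u : coefs u 0 = 0. Proof. by rewrite uE coefs0_xiZ. Qed.
Lemma coefs0_s : coefs s 0 = 0.
Proof. by rewrite sE coefs0Z coefs0_ln1p scaler0. Qed.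
Lemma coefs0_sZ k : coefs (k *: s) 0 = 0.
Proof. by rewrite coefs0Z coefs0_s scaler0. Qed.

Lemma comm_s t : GRing.comm t z -> GRing.comm t s.
Proof.
move=> tz; rewrite sE; apply/comm_scale/fps_ln1p_comm; first exact: coefs0_u.
by rewrite uE; exact: comm_scale.
Qed.
Lemma comm_E t k : GRing.comm t s -> GRing.comm t (E k).
Proof.
by move=> ts; rewrite EE; apply: fps_exp_comm; [exact: coefs0_sZ | exact: comm_scale].
Qed.

Lemma ED a b : E (a + b) = E a * E b.
Proof.
rewrite !EE scalerDl fps_expD ?coefs0_sZ //.
by apply: comm_scale; apply/commr_sym/comm_scale.
Qed.
Lemma E0 : E 0 = 1. Proof. by rewrite EE scale0r fps_exp0. Qed.
Lemma EN k : E k * E (- k) = 1. Proof. by rewrite -ED subrr E0. Qed.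
Lemma NE k : E (- k) * E k = 1. Proof. by rewrite -ED addNr E0. Qed.
Lemma E2 : E 2 = 1 + u.
Proof.
by rewrite EE sE scalerA mulrV ?scale1r ?(fps_exp_ln1p coefs0_u) // (fps_nat_unit K 1).
Qed.
Lemma EC a b : GRing.comm (E a) (E b).
Proof. by rewrite /GRing.comm -!ED addrC. Qed.

Lemma h_u : h * u = u * h + u *+ 2.
Proof. by rewrite uE -scalerAr hz scalerDr -scalerAl scalerMnr. Qed.

(** [u] has weight 2, so half of [ad h] is the Euler operator on powers of [u]. The differential
    equation of the logarithm becomes [(1 + u) [h, s] = u], and [1 + u = E 2]. *)
Lemma h_s : h * s = s * h + (1 - E (- 2)).
Proof.
have huX k : h * u ^+ k = u ^+ k * h + u ^+ k *+ (2 * k).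
  elim: k => [|k ih]; first by rewrite muln0 mulr0n addr0 mulr1 mul1r.
  rewrite exprS mulrA h_u mulrDl -mulrA ih mulrDr !mulrA -addrA; congr (_ + _).
  by rewrite mulrnAl mulrnAr -mulrnDr mulnS addnC.
pose d t := 2^-1 *: (h * t - t * h).
have dL : linear d.
  move=> c x y; rewrite /d mulrDr mulrDl opprD addrACA -scalerAr -scalerAl -scalerBr.
  by rewrite scalerDr !scalerA mulrC.
have dX k : d (u ^+ k) = u ^+ k *+ k.
  rewrite /d huX addrC addKr mulnC mulrnA -scaler_nat scalerA mulVr ?scale1r //.
  exact: (fps_nat_unit K 1).
have := fps_ln1p_derivation coefs0_u dL dX.
have -> : d (fps_ln1p u) = h * s - s * h by rewrite /d sE scalerBr scalerAr scalerAl.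
rewrite -E2 => E2d; apply/eqP; rewrite addrC -subr_eq; apply/eqP.
rewrite -[LHS]mul1r -[X in X * _](NE 2) -mulrA E2d.
have -> : u = E 2 - 1 by rewrite E2 addrC addKr.
by rewrite mulrBr mulr1 NE.
Qed.

Lemma h_W : h * E (- 2) = E (- 2) * h - E (- 2) *+ 2 + E (- 4) *+ 2.
Proof.
have hE : h * E 2 = E 2 * h + E 2 *+ 2 - 1 *+ 2.
  rewrite E2 mulrDr mulrDl mulr1 mul1r h_u mulrnDl.
  by move: (1 *+ 2) (u *+ 2) => a b; rewrite [a + b]addrC !addrA addrK.
have W2 : E (- 2) * E 2 = 1 by exact: NE.
have W2' : E 2 * E (- 2) = 1 by rewrite EN.
(* Multiplying the relation for [E 2] by its inverse on both sides gives the relation for that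
   inverse; the constant 2 becomes the term in [E (- 4)]. *)
move: (congr1 (fun t => E (- 2) * t * E (- 2)) hE).
rewrite mulrA -[in LHS]mulrA W2' mulr1 mulrBr mulrDr mulrBl mulrDl !mulrA W2 mul1r.
rewrite !mulrnAr !mulrnAl W2 mulr1 mul1r -ED.
have -> : - 2 + - 2 = - 4 :> fps K by ring.
move=> ->; move: (E (- 2) *+ 2) (E (- 4) *+ 2) => a b.
by rewrite addrAC subrK addrK.
Qed.

Lemma tens1l_mor : alg_mor (fun t : H => 1 \ox t : HH).
Proof.
split; first by move=> c t t'; rewrite tensPr.
by split=> [|t t']; rewrite ?tens11 ?tensM ?mulr1.
Qed.
Lemma tens1r_mor : alg_mor (fun t : H => t \ox 1 : HH).
Proof.
split; first by move=> c t t'; rewrite tensPl.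
by split=> [|t t']; rewrite ?tens11 ?tensM ?mulr1.
Qed.

(** * Conjugation by the Jordanian factor [J] *)

Variable J : HH.
Hypothesis JE : J = fps_exp (h \ox s).

Lemma coefs0_tensr (t t' : H) : coefs t' 0 = 0 -> coefs (t \ox t') 0 = 0.
Proof. by move=> t0; rewrite coefs0_tens t0 (bilinear0r (tpure_bilinear A A)). Qed.
Lemma coefs0_hs : coefs (h \ox s) 0 = 0. Proof. exact: coefs0_tensr coefs0_s. Qed.

Lemma J_tens c p q : h * p = p * h + c *: p -> GRing.comm q s ->
  J * (p \ox q) = (p \ox (q * E c)) * J.
Proof.
move=> hp qs; have b0 : coefs (1 \ox (c *: s) : HH) 0 = 0 by exact: coefs0_tensr (coefs0_sZ c).
rewrite JE (fps_exp_shift coefs0_hs b0).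
- have -> : fps_exp (1 \ox (c *: s) : HH) = 1 \ox E c.
    by rewrite EE -(am_exp (coefs0_sZ c) tens1l_mor).
  by rewrite tensM mulr1.
- by rewrite tensZr; apply: comm_scale; rewrite /GRing.comm !tensM mulr1 mul1r.
- by rewrite mulrDr !tensM hp mulr1 tensDl -qs -scalerAr tensZl tensZr.
Qed.

Lemma J_tens0 p q : h * p = p * h -> GRing.comm q s -> J * (p \ox q) = (p \ox q) * J.
Proof.
move=> hp qs; rewrite (J_tens (c := 0)) ?E0 ?mulr1 //.
by rewrite scale0r addr0.
Qed.

Lemma flip_J : fps_flip J = fps_exp (s \ox h).
Proof. rewrite JE (am_exp coefs0_hs (fps_flip_mor A A)) fps_flip_tens; reflexivity. Qed.

Local Notation W := (E (- 2)).

(** [[h (x) s, 1 (x) h] = h (x) (W - 1)] by [h_s], and this commutes with [h (x) s], so the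
    exponential acts to first order only. *)
Lemma J_h : J * (1 \ox h) = (1 \ox h + h \ox (W - 1)) * J.
Proof.
have Ws : GRing.comm s (W - 1).
  apply: commrB; last exact: commr1.
  exact: comm_E.
rewrite JE; apply: (fps_exp_commutator coefs0_hs); last by rewrite !tensM Ws.
rewrite !tensM mulr1 mul1r h_s -tensDr; congr (_ \ox _).
by rewrite -addrA [X in _ + X]addrA subrK subrr addr0.
Qed.

(** * Conjugation by the extension factor [Phi] *)

Variables (r : seq nat) (x y : nat -> H).
Hypotheses (r_uniq : uniq r).
Hypothesis hx : {in r, forall i, h * x i = x i * h + x i}.
Hypothesis hy : {in r, forall i, h * y i = y i * h + y i}.
Hypothesis xz : {in r, forall i, GRing.comm (x i) z}.
Hypothesis yz : {in r, forall i, GRing.comm (y i) z}.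
Hypothesis xx : {in r &, forall i j, GRing.comm (x i) (x j)}.
Hypothesis yy : {in r &, forall i j, GRing.comm (y i) (y j)}.
Hypothesis xy : {in r &, forall i j, x i * y j = y j * x i + (if i == j then z else 0)}.

Local Notation c2 := (2 * xi).
Local Notation a i := (x i \ox (y i * W)).
Variables (B Phi : HH).
Hypothesis BE : B = \sum_(i <- r) c2 *: a i.
Hypothesis PhiE : Phi = fps_exp B.

Lemma xE i k : i \in r -> GRing.comm (x i) (E k).
Proof. by move=> ir; apply/comm_E/comm_s/xz. Qed.
Lemma yE i k : i \in r -> GRing.comm (y i) (E k).
Proof. by move=> ir; apply/comm_E/comm_s/yz. Qed.
Lemma yWE i j k : i \in r -> j \in r -> GRing.comm (y i * W) (y j * E k).
Proof.
move=> ir jr; apply/commrM; apply/commr_sym/commrM.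
- exact/yy.
- exact/yE.
- exact/commr_sym/yE.
- exact: EC.
Qed.

Lemma yW_E i k : i \in r -> GRing.comm (E k) (y i * W).
Proof. by move=> ir; apply: commrM; [exact/commr_sym/yE | exact: EC]. Qed.

Lemma coefs0_a i : coefs (c2 *: a i) 0 = 0. Proof. exact: coefs0_xiZ. Qed.
Lemma coefs0_B : coefs B 0 = 0.
Proof. by rewrite BE coefs_sum big1 // => i _; exact: coefs0_a. Qed.

Lemma comm_a i j : i \in r -> j \in r -> GRing.comm (a i) (a j).
Proof. by move=> ir jr; rewrite /GRing.comm !tensM xx // yWE. Qed.

(** The exponents commute, so the product is a single exponential, and conjugation by it is one
    application of [fps_exp_commutator]. *)
Lemma Phi_prod : \prod_(i <- r) fps_exp (c2 *: a i) = Phi.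
Proof.
rewrite PhiE BE; apply: fps_exp_prod => [i _|i j ir jr]; first exact: coefs0_a.
exact/comm_scale/commr_sym/comm_scale/comm_a.
Qed.

Lemma B_commutator t (c : nat -> HH) : {in r, forall i, c2 *: (a i * t - t * a i) = c i} ->
  B * t = t * B + \sum_(i <- r) c i.
Proof.
move=> ac; rewrite BE mulr_suml mulr_sumr -big_split !big_seq; apply: eq_bigr => i /ac <-.
by rewrite -scalerAl -scalerAr scalerBr [RHS]addrC subrK.
Qed.

Lemma B_comm t : {in r, forall i, GRing.comm t (a i)} -> GRing.comm t B.
Proof. by move=> ta; rewrite BE big_seq; apply: commr_sum => i /ta /comm_scale. Qed.

Lemma Phi_comm t : {in r, forall i, GRing.comm t (a i)} -> Phi * t = t * Phi.
Proof. rewrite PhiE => /B_comm ta; exact/esym/(fps_exp_comm coefs0_B). Qed.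

Lemma Phi_commutator t (c : nat -> HH) :
  {in r, forall i, c2 *: (a i * t - t * a i) = c i} ->
  {in r &, forall i j, GRing.comm (c j) (a i)} ->
  Phi * t = (t + \sum_(i <- r) c i) * Phi.
Proof.
move=> ac cc; rewrite PhiE; apply: (fps_exp_commutator coefs0_B); first exact: B_commutator.
apply/esym; rewrite big_seq mulr_suml mulr_sumr; apply: eq_bigr => j jr.
by apply: B_comm => i ir; exact: cc.
Qed.

Lemma sum_delta (V : nmodType) i (f : V) : i \in r ->
  \sum_(j <- r) (if j == i then f else 0) = f.
Proof.
move=> ir; rewrite (bigD1_seq i) //= eqxx big1 ?addr0 // => j /negbTE -> //.
Qed.

Lemma uW : u * W = 1 - W.
Proof.
have -> : u = E 2 - 1 by rewrite E2 addrC addKr.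
by rewrite mulrBl EN mul1r.
Qed.

(** Only the summand with index [i] fails to commute with [1 (x) x i]; the second leg of that
    commutator is [- u W = W - 1]. *)
Lemma Phi_x i : i \in r ->
  Phi * (1 \ox x i) = (1 \ox x i + x i \ox (W - 1)) * Phi.
Proof.
move=> ir.
rewrite (Phi_commutator (c := fun j => if j == i then x i \ox (W - 1) else 0)).
- by rewrite sum_delta.
- move=> j jr; rewrite !tensM mulr1 mul1r -tensNr -tensDr.
  have -> : y j * W * x i - x i * (y j * W) = (if j == i then - (z * W) else 0).
    rewrite -mulrA -(xE _ ir) !mulrA xy // mulrDl subrDKl eq_sym.
    by case: eqP => // _; rewrite mul0r oppr0.
  case: eqP => [->|_]; last by rewrite tens0r scaler0.
  by rewrite -tensZr scalerN scalerAl -uE uW opprB.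
- move=> k j kr jr; case: eqP => _; last by rewrite /GRing.comm mul0r mulr0.
  rewrite /GRing.comm !tensM xx //; congr (_ \ox _).
  rewrite mulrBl mulrBr mulr1 mul1r; congr (_ - _).
  by rewrite mulrA -yE // -mulrA.
Qed.

Lemma u_comm t : GRing.comm t z -> GRing.comm t u.
Proof. by rewrite uE; exact: comm_scale. Qed.

Lemma Phi_y i : i \in r ->
  Phi * (y i \ox 1) = (y i \ox 1 + u \ox (y i * W)) * Phi.
Proof.
move=> ir.
rewrite (Phi_commutator (c := fun j => if j == i then u \ox (y i * W) else 0)).
- by rewrite sum_delta.
- move=> j jr; rewrite !tensM mulr1 mul1r -tensNl -tensDl.
  have -> : x j * y i - y i * x j = if j == i then z else 0.
    by rewrite xy // addrAC subrr add0r.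
  case: eqP => [->|_]; last by rewrite tens0l scaler0.
  by rewrite -tensZl -uE.
- move=> k j kr jr; case: eqP => _; last by rewrite /GRing.comm mul0r mulr0.
  by rewrite /GRing.comm !tensM yWE // (u_comm (xz kr)).
Qed.

Lemma h_yW j : j \in r -> h * (y j * W) = y j * W * h - y j * W + y j * E (- 4) *+ 2.
Proof.
move=> jr; rewrite mulrA hy // mulrDl -[y j * h * W]mulrA h_W mulrDr mulrBr !mulrnAr mulrA.
move: (y j * E (- 4) *+ 2) (y j * W) => p q; move: (q * h) => t.
by rewrite addrAC mulr2n opprD [t + (_ - _)]addrA subrK.
Qed.

(** In [x j (x) y j W] the weight 1 of [x j] cancels the term [- y j W] of [h_yW]. What survives is
    the correction in [E (- 4)] due to [[h, W]], whose factor 2 turns [c2] into [2 * c2]. *)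
Lemma Phi_h : Phi * (h \ox 1 + 1 \ox h) =
  (h \ox 1 + 1 \ox h + \sum_(j <- r) - (2 * c2) *: (x j \ox (y j * E (- 4)))) * Phi.
Proof.
rewrite (Phi_commutator (c := fun j => - (2 * c2) *: (x j \ox (y j * E (- 4))))) //.
  move=> j jr; rewrite [(h \ox 1 + _) * _]mulrDl mulrDr !tensM !mulr1 !mul1r h_yW // hx //.
  rewrite tensDl [x j \ox (_ - _ + _)]tensDr [x j \ox (_ - _)]tensDr tensNr subrDK4.
  have -> : x j \ox (y j * E (- 4) *+ 2) = 2 *: (x j \ox (y j * E (- 4))).
    by rewrite scaler_nat [in LHS]mulr2n tensDr -mulr2n.
  by rewrite scalerN scalerA scaleNr [c2 * 2]mulrC.
move=> k j kr jr; apply/commr_sym/comm_scale.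
by rewrite /GRing.comm !tensM xx // yWE.
Qed.

(** * The twisted coproducts *)

Variables (D : H -> HH) (F : HH).
Hypothesis FprodE : F = J * \prod_(i <- r) fps_exp (c2 *: a i).
Hypothesis Dmor : alg_mor D.
Hypothesis Dz : D z = z \ox 1 + 1 \ox z.
Hypothesis Dh : D h = h \ox 1 + 1 \ox h.
Hypothesis Dx : {in r, forall i, D (x i) = x i \ox 1 + 1 \ox x i}.
Hypothesis Dy : {in r, forall i, D (y i) = y i \ox 1 + 1 \ox y i}.
Local Notation DF := (twisted_coprod D F).

Lemma FE : F = J * Phi. Proof. by rewrite FprodE Phi_prod. Qed.

Lemma J_unit : J \is a GRing.unit.
Proof. by rewrite JE; exact: fps_exp_unit coefs0_hs. Qed.
Lemma Phi_unit : Phi \is a GRing.unit.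
Proof. by rewrite PhiE; exact: fps_exp_unit coefs0_B. Qed.
Lemma F_unit : F \is a GRing.unit.
Proof. by rewrite FE unitrMl ?Phi_unit // J_unit. Qed.

Lemma twisted_coprodP t T1 T2 : Phi * D t = T1 * Phi -> J * T1 = T2 * J -> DF t = T2.
Proof.
move=> E1 E2'; rewrite /twisted_coprod.
have -> : F * D t = T2 * F by rewrite FE -mulrA E1 mulrA E2' mulrA.
by rewrite mulrK // F_unit.
Qed.

Lemma s_E k : GRing.comm (E k) s. Proof. exact/commr_sym/comm_E. Qed.
Lemma z_s : GRing.comm z s. Proof. exact: comm_s. Qed.
Lemma h_1 : h * 1 = 1 * h. Proof. by rewrite mulr1 mul1r. Qed.

Lemma twisted_coprod_x i : i \in r -> DF (x i) = x i \ox E (- 1) + 1 \ox x i.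
Proof.
move=> ir; apply: (twisted_coprodP (T1 := x i \ox W + 1 \ox x i)).
  rewrite Dx // mulrDr Phi_x // Phi_comm => [|j jr]; last first.
    by rewrite /GRing.comm !tensM xx // mulr1 mul1r.
  rewrite -mulrDl tensDr tensNr; congr (_ * _).
  move: (x i \ox 1) (1 \ox x i) (x i \ox W) => p q t.
  by rewrite addrCA [p + _]addrC subrK addrC.
rewrite mulrDr (J_tens (c := 1)) ?scale1r ?hx //; last exact: s_E.
rewrite -ED J_tens0; [|exact: h_1 | exact/comm_s/xz].
rewrite -mulrDl; have -> // : - 2 + 1 = - 1 :> fps K by ring.
Qed.

Lemma twisted_coprod_y i : i \in r -> DF (y i) = y i \ox E 1 + E 2 \ox y i.
Proof.
move=> ir; have ys : GRing.comm (y i) s by exact/comm_s/yz.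
apply: (twisted_coprodP (T1 := y i \ox 1 + u \ox (y i * W) + 1 \ox y i)).
  rewrite Dy // mulrDr Phi_y // [Phi * (1 \ox _)]Phi_comm ?mulrDl // => j jr.
  by rewrite /GRing.comm !tensM mulr1 mul1r mulrA yy // -!mulrA -yE.
rewrite !mulrDr (J_tens (c := 1)) ?scale1r ?hy //; last exact/commr_sym/commr1.
(* [u] has weight 2, so [J] contributes [E 2] and cancels the [W] next to [y i]. *)
rewrite mul1r (J_tens (c := 2)); first last.
- by apply/commr_sym/commrM; [exact/commr_sym | exact/comm_E].
- by rewrite h_u scaler_nat.
rewrite -mulrA NE mulr1 J_tens0 //; last exact: h_1.
by rewrite -!mulrDl E2 tensDl [1 \ox _ + _]addrC addrA.
Qed.

Lemma twisted_coprod_z : DF z = z \ox E 2 + 1 \ox z.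
Proof.
apply: (twisted_coprodP (T1 := z \ox 1 + 1 \ox z)).
  rewrite Dz Phi_comm // => j jr; rewrite /GRing.comm mulrDl mulrDr !tensM !mulr1 !mul1r xz //.
  congr (_ + _ \ox _); apply: commrM; [exact/commr_sym/yz | exact/comm_E/comm_s].
rewrite mulrDr (J_tens (c := 2)) ?scaler_nat //; last exact/commr_sym/commr1.
by rewrite mul1r J_tens0 ?mulrDl //; [exact: h_1 | exact: z_s].
Qed.

Lemma twisted_coprod_h : DF h =
  h \ox W + 1 \ox h - (2 * c2) *: \sum_(j <- r) x j \ox (y j * E (- 3)).
Proof.
apply: (twisted_coprodP (T1 := h \ox 1 + 1 \ox h
    + \sum_(j <- r) - (2 * c2) *: (x j \ox (y j * E (- 4))))).
  by rewrite Dh Phi_h.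
rewrite !mulrDr J_h J_tens0 //; last exact/commr_sym/commr1.
rewrite -mulrDl tensDr tensNr.
have -> : h \ox 1 + (1 \ox h + (h \ox W - h \ox 1)) = h \ox W + 1 \ox h.
  by move: (h \ox 1) (1 \ox h) (h \ox W) => p q t; rewrite addrCA [p + _]addrC subrK addrC.
rewrite [(_ - _) * J]mulrDl; congr (_ + _).
rewrite mulr_sumr -scaleNr scaler_sumr mulr_suml !big_seq; apply: eq_bigr => j jr.
rewrite -scalerAr -scalerAl; congr (_ *: _).
(* [x j] has weight 1, which turns [E (- 4)] into [E (- 3)]. *)
rewrite (J_tens (c := 1)) ?scale1r ?hx //; last first.
  by apply/commr_sym/commrM; [exact/commr_sym/comm_s/yz | exact/comm_E].
rewrite -mulrA -ED; have -> // : - 4 + 1 = - 3 :> fps K by ring.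
Qed.

Lemma am_s (C : algType K) (f : H -> fps C) : alg_mor f -> f s = 2^-1 *: fps_ln1p (f u).
Proof. by move=> fA; rewrite sE (linZ fA.1) (am_ln1p coefs0_u fA). Qed.

Lemma am_E (C : algType K) (f : H -> fps C) k : alg_mor f -> f (E k) = fps_exp (k *: f s).
Proof. by move=> fA; rewrite EE (am_exp (coefs0_sZ k) fA) (linZ fA.1). Qed.

Lemma DFmor : alg_mor DF.
Proof. exact: twisted_coprod_mor Dmor F_unit. Qed.

Lemma scaler2_inj (C : algType K) (t t' : fps C) : (2 : fps K) *: t = 2 *: t' -> t = t'.
Proof.
move/(congr1 (fun t => 2^-1 *: t)); rewrite !scalerA mulVr ?scale1r //.
exact: (fps_nat_unit K 1).
Qed.

Lemma exp_s_primitive k : fps_exp (k *: (s \ox 1 + 1 \ox s : HH)) = E k \ox E k.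
Proof.
rewrite scalerDr -tensZl -tensZr fps_expD.
- rewrite -(am_exp (coefs0_sZ k) tens1l_mor) -(am_exp (coefs0_sZ k) tens1r_mor) -EE.
  by rewrite tensM mulr1 mul1r.
- exact: (coefs0_lin tens1r_mor.1 (coefs0_sZ k)).
- exact: (coefs0_lin tens1l_mor.1 (coefs0_sZ k)).
by rewrite /GRing.comm !tensM !mulr1 !mul1r.
Qed.

Lemma twisted_coprod_u : DF u = u \ox E 2 + 1 \ox u.
Proof. by rewrite [in LHS]uE (linZ DFmor.1) twisted_coprod_z scalerDr -tensZl -tensZr -uE. Qed.

(** From the coproduct of [u], the element [1 + u = E 2] is group-like. Hence [2 s] and twice the
    primitive sum have equal exponentials after [DF], and [fps_exp_inj] applies because both
    arguments commute. *)
Lemma twisted_coprod_s : DF s = s \ox 1 + 1 \ox s.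
Proof.
have p0 : coefs (s \ox 1 + 1 \ox s : HH) 0 = 0.
  rewrite coefsD (coefs0_lin tens1r_mor.1 coefs0_s) (coefs0_lin tens1l_mor.1 coefs0_s).
  by rewrite addr0.
have c0 (t : HH) : coefs t 0 = 0 -> coefs ((2 : fps K) *: t) 0 = 0.
  by move=> t0; rewrite coefs0Z t0 scaler0.
apply: scaler2_inj; apply: fps_exp_inj.
- exact/c0/(coefs0_lin DFmor.1)/coefs0_s.
- exact: c0.
- apply/comm_scale/commr_sym/comm_scale; rewrite (am_s DFmor); apply/comm_scale/fps_ln1p_comm.
    exact/(coefs0_lin DFmor.1)/coefs0_u.
  have us : GRing.comm s u by exact/u_comm/commr_sym/z_s.
  rewrite twisted_coprod_u; apply: commrD; apply/commr_sym/commrD;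
    by rewrite /GRing.comm !tensM ?mulr1 ?mul1r ?us ?(s_E 2).
rewrite -(am_E 2 DFmor) exp_s_primitive E2 (linD DFmor.1) (am1 DFmor) twisted_coprod_u E2.
by rewrite tensDl -tens11 [1 \ox (1 + u)]tensDr -addrA; congr (_ + _); exact: addrC.
Qed.

Lemma twisted_coprod_E k : DF (E k) = E k \ox E k.
Proof. by rewrite (am_E k DFmor) twisted_coprod_s exp_s_primitive. Qed.

(** The factor [W] cancels the [E 2] in front of [y i] and leaves a skew-primitive element, so the
    image of each exponent of [Phi] under the coproduct of its second leg is a sum of two terms. *)
Lemma twisted_coprod_yW i : i \in r ->
  DF (y i * W) = (y i * W) \ox E (- 1) + 1 \ox (y i * W).
Proof.
move=> ir; rewrite (amM DFmor) twisted_coprod_y // twisted_coprod_E mulrDl !tensM EN -ED.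
by have -> : 1 + - 2 = - 1 :> fps K by ring.
Qed.

Lemma comm_sum2 (C : algType K) (f g : nat -> fps C) :
  {in r &, forall i j, GRing.comm (f i) (g j)} ->
  GRing.comm (\sum_(i <- r) f i) (\sum_(j <- r) g j).
Proof.
move=> fg; rewrite big_seq [X in GRing.comm _ X]big_seq.
apply: commr_sum => j jr; apply/commr_sym/commr_sum => i ir; exact/commr_sym/fg.
Qed.

(** * The cocycle identity *)

Local Notation HHH := (fps (tens (tens A A) A)).

Lemma lin_B (C : algType K) (f : HH -> fps C) : linear f ->
  f B = \sum_(j <- r) c2 *: f (a j).
Proof. by move=> fL; rewrite BE (lin_sum fL); apply: eq_bigr => j _; rewrite (linZ fL). Qed.

Lemma comm_scale2 (C : algType K) c (t t' : fps C) :
  GRing.comm t t' -> GRing.comm (c *: t) (c *: t').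
Proof. by move=> tt; apply/comm_scale/commr_sym/comm_scale/commr_sym. Qed.

Lemma tens_idr_J : tens_idr D J = leg13 J * leg23 J.
Proof.
have m13 := @leg13_mor K A; have m23 := @leg23_mor K A.
rewrite JE (am_exp coefs0_hs (tens_idr_mor Dmor)).
rewrite (am_exp coefs0_hs m13) (am_exp coefs0_hs m23).
rewrite -fps_expD; first last.
- by rewrite leg13_tens leg23_tens /GRing.comm !tensM !mulr1 !mul1r.
- exact: coefs0_lin m23.1 coefs0_hs.
- exact: coefs0_lin m13.1 coefs0_hs.
by rewrite (tens_idr_tens Dmor.1) Dh tensDl leg13_tens leg23_tens.
Qed.

Lemma tens_idr_Phi : tens_idr D Phi = leg13 Phi * leg23 Phi.
Proof.
have m13 := @leg13_mor K A; have m23 := @leg23_mor K A.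
rewrite PhiE (am_exp coefs0_B (tens_idr_mor Dmor)) (am_exp coefs0_B m13) (am_exp coefs0_B m23).
rewrite -fps_expD; first last.
- rewrite (lin_B m13.1) (lin_B m23.1); apply: comm_sum2 => i j ir jr; apply: comm_scale2.
  by rewrite leg13_tens leg23_tens /GRing.comm !tensM !mulr1 !mul1r yWE.
- exact: coefs0_lin m23.1 coefs0_B.
- exact: coefs0_lin m13.1 coefs0_B.
congr fps_exp; rewrite (lin_B (tens_idr_mor Dmor).1) (lin_B m13.1) (lin_B m23.1) -big_split.
rewrite !big_seq; apply: eq_bigr => j jr; rewrite (tens_idr_tens Dmor.1) Dx // tensDl scalerDr.
by rewrite leg13_tens leg23_tens.
Qed.

Lemma id_tens_J : id_tens DF J = leg12 J * leg13 J.
Proof.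
have m13 := @leg13_mor K A; have m12 := @leg12_mor K A.
rewrite JE (am_exp coefs0_hs (id_tens_mor DFmor)).
rewrite (am_exp coefs0_hs m13) (am_exp coefs0_hs m12).
rewrite -fps_expD; first last.
- by rewrite leg13_tens leg12_tens /GRing.comm !tensM !mulr1 !mul1r.
- exact: coefs0_lin m13.1 coefs0_hs.
- exact: coefs0_lin m12.1 coefs0_hs.
rewrite (id_tens_tens DFmor.1) twisted_coprod_s tensDr (linD (fps_assoc_mor A A A).1).
by rewrite !fps_assoc_tens leg13_tens leg12_tens.
Qed.

Let Psi : HHH := fps_exp (\sum_(j <- r) c2 *: (x j \ox (y j * W) \ox E (- 1))).

Lemma coefs0_Psi :
  coefs (\sum_(j <- r) c2 *: (x j \ox (y j * W) \ox E (- 1)) : HHH) 0 = 0.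
Proof. by rewrite coefs_sum big1 // => i _; exact: coefs0_xiZ. Qed.

Lemma id_tens_Phi : id_tens DF Phi = Psi * leg13 Phi.
Proof.
have m13 := @leg13_mor K A; have mD := id_tens_mor DFmor.
rewrite PhiE (am_exp coefs0_B mD) (am_exp coefs0_B m13) /Psi.
rewrite -fps_expD; first last.
- rewrite (lin_B m13.1); apply: comm_sum2 => i j ir jr; apply: comm_scale2.
  by rewrite leg13_tens /GRing.comm !tensM !mulr1 !mul1r xx // yW_E.
- exact: coefs0_lin m13.1 coefs0_B.
- exact: coefs0_Psi.
congr fps_exp; rewrite (lin_B mD.1) (lin_B m13.1) -big_split.
rewrite !big_seq; apply: eq_bigr => j jr; rewrite (id_tens_tens DFmor.1) twisted_coprod_yW //.
rewrite tensDr (linD (fps_assoc_mor A A A).1) scalerDr.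
by rewrite !fps_assoc_tens leg13_tens.
Qed.

(** Passing [x j], of weight 1, the factor [J_13] puts [E 1] into the third leg, which cancels the
    [E (- 1)] there. *)
Lemma leg12_Phi_J : leg12 Phi * leg13 J = leg13 J * Psi.
Proof.
have m12 := @leg12_mor K A; have m13 := @leg13_mor K A.
rewrite PhiE (am_exp coefs0_B m12).
apply: fps_exp_intertwine; [exact: coefs0_lin m12.1 coefs0_B | exact: coefs0_Psi |].
rewrite (lin_B m12.1) mulr_suml mulr_sumr !big_seq; apply: eq_bigr => j jr.
rewrite -scalerAl -scalerAr; congr (_ *: _).
have -> : x j \ox (y j * W) \ox E (- 1) = leg13 (x j \ox E (- 1)) * leg2 (y j * W).
  by rewrite leg13_tens /leg2 !tensM !mulr1 mul1r.
rewrite mulrA -(amM m13) (J_tens (c := 1)) ?scale1r ?hx //; last exact: s_E.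
rewrite NE (amM m13) -mulrA leg13_leg2_comm mulrA leg13_tens leg12_tens /leg2.
by rewrite !tensM !mulr1 mul1r.
Qed.

(** The two exponents share only the third leg, where [y j * W] commutes with [s]. *)
Lemma leg13_Phi_J : leg13 Phi * leg23 J = leg23 J * leg13 Phi.
Proof.
have m13 := @leg13_mor K A; have m23 := @leg23_mor K A.
rewrite PhiE JE (am_exp coefs0_B m13) (am_exp coefs0_hs m23).
apply: fps_exp_comm; first exact: coefs0_lin m23.1 coefs0_hs.
apply/commr_sym/fps_exp_comm; first exact: coefs0_lin m13.1 coefs0_B.
rewrite (lin_B m13.1) big_seq; apply: commr_sum => j jr; apply: comm_scale.
rewrite leg13_tens leg23_tens /GRing.comm !tensM !mulr1 !mul1r; congr (_ \ox _).
by apply/commrM; [exact/commr_sym/comm_s/yz | exact/comm_E].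
Qed.

Lemma chain_twist_cocycle : leg12 F * tens_idr D F = leg23 F * id_tens D F.
Proof.
have m12 := @leg12_mor K A; have m23 := @leg23_mor K A.
have -> : leg23 F * id_tens D F = id_tens DF F * leg23 F.
  by rewrite (id_tens_twisted Dmor F_unit) mulrVK // am_unit // F_unit.
have -> : id_tens DF F = id_tens DF J * id_tens DF Phi.
  by rewrite {2}FE (amM (id_tens_mor DFmor)).
rewrite id_tens_J id_tens_Phi FE (amM m12) (amM m23) (amM (tens_idr_mor Dmor)).
rewrite tens_idr_J tens_idr_Phi.
(* What remains is a computation with words in these factors: the two relations exchange [Phi_12]
   with [J_13], and [Phi_13] with [J_23]. *)
move: leg12_Phi_J leg13_Phi_J; rewrite /Psi; move: (fps_exp _) (leg12 J) (leg12 Phi).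
move: (leg13 J) (leg13 Phi) (leg23 J) (leg23 Phi) => j13 p13 j23 p23 psi j12 p12 e12 e13.
by rewrite !mulrA -[j12 * p12 * _]mulrA e12 -[_ * j23 * p13]mulrA -e13 !mulrA.
Qed.

(** * The universal R-matrix *)

Lemma am_J (C : algType K) (f : HH -> fps C) : alg_mor f -> f J = fps_exp (f (h \ox s)).
Proof. by rewrite JE => fA; rewrite (am_exp coefs0_hs fA). Qed.
Lemma am_Phi (C : algType K) (f : HH -> fps C) : alg_mor f ->
  f Phi = fps_exp (\sum_(j <- r) c2 *: f (a j)).
Proof. by rewrite PhiE => fA; rewrite (am_exp coefs0_B fA) (lin_B fA.1). Qed.

Local Notation b i := (y i * E (- 1)).

(** In the R-matrix the two factors coming from [J] stand between the products, so each product has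
    been carried across one of them. This is why it shows [e^(-sigma)] where [F] shows
    [e^(-2 sigma)]. *)
Lemma J_a j : j \in r -> J * a j = (x j \ox b j) * J.
Proof.
move=> jr; rewrite (J_tens (c := 1)) ?scale1r ?hx //; last first.
  by apply/commr_sym/commrM; [exact/commr_sym/comm_s/yz | exact/comm_E].
by rewrite -mulrA -ED; have -> : - 2 + 1 = - 1 :> fps K by ring.
Qed.

Lemma yE_comm i j k l : i \in r -> j \in r -> GRing.comm (y i * E k) (y j * E l).
Proof.
move=> ir jr; apply/commrM; apply/commr_sym/commrM.
- exact/yy.
- exact/yE.
- exact/commr_sym/yE.
- exact: EC.
Qed.

Lemma flip_chain_twist : fps_flip F =
  \prod_(j <- r) fps_exp (c2 *: (b j \ox x j)) * fps_exp (s \ox h).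
Proof.
have fA := fps_flip_mor A A.
rewrite FE (amM fA) flip_J (am_Phi fA) fps_exp_prod => [|i _|i j ir jr]; first last.
- by apply: comm_scale2; rewrite /GRing.comm !tensM xx // yE_comm.
- exact: coefs0_xiZ.
apply/esym/fps_exp_intertwine.
- by rewrite coefs_sum big1 // => i _; exact: coefs0_xiZ.
- by rewrite coefs_sum big1 // => i _; exact: coefs0_xiZ.
rewrite -flip_J mulr_suml mulr_sumr !big_seq; apply: eq_bigr => j jr.
rewrite -scalerAl -scalerAr; congr (_ *: _).
by rewrite -(amM fA) J_a // (amM fA) fps_flip_tens.
Qed.

Lemma chain_twistV : F^-1 =
  fps_exp (- (h \ox s)) * \prod_(j <- r) fps_exp (- (c2 *: (x j \ox b j))).
Proof.
rewrite FE (invrM J_unit Phi_unit) PhiE (fps_expV coefs0_B).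
have JV : J^-1 = fps_exp (- (h \ox s)) by rewrite JE; exact: fps_expV coefs0_hs.
rewrite -JV fps_exp_prod => [|i _|i j ir jr]; first last.
- apply/commrN/commr_sym/commrN/comm_scale2; by rewrite /GRing.comm !tensM xx // yE_comm.
- by rewrite coefsN coefs0_xiZ oppr0.
have B'0 : coefs (\sum_(j <- r) - (c2 *: (x j \ox b j)) : HH) 0 = 0.
  by rewrite coefs_sum big1 // => i _; rewrite coefsN coefs0_xiZ oppr0.
apply: fps_exp_intertwine => //; first by rewrite coefsN coefs0_B oppr0.
apply: (mulrI J_unit); rewrite !mulrA mulrV ?J_unit // mul1r.
apply: (canLR (mulrK J_unit)); rewrite BE -sumrN mulr_suml mulr_sumr !big_seq.
apply: eq_bigr => j jr; rewrite mulrN mulNr -scalerAl -scalerAr J_a //.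
Qed.

Theorem chain_twist_R : fps_flip F * F^-1 =
  \prod_(j <- r) fps_exp (c2 *: (b j \ox x j)) * fps_exp (s \ox h) *
  fps_exp (- (h \ox s)) * \prod_(j <- r) fps_exp (- (c2 *: (x j \ox b j))).
Proof. exact: etrans (congr2 *%R flip_chain_twist chain_twistV) (mulrA _ _ _). Qed.

(** * Counit normalisation of the twist *)

Section Counit.
Variable e : H -> fps K.
Hypotheses (eL : scalar e) (eM : monoid_morphism e).
Hypotheses (ez : e z = 0) (eh : e h = 0).
Hypothesis ey : {in r, forall i, e (y i) = 0}.
Hypothesis ex : {in r, forall i, e (x i) = 0}.

Lemma counit_s : e s = 0.
Proof.
have eA : @alg_mor K A K^o e by split.
have eu0 : e u = 0 by rewrite uE (linZ eA.1) ez; exact: (@scaler0 _ (fps K^o)).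
rewrite (am_s eA) eu0; have -> := @fps_ln1p0 K K^o; exact: (@scaler0 _ (fps K^o)).
Qed.

Lemma chain_twist_counitl : counit_idr e F = 1.
Proof.
have cA := counit_idr_mor eL eM; rewrite FE (amM cA) (am_J cA) (am_Phi cA).
rewrite (counit_idr_tens eL) eh scale0r fps_exp0 big_seq big1 ?fps_exp0 ?mulr1 // => j jr.
by rewrite (counit_idr_tens eL) ex // scale0r scaler0.
Qed.

Lemma chain_twist_counitr : id_counit e F = 1.
Proof.
have cA := id_counit_mor eL eM; rewrite FE (amM cA) (am_J cA) (am_Phi cA).
rewrite (id_counit_tens eL) counit_s scale0r fps_exp0 big_seq big1 ?fps_exp0 ?mulr1 // => j jr.
by rewrite (id_counit_tens eL) eM.2 ey // mul0r scale0r scaler0.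
Qed.

Theorem chain_twist : twist D e F.
Proof.
split; [exact: F_unit | exact: chain_twist_cocycle | exact: chain_twist_counitl
  | exact: chain_twist_counitr].
Qed.

(** * The twisted antipode *)

Section Antipode.
Variable S : H -> H.
Hypothesis hopfD : hopf_algebra D e S.
Hypotheses (S1 : S 1 = 1) (SM : forall t t', S (t * t') = S t' * S t).
Local Notation v := (twist_elt S F).
Local Notation SF := (twisted_antipode S F).

Let vU : v \is a GRing.unit := twist_elt_unit hopfD chain_twist S1 SM.
Let SFL : linear SF := twisted_antipode_linear F hopfD.

Lemma SF1 : SF 1 = 1.
Proof. by rewrite /twisted_antipode S1 mulr1 mulrV. Qed.
Lemma SFM t t' : SF (t * t') = SF t' * SF t.
Proof. by rewrite /twisted_antipode SM !mulrA mulrVK. Qed.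
Lemma SFX t k : SF (t ^+ k) = SF t ^+ k.
Proof. by elim: k => [|k ih]; rewrite ?SF1 // exprS exprSr SFM ih. Qed.

Let M := fps_tlift (fun t t' => SF t * t').
Lemma M_bilin : bilin (fun t t' => SF t * t').
Proof.
split=> [t'|t] c p q; first by rewrite SFL mulrDl -scalerAl.
by rewrite mulrDr -scalerAr.
Qed.
Lemma M_linear : linear M. Proof. exact: fps_tlift_linear M_bilin. Qed.
Lemma M_tens t t' : M (t \ox t') = SF t * t'.
Proof. exact: fps_tlift_tens M_bilin t t'. Qed.
Lemma M_coprod t : M (DF t) = e t *: 1.
Proof. exact: twisted_antipodel hopfD chain_twist S1 SM t. Qed.

(** The shape taken by the antipode axiom on a generator whose coproduct has a group-like second leg
    [E k]. *)
Lemma solve_E (p q : H) k : p * E k + q = 0 -> p = - (q * E (- k)).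
Proof. by move/eqP; rewrite addr_eq0 => /eqP pE; rewrite -mulNr -pE -mulrA EN mulr1. Qed.

Lemma twisted_antipode_z : SF z = - (z * W).
Proof.
apply: solve_E; have := M_coprod z.
by rewrite twisted_coprod_z (linD M_linear) !M_tens SF1 mul1r ez scale0r.
Qed.

Lemma twisted_antipode_u : SF u = - (u * W).
Proof. by rewrite uE (linZ SFL) twisted_antipode_z scalerN scalerAl. Qed.

(** On powers of a single element an anti-morphism is multiplicative, so [SF] passes through the
    logarithm. Then [1 + SF u = 1 - u W = W], that is, [2 SF s] and [- 2 s] have the same
    exponential. *)
Lemma twisted_antipode_s : SF s = - s.
Proof.
have c0 (t : H) : coefs t 0 = 0 -> coefs ((2 : fps K) *: t) 0 = 0.
  by move=> t0; rewrite coefs0Z t0 scaler0.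
have us : GRing.comm s u by exact/u_comm/commr_sym/z_s.
have SFu0 := coefs0_lin SFL coefs0_u.
have SFsE : SF s = 2^-1 *: fps_ln1p (SF u).
  rewrite [in LHS]sE (linZ SFL) (fps_ln1p_map coefs0_u SFL) // => k; exact: SFX.
apply: scaler2_inj; apply: fps_exp_inj.
- exact/c0/(coefs0_lin SFL)/coefs0_s.
- by apply: c0; rewrite coefsN coefs0_s oppr0.
- apply/comm_scale/commr_sym/comm_scale; rewrite SFsE; apply/comm_scale/(fps_ln1p_comm SFu0).
  rewrite twisted_antipode_u; apply/commr_sym/commrN/commr_sym/commrN/commrM => //.
  exact/commr_sym/s_E.
have -> : (2 : fps K) *: SF s = fps_ln1p (SF u).
  by rewrite SFsE scalerA mulrV ?scale1r //; exact: (fps_nat_unit K 1).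
rewrite (fps_exp_ln1p SFu0) twisted_antipode_u uW opprB addrCA subrr addr0.
by rewrite EE scalerN scaleNr.
Qed.

Lemma twisted_antipode_E k : SF (E k) = E (- k).
Proof.
rewrite [in LHS]EE (fps_exp_map (coefs0_sZ k) SFL) => [|n]; last exact: SFX.
by rewrite (linZ SFL) twisted_antipode_s scalerN -scaleNr EE.
Qed.

Lemma twisted_antipode_x i : i \in r -> SF (x i) = - (x i * E 1).
Proof.
move=> ir; rewrite -[in RHS](opprK 1); apply: solve_E; have := M_coprod (x i).
by rewrite twisted_coprod_x // (linD M_linear) !M_tens SF1 mul1r ex // scale0r.
Qed.

Lemma twisted_antipode_y i : i \in r -> SF (y i) = - (y i * E (- 3)).
Proof.
move=> ir; have := M_coprod (y i).
rewrite twisted_coprod_y // (linD M_linear) !M_tens ey // scale0r twisted_antipode_E.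
move=> /solve_E ->; rewrite -(yE _ ir) -mulrA -ED.
by have -> : - 2 + - 1 = - 3 :> fps K by ring.
Qed.

Lemma twisted_antipode_h :
  SF h = - (h * E 2) - (2 * c2) *: \sum_(j <- r) x j * y j.
Proof.
have := M_coprod h; rewrite eh scale0r.
rewrite twisted_coprod_h (linB M_linear) (linD M_linear) (linZ M_linear) (lin_sum M_linear).
rewrite !M_tens SF1 mul1r -addrA => /solve_E ->; rewrite opprK mulrBl opprD opprK.
congr (_ + _); rewrite -scalerAl -scalerN mulr_suml -sumrN; congr (_ *: _).
rewrite !big_seq; apply: eq_bigr => j jr; rewrite M_tens twisted_antipode_x // !mulNr.
(* [E 1] comes from the antipode of [x j], [E (- 3)] from the coproduct of [h], and [E 2] from
   inverting [W]; they cancel. *)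
congr (- _); rewrite -!mulrA -ED [E 1 * _]mulrA -yE // -mulrA -ED.
have -> : 1 + (- 3 + 2) = 0 :> fps K by ring.
by rewrite E0 mulr1.
Qed.

Hypothesis D_cocomm : forall t, fps_flip (D t) = D t.

(** Collects the results for an arbitrary algebra; the concrete enveloping algebra enters through
    the brackets and its standard Hopf structure alone. *)
Theorem chain_twist_quantization :
  [/\ twist D e F, v \is a GRing.unit, hopf_algebra DF e SF
    & triangular DF (fps_flip F * F^-1)] /\
  [/\ DF h = h \ox W + 1 \ox h - (2 * c2) *: \sum_(j <- r) x j \ox (y j * E (- 3)),
      {in r, forall i, DF (x i) = x i \ox E (- 1) + 1 \ox x i},
      {in r, forall i, DF (y i) = y i \ox E 1 + E 2 \ox y i}
    & DF z = z \ox E 2 + 1 \ox z] /\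
  ([/\ SF s = - s,
       {in r, forall i, SF (x i) = - (x i * E 1)}
     & {in r, forall i, SF (y i) = - (y i * E (- 3))}] /\
   SF z = - (z * W) /\
   SF h = - (h * E 2) - (2 * c2) *: \sum_(j <- r) x j * y j) /\
  fps_flip F * F^-1 =
  \prod_(j <- r) fps_exp (c2 *: (b j \ox x j)) * fps_exp (s \ox h) *
  fps_exp (- (h \ox s)) * \prod_(j <- r) fps_exp (- (c2 *: (x j \ox b j))).
Proof.
split; [split | split; [split | split; [split; [split | split] |]]].
- exact: chain_twist.
- exact: vU.
- exact: twisted_hopf_algebra hopfD chain_twist S1 SM.
- exact: twisted_triangular hopfD chain_twist D_cocomm.
- exact: twisted_coprod_h.
- exact: twisted_coprod_x.
- exact: twisted_coprod_y.
- exact: twisted_coprod_z.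
- exact: twisted_antipode_s.
- exact: twisted_antipode_x.
- exact: twisted_antipode_y.
- exact: twisted_antipode_z.
- exact: twisted_antipode_h.
- exact: chain_twist_R.
Qed.
End Antipode.
End Counit.

End ChainTwist.

(** * Brackets of the generators of [lieB] *)

Section LieBRelations.
Variables (K : fieldType) (N : nat).
Hypothesis N3 : (2 < N)%N.
Local Notation E := (mxunit K N).
Local Notation gen := (@lieB_gen K N).

Lemma lieB_genD X Y : gen (X + Y) = gen X + gen Y.
Proof.
have [iL _] := uea_inj_morphism (@lieB_br K N).
by rewrite /lieB_gen linearD (linD iL) fps_constD.
Qed.
Lemma lieB_gen0 : gen 0 = 0.
Proof.
have [iL _] := uea_inj_morphism (@lieB_br K N).
by rewrite /lieB_gen linear0 (lin0 iL) fps_const0.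
Qed.

(** Membership makes [vsproj] faithful on [X] and [Y], so a relation in the enveloping algebra
    follows from a commutator of matrices. *)
Lemma lieB_gen_bracket X Y Z : X \in lieB K N -> Y \in lieB K N ->
  X *m Y - Y *m X = Z -> gen X * gen Y = gen Y * gen X + gen Z.
Proof.
move=> XB YB <-; have [_ iM] := uea_inj_morphism (@lieB_br K N).
rewrite -!fps_constM -fps_constD; congr (_%:S).
have -> : uea_inj (@lieB_br K N) (vsproj (lieB K N) (X *m Y - Y *m X)) =
    uea_inj (@lieB_br K N) (lieB_br (vsproj _ X) (vsproj _ Y)).
  by rewrite /lieB_br !vsprojK.
by rewrite iM addrC subrK.
Qed.

Lemma lieB_gen_comm X Y : X \in lieB K N -> Y \in lieB K N ->
  X *m Y - Y *m X = 0 -> GRing.comm (gen X) (gen Y).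
Proof. by move=> XB YB /(lieB_gen_bracket XB YB); rewrite lieB_gen0 addr0. Qed.

Let N1 : (N == 1)%N = false.
Proof. by apply/negbTE; rewrite neq_ltn (ltn_trans _ N3) ?orbT. Qed.
Let N0 : (0 < N)%N. Proof. exact: ltn_trans N3. Qed.

Lemma mid_neq j : (1 < j < N)%N ->
  ((j == 1)%N = false) * ((j == N)%N = false) * ((1 == j)%N = false) * ((N == j)%N = false).
Proof.
case/andP=> j1 jN; rewrite ![1%N == _]eq_sym ![N == _]eq_sym.
by rewrite (gtn_eqF j1) (ltn_eqF jN).
Qed.

Lemma lieB_hz : gen (mxH1N K N) * gen (E 1%N N) =
  gen (E 1%N N) * gen (mxH1N K N) + gen (E 1%N N) *+ 2.
Proof.
rewrite mulr2n -lieB_genD; apply: lieB_gen_bracket; [exact: mem_lieBH | exact: mem_lieB1N |].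
rewrite /mxH1N mulmxBl mulmxBr !mxunitM N1 !eqxx N0 !leqnn /=.
by rewrite subr0 sub0r opprK.
Qed.

Lemma lieB_hx j : (1 < j < N)%N -> gen (mxH1N K N) * gen (E 1%N j) =
  gen (E 1%N j) * gen (mxH1N K N) + gen (E 1%N j).
Proof.
move=> jP; apply: lieB_gen_bracket; [exact: mem_lieBH | exact: mem_lieB1j |].
rewrite /mxH1N mulmxBl mulmxBr !mxunitM N1 !(mid_neq jP) !eqxx N0 /=.
by rewrite !subr0.
Qed.

Lemma lieB_hy j : (1 < j < N)%N -> gen (mxH1N K N) * gen (E j N) =
  gen (E j N) * gen (mxH1N K N) + gen (E j N).
Proof.
move=> jP; apply: lieB_gen_bracket; [exact: mem_lieBH | exact: mem_lieBjN |].
rewrite /mxH1N mulmxBl mulmxBr !mxunitM N1 !(mid_neq jP) !eqxx N0 !leqnn /=.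
by rewrite subr0 !sub0r opprK.
Qed.

Lemma lieB_xz j : (1 < j < N)%N -> GRing.comm (gen (E 1%N j)) (gen (E 1%N N)).
Proof.
move=> jP; apply: lieB_gen_comm; [exact: mem_lieB1j | exact: mem_lieB1N |].
by rewrite !mxunitM N1 !(mid_neq jP) subrr.
Qed.

Lemma lieB_yz j : (1 < j < N)%N -> GRing.comm (gen (E j N)) (gen (E 1%N N)).
Proof.
move=> jP; apply: lieB_gen_comm; [exact: mem_lieBjN | exact: mem_lieB1N |].
by rewrite !mxunitM N1 !(mid_neq jP) subrr.
Qed.

Lemma lieB_xx i j : (1 < i < N)%N -> (1 < j < N)%N ->
  GRing.comm (gen (E 1%N i)) (gen (E 1%N j)).
Proof.
move=> iP jP; apply: lieB_gen_comm; [exact: mem_lieB1j | exact: mem_lieB1j |].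
by rewrite !mxunitM !(mid_neq iP) !(mid_neq jP) subrr.
Qed.

Lemma lieB_yy i j : (1 < i < N)%N -> (1 < j < N)%N ->
  GRing.comm (gen (E i N)) (gen (E j N)).
Proof.
move=> iP jP; apply: lieB_gen_comm; [exact: mem_lieBjN | exact: mem_lieBjN |].
by rewrite !mxunitM !(mid_neq iP) !(mid_neq jP) subrr.
Qed.

Lemma lieB_xy i j : (1 < i < N)%N -> (1 < j < N)%N -> gen (E 1%N i) * gen (E j N) =
  gen (E j N) * gen (E 1%N i) + (if i == j then gen (E 1%N N) else 0).
Proof.
move=> iP jP; have -> : (if i == j then gen (E 1%N N) else 0) =
    gen (if i == j then E 1%N N else 0) by case: ifP; rewrite ?lieB_gen0.
apply: lieB_gen_bracket; [exact: mem_lieB1j | exact: mem_lieBjN |].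
have /andP[i1 /ltnW iN] := iP; rewrite !mxunitM N1 (ltnW i1) iN /= subr0.
by rewrite andbT.
Qed.
End LieBRelations.

Theorem mainTheorem3 (R : realType) (N : nat) (hN : (3 <= N)%N) :
  let U := uea (@lieB_br R[i] N) in
  let H : fps U := lieB_gen (mxH1N R[i] N) in
  let E (i j : nat) : fps U := lieB_gen (mxunit R[i] N i j) in
  let xi := fps_xi R[i] in
  let s : fps U := 2^-1 *: fps_ln1p ((2 * xi) *: E 1%N N) in
  let e (k : fps R[i]) : fps U := fps_exp (k *: s) in
  let F : fps (tens U U) := fps_exp (H \ox s) *
    \prod_(2 <= j < N) fps_exp ((2 * xi) *: (E 1%N j \ox (E j N * e (- 2)))) in
  let D : fps U -> fps (tens U U) := @lieB_coprod R[i] N in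
  let eps : fps U -> fps R[i] := @lieB_counit R[i] N in
  let S : fps U -> fps U := @lieB_antipode R[i] N in
  let DF := twisted_coprod D F in
  let SF := twisted_antipode S F in
  let RF := fps_flip F * F^-1 in
  [/\ twist D eps F,
      twist_elt S F \is a GRing.unit,
      hopf_algebra DF eps SF
    & triangular DF RF] /\
  [/\ DF H = H \ox e (- 2) + 1 \ox H
             - (4 * xi) *: \sum_(2 <= j < N) E 1%N j \ox (E j N * e (- 3)),
      forall i, (2 <= i < N)%N -> DF (E 1%N i) = E 1%N i \ox e (- 1) + 1 \ox E 1%N i,
      forall i, (2 <= i < N)%N -> DF (E i N) = E i N \ox e 1 + e 2 \ox E i N
    & DF (E 1%N N) = E 1%N N \ox e 2 + 1 \ox E 1%N N] /\
  ([/\ SF s = - s,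
       forall i, (2 <= i < N)%N -> SF (E 1%N i) = - (E 1%N i * e 1)
     & forall i, (2 <= i < N)%N -> SF (E i N) = - (E i N * e (- 3))] /\
   SF (E 1%N N) = - (E 1%N N * e (- 2)) /\
   SF H = - (H * e 2) - (4 * xi) *: \sum_(2 <= j < N) E 1%N j * E j N) /\
  RF = (\prod_(2 <= j < N) fps_exp ((2 * xi) *: ((E j N * e (- 1)) \ox E 1%N j)))
       * fps_exp (s \ox H) * fps_exp (- (H \ox s))
       * (\prod_(2 <= j < N) fps_exp (- ((2 * xi) *: (E 1%N j \ox (E j N * e (- 1)))))).
Proof.
move=> U H E xi s e F D eps S DF SF RF.
pose r := index_iota 2 N.
have rE j : j \in r -> (1 < j < N)%N by rewrite mem_index_iota.
have hz : H * E 1%N N = E 1%N N * H + E 1%N N *+ 2 := lieB_hz R[i] hN.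
have hx : {in r, forall j, H * E 1%N j = E 1%N j * H + E 1%N j}.
  by move=> j /rE; exact: lieB_hx.
have hy : {in r, forall j, H * E j N = E j N * H + E j N}.
  by move=> j /rE; exact: lieB_hy.
have xz : {in r, forall j, GRing.comm (E 1%N j) (E 1%N N)}.
  by move=> j /rE; exact: lieB_xz.
have yz : {in r, forall j, GRing.comm (E j N) (E 1%N N)}.
  by move=> j /rE; exact: lieB_yz.
have xx : {in r &, forall i j, GRing.comm (E 1%N i) (E 1%N j)}.
  by move=> i j /rE iP /rE jP; exact: lieB_xx.
have yy : {in r &, forall i j, GRing.comm (E i N) (E j N)}.
  by move=> i j /rE iP /rE jP; exact: lieB_yy.
have xy : {in r &, forall i j,
    E 1%N i * E j N = E j N * E 1%N i + (if i == j then E 1%N N else 0)}.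
  by move=> i j /rE iP /rE jP; exact: lieB_xy.
have hopfD : hopf_algebra D eps S := uea_hopf _.
have Dmor : alg_mor D := uea_coprod_mor _.
have SM : forall t t', S (t * t') = S t' * S t := @uea_antipodeM _ _ _.
have S1 : S 1 = 1 := uea_antipode1 _.
have Dcoc : forall t, fps_flip (D t) = D t := @uea_cocomm _ _ _.
have Dg X : D (lieB_gen X) = lieB_gen X \ox 1 + 1 \ox lieB_gen X by exact: uea_coprod_gen.
have eg X : eps (lieB_gen X) = 0 by exact: uea_counit_gen.
have Dh : D H = H \ox 1 + 1 \ox H by exact: Dg.
have DE i j : D (E i j) = E i j \ox 1 + 1 \ox E i j by exact: Dg.
have eh : eps H = 0 by exact: eg.
have eE i j : eps (E i j) = 0 by exact: eg.
have sE : s = 2^-1 *: fps_ln1p ((2 * xi) *: E 1%N N) by [].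
have EE : forall k, e k = fps_exp (k *: s) by [].
have FE0 : F = fps_exp (H \ox s) *
  \prod_(j <- r) fps_exp ((2 * xi) *: (E 1%N j \ox (E j N * e (- 2)))) by [].
rewrite /RF /SF /DF; clear RF SF DF Dg eg.
(* From here on only the relations collected above are used. *)
clearbody H E s e F D eps S.
(* One factor 2 is that of [2 * xi] in the twist, the other comes from the weight of [W]. *)
have xi4 : 4 * xi = 2 * (2 * xi) by rewrite mulrA -natrM.
rewrite xi4.
have u_r : uniq r by exact: iota_uniq.
have [tw [[dh dx dy dz] [[[ss sx sy] [sz sh]] rm]]] :=
  chain_twist_quantization hz (erefl _) sE EE (erefl _) u_r hx hy xz yz xx yy xy
    (erefl _) (erefl _) FE0 Dmor (DE _ _) Dh (fun i _ => DE _ _) (fun i _ => DE _ _)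
    (hopf_counit_linear hopfD) (hopf_counit_morphism hopfD) (eE _ _) eh (fun i _ => eE _ _)
    (fun i _ => eE _ _) hopfD S1 SM Dcoc.
have Er i : (2 <= i < N)%N -> i \in r by rewrite mem_index_iota.
split; [exact: tw | split; [split | split; [split; [split | split] |]]].
- exact: dh.
- by move=> i /Er; exact: dx.
- by move=> i /Er; exact: dy.
- exact: dz.
- exact: ss.
- by move=> i /Er; exact: sx.
- by move=> i /Er; exact: sy.
- exact: sz.
- exact: sh.
- exact: rm.
Qed.
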